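(* Let $A=\mathbb C[a_1,\dots,a_{12}]$ and let $\mathcal A_6$ be the homogeneous coordinate ring of the Cayley plane, with the LPA structure over $A$ generated by the seed $S$ with cluster $\{x_1,x_2,x_3,x_4,y_3\}$ and exchange polynomials $$\begin{aligned} F_{x_1}&= y_3 + a_{12}a_1,\\ F_{x_2}&= a_2x_1(y_3 + a_{10}x_4) + a_9x_3(y_3 + a_1a_{12}) + x_1x_3(a_7x_4 + a_4a_{12}),\\ F_{x_3}&= y_3 + a_3x_2 + a_{10}x_4,\\ F_{x_4}&= a_{11}(y_3 + a_3x_2) + x_3(a_4x_1 + a_6x_2 + a_1a_9),\\ F_{y_3}&= x_1x_4(a_5 x_2 + a_7x_3 + a_2a_{10}) + a_{12}x_3(a_4x_1 + a_1a_9)+ a_{12}x_2(a_6x_3 + a_8x_4 + a_3a_{11}). \end{aligned}$$ Then the positivity phenomenon holds for $\mathcal A_6$: all coefficients (of monomials in the frozen variables $a_1,\dots,a_{12}$ and the cluster variables of the seed) in the Laurent expansions of the cluster variables in the clusters of the LPA, and all coefficients in the exchange polynomials of each seed, are positive.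
   Context: **The ring $\mathcal A_6$.** Indices of $a,x,y$ are in $\mathbb Z/12$ and indices of $z$ are in $\mathbb Z/3$. $\mathcal A_6=\mathbb C[a_1,\dots,a_{12},x_1,\dots,x_{12},z_1,z_2,z_3]/I$ is the homogeneous coordinate ring of the Cayley plane $\mathbb{OP}^2=E_6/P_6\subset\mathbb P^{26}$ (an integral domain), where $I$ is generated by the 27 quadrics (12+12+3) $$\begin{aligned} &x_ix_{i+5}=a_{i+5}x_{i+2}+a_iz_{i+1}+a_{i+7}x_{i+3}+a_{i+2}a_{i+10},\\ &x_ix_{i+4}=x_{i+2}z_{i+2}-a_{i+2}x_{i+1}-a_{i+9}x_{i+3}+a_ia_{i+11},\\ &z_iz_{i+1}=x_{i+2}x_{i+8}+x_{i+5}x_{i+11}+a_{i+1}a_{i+7}+a_{i+4}a_{i+10}. \end{aligned}$$ Put $y_i:=x_iz_i-a_ix_{i-1}-a_{i+7}x_{i+1}$. The $a_i$ are frozen variables and $A=\mathbb C[a_1,\dots,a_{12}]$ is the coefficient ring. **Laurent phenomenon algebras (LPAs).** Let $A$ be a domain and $\mathcal F$ a degree $n$ transcendental field extension of $\mathrm{Frac}(A)$ (here $\mathcal F=\mathrm{Frac}(\mathcal A_6)$, $n=5$). A *seed* of rank $n$ is a pair $(\mathbf x,\mathbf F)$ where the cluster $\mathbf x=\{x_1,\dots,x_n\}$ (cluster variables) is a transcendence basis of $\mathcal F$ and $\mathbf F=\{F_1,\dots,F_n\}\subset A[x_1,\dots,x_n]$ are exchange polynomials such that (LP1) $F_i$ does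 not depend on $x_i$, and (LP2) $F_i$ is irreducible and not divisible by any $x_j$. The *exchange Laurent polynomial* is $\hat F_i=F_i\prod_{j\ne i}x_j^{-m_j}$, where $m_j\ge0$ is the maximal $m$ such that $F_i|_{x_j\leftarrow F_j/x_j}$ is divisible by $F_j^m$. *Mutation* at $i$ replaces $x_i$ by $x_i'$ with $x_ix_i'=\hat F_i$ and keeps the other cluster variables. Exchange polynomials change as follows: $F_i'=F_i$. For $j\neq i$, if $F_j$ does not depend on $x_i$ then $F_j'=F_j$ (up to a unit of $A$). Otherwise, (i) substitute: $(F_j')^*=F_j|_{x_i\leftarrow(\hat F_i|_{x_j\leftarrow0})/x_i'}$; (ii) divide out all common factors of $(F_j')^*$ with $\hat F_i|_{x_j\leftarrow 0}$; (iii) multiply by a monomial in the new cluster variables so that (LP1) and (LP2) hold. This determines $F_j'$ up to a unit of $A$. The seeds and cluster variables of the LPA are all those obtainable from $S$ by sequences of mutations. **Normalisation.** Cluster variables and exchange polynomials are only defined up to units of $A$ (nonzero constants). They are normalised as follows: the cluster variables are, up to units, the 32 elements $x_i,y_i$ ($i\in\mathbb Z/12$), $z_k$ ($k\in\mathbb Z/3$), $t_k=x_kx_{k+3}x_{k+6}x_{k+9}-a_{k+2}a_{k+5}a_{k+8}a_{k+11}$ ($k=1,2,3$), and $u_i=x_ix_{i+4}x_{i+8}-a_{i+3}a_{i+4}x_i-a_{i+7}a_{i+8}x_{i+4}-a_{i+11}a_ix_{i+8}-a_ia_{i+4}a_{i+8}-a_{i+3}a_{i+7}a_{i+11}$ ($i=1,2$).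 These representatives are used, and each exchange polynomial is scaled so that $x_ix_i'=\hat F_i$ holds for them. By the Laurent phenomenon every cluster variable is, in each cluster $\{v_1,\dots,v_5\}$ of the LPA, an element of $A[v_1^{\pm1},\dots,v_5^{\pm1}]$ (its Laurent expansion in that cluster). *)

(* Defs.v *)
From HB Require Import structures.
From mathcomp Require Import all_boot all_order all_algebra.
From mathcomp Require Import reals complex mpoly.

Set Implicit Arguments.
Unset Strict Implicit.
Unset Printing Implicit Defensive.

Import Order.TTheory GRing.Theory Num.Theory.

Local Open Scope ring_scope.

(** * Laurent phenomenon algebras of rank [n] over a domain [A] *)

Definition irreducible_elt (D : idomainType) (p : D) : Prop :=
  [/\ p != 0, p \isn't a GRing.unit &
      forall q r : D, p = q * r -> q \is a GRing.unit \/ r \is a GRing.unit].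

Section LaurentPhenomenonAlgebra.

Variables (A : idomainType) (n : nat).

Local Notation P := {mpoly A[n]}.
(* Laurent polynomials in the formal variables ['X_0, ..., 'X_(n-1)] are
   handled inside the field of rational functions. *)
Local Notation K := {fraction P}.

Definition mfree (i : 'I_n) (p : P) : bool :=
  all (fun m : 'X_{1..n} => m i == 0%N) (msupp p).

Definition ratC (c : A) : K := tofrac (c%:MP : P).
Definition ratX (k : 'I_n) : K := tofrac ('X_k : P).

(* Membership in A['X_0^{±1}, ..., 'X_(n-1)^{±1}], and divisibility there. *)
Definition laurent (f : K) : Prop :=
  exists (p : P) (m : 'X_{1..n}), f = tofrac p / tofrac ('X_[m] : P).

Definition laurent_dvd (f g : K) : Prop := exists2 h : K, laurent h & g = h * f.

Section Seeds.

Variables (F : fieldType) (emb : A -> F).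

Definition transcendence_basis (x : 'I_n -> F) : Prop :=
  (forall p : P, mmap emb x p = 0 -> p = 0) /\
  (forall f : F, exists2 q : {poly P}, q != 0 & root (map_poly (mmap emb x) q) f).

(* The variable ['X_k] of the [k]-indexed exchange polynomials of a seed stands
   for the [k]-th cluster variable of that same seed. *)
Record seed := Seed { cluster : 'I_n -> F; exch : 'I_n -> P }.

Definition LP1 (s : seed) : Prop := forall i, mfree i (exch s i).

Definition LP2 (s : seed) : Prop :=
  forall i, irreducible_elt (exch s i) /\
            (forall (j : 'I_n) (q : P), exch s i <> q * 'X_j).

Definition is_seed (s : seed) : Prop :=
  [/\ transcendence_basis (cluster s), LP1 s & LP2 s].

(* [m j] is the maximal exponent such that [F_i] with ['X_j] replaced by
   [F_j / 'X_j] is divisible by [F_j ^ m j]; the value [m i] is irrelevant.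
   As [F_j] is divisible by no variable, it does not matter which variables
   are inverted in the ring where divisibility is tested. *)
Definition exch_exponents (s : seed) (i : 'I_n) (m : 'I_n -> nat) : Prop :=
  forall j, j != i ->
    let Fj := tofrac (exch s j) in
    let G := mmap ratC [eta ratX with j |-> Fj / ratX j] (exch s i) in
    laurent_dvd (Fj ^+ m j) G /\
    (forall r : nat, laurent_dvd (Fj ^+ r) G -> (r <= m j)%N).

(* Value of the exchange Laurent polynomial at a point [v] of a field [E]. *)
Definition exch_laurent (E : fieldType) (h : A -> E) (s : seed) (i : 'I_n)
    (m : 'I_n -> nat) (v : 'I_n -> E) : E :=
  mmap h v (exch s i) * \prod_(j < n | j != i) v j ^- m j.

(* The exchange Laurent polynomial at ['X_j <- 0]. It is only used when [F_j]
   depends on ['X_i]; then [m j = 0], and the factor [0 ^- 0] is [1]. *)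
Definition exch_laurent0 (s : seed) (i : 'I_n) (m : 'I_n -> nat) (j : 'I_n) : K :=
  exch_laurent ratC s i m [eta ratX with j |-> 0].

(* [F'] is a possible value of [F_j'] after mutation at [i], when [F_j] depends
   on ['X_i]. In [F'], in [G] and in [H] the variable ['X_i] stands for the new
   cluster variable. The [ds] are the common factors successively divided out
   of [G], which leave [H] coprime to [h0] in the Laurent polynomial ring. *)
Definition mutated_exch (s : seed) (i : 'I_n) (m : 'I_n -> nat) (j : 'I_n)
    (F' : P) : Prop :=
  let h0 := exch_laurent0 s i m j in
  let G := mmap ratC [eta ratX with i |-> h0 / ratX i] (exch s j) in
  exists (ds : seq K) (H : K) (e : 'I_n -> int),
    [/\ G = (\prod_(d <- ds) d) * H,
        (forall d, d \in ds -> laurent d /\ laurent_dvd d h0),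
        laurent H,
        (forall d, laurent d -> laurent_dvd d H -> laurent_dvd d h0 ->
           laurent_dvd d 1) &
        tofrac F' = H * \prod_(k < n) ratX k ^ e k].

Definition mutation (s : seed) (i : 'I_n) (s' : seed) : Prop :=
  is_seed s' /\
  exists m : 'I_n -> nat,
    [/\ exch_exponents s i m,
        cluster s i * cluster s' i = exch_laurent emb s i m (cluster s),
        (forall k, k != i -> cluster s' k = cluster s k),
        exch s' i = exch s i &
        forall j, j != i ->
          if mfree i (exch s j)
          then exists2 c : A, c \is a GRing.unit & exch s' j = c *: exch s j
          else mutated_exch s i m j (exch s' j)].

Inductive lpa_seed (s0 : seed) : seed -> Prop :=
| lpa_seed_init : lpa_seed s0 s0
| lpa_seed_mutation (s s' : seed) (i : 'I_n) :
    lpa_seed s0 s -> mutation s i s' -> lpa_seed s0 s'.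

End Seeds.

End LaurentPhenomenonAlgebra.

(** * The Cayley plane *)

Section CayleyPlane.

Variable R : realType.

Local Notation C := (complex R).

(* Indices are natural numbers read modulo 12 (for a, x, y) or 3 (for z);
   in particular [a_12] is the variable of index 0. *)
Definition coef_ring : idomainType := {mpoly C[12]}.

Definition ambient : idomainType := {mpoly C[12 + 12 + 3]}.

Definition av (i : nat) : ambient := 'X_(lshift 3 (lshift 12 (@inZp 11 i))).
Definition xv (i : nat) : ambient := 'X_(lshift 3 (rshift 12 (@inZp 11 i))).
Definition zv (k : nat) : ambient := 'X_(rshift (12 + 12) (@inZp 2 k)).

Definition quadric5 (i : nat) : ambient :=
  xv i * xv (i + 5)
  - (av (i + 5) * xv (i + 2) + av i * zv (i + 1) + av (i + 7) * xv (i + 3)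
     + av (i + 2) * av (i + 10)).

Definition quadric4 (i : nat) : ambient :=
  xv i * xv (i + 4)
  - (xv (i + 2) * zv (i + 2) - av (i + 2) * xv (i + 1) - av (i + 9) * xv (i + 3)
     + av i * av (i + 11)).

Definition quadricz (i : nat) : ambient :=
  zv i * zv (i + 1)
  - (xv (i + 2) * xv (i + 8) + xv (i + 5) * xv (i + 11)
     + av (i + 1) * av (i + 7) + av (i + 4) * av (i + 10)).

Definition cayley_ideal (p : ambient) : Prop :=
  exists (b c : 'I_12 -> ambient) (d : 'I_3 -> ambient),
    p = \sum_(i < 12) b i * quadric5 i + \sum_(i < 12) c i * quadric4 i
        + \sum_(i < 3) d i * quadricz i.

(* [i + 11] is the index [i - 1]. *)
Definition yv (i : nat) : ambient :=
  xv i * zv i - av i * xv (i + 11) - av (i + 7) * xv (i + 1).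

Definition tv (k : nat) : ambient :=
  xv k * xv (k + 3) * xv (k + 6) * xv (k + 9)
  - av (k + 2) * av (k + 5) * av (k + 8) * av (k + 11).

Definition uv (i : nat) : ambient :=
  xv i * xv (i + 4) * xv (i + 8)
  - av (i + 3) * av (i + 4) * xv i
  - av (i + 7) * av (i + 8) * xv (i + 4)
  - av (i + 11) * av i * xv (i + 8)
  - av i * av (i + 4) * av (i + 8)
  - av (i + 3) * av (i + 7) * av (i + 11).

Definition representatives : seq ambient :=
  [seq xv i | i <- iota 1 12] ++ [seq yv i | i <- iota 1 12]
  ++ [seq zv k | k <- iota 1 3] ++ [seq tv k | k <- iota 1 3]
  ++ [seq uv i | i <- iota 1 2].

Definition coef_incl (c : coef_ring) : ambient :=
  c \mPo [tuple ('X_(lshift 3 (lshift 12 k)) : ambient) | k < 12].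

Section LPAStructure.

Variables (A6 : idomainType) (pi : {rmorphism ambient -> A6}).

(* [A6] is, through [pi], the quotient of [ambient] by the ideal of quadrics. *)
Definition coordinate_ring : Prop :=
  (forall f : A6, exists p : ambient, pi p = f) /\
  (forall p : ambient, pi p = 0 <-> cayley_ideal p).

Definition to_frac (p : ambient) : {fraction A6} := tofrac (pi p).

Definition coef_emb (c : coef_ring) : {fraction A6} := to_frac (coef_incl c).

Definition cayley_seed : Type := seed coef_ring 5 {fraction A6}.

(* [a_i] as a constant of the ring containing the exchange polynomials. *)
Definition frz (i : nat) : {mpoly coef_ring[5]} :=
  ('X_(@inZp 11 i) : coef_ring)%:MP.

Definition initial_seed : cayley_seed :=
  let x1 := 'X_(@inZp 4 0%N) in
  let x2 := 'X_(@inZp 4 1%N) in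
  let x3 := 'X_(@inZp 4 2%N) in
  let x4 := 'X_(@inZp 4 3%N) in
  let y3 := 'X_(@inZp 4 4%N) in
  Seed
    (tnth [tuple to_frac (xv 1); to_frac (xv 2); to_frac (xv 3); to_frac (xv 4);
                 to_frac (yv 3)])
    (tnth [tuple
      y3 + frz 12 * frz 1;
      frz 2 * x1 * (y3 + frz 10 * x4) + frz 9 * x3 * (y3 + frz 1 * frz 12)
        + x1 * x3 * (frz 7 * x4 + frz 4 * frz 12);
      y3 + frz 3 * x2 + frz 10 * x4;
      frz 11 * (y3 + frz 3 * x2) + x3 * (frz 4 * x1 + frz 6 * x2 + frz 1 * frz 9);
      x1 * x4 * (frz 5 * x2 + frz 7 * x3 + frz 2 * frz 10)
        + frz 12 * x3 * (frz 4 * x1 + frz 1 * frz 9)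
        + frz 12 * x2 * (frz 6 * x3 + frz 8 * x4 + frz 3 * frz 11)]).

Definition cayley_lpa_seed (s : cayley_seed) : Prop :=
  lpa_seed coef_emb initial_seed s.

Definition is_representative (w : {fraction A6}) : Prop :=
  exists2 p : ambient, p \in representatives & w = to_frac p.

(* Mutation leaves exchange polynomials free up to units. A seed is normalised
   when its cluster variables, and those obtained from it by one mutation, are
   exactly (not only up to a unit) among the 32 representatives. *)
Definition normalised (s : cayley_seed) : Prop :=
  (forall i, is_representative (cluster s i)) /\
  (forall i, exists (m : 'I_5 -> nat) (w : {fraction A6}),
     [/\ exch_exponents s i m, is_representative w &
         cluster s i * w = exch_laurent coef_emb s i m (cluster s)]).

(* The order of [C] is the one of [numClosedFieldType]: [0 < c] says that [c]
   is a positive real number. *)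
Definition positive_coefs (p : {mpoly coef_ring[5]}) : Prop :=
  forall (m : 'X_{1..5}) (r : 'X_{1..12}), r \in msupp (p@_m) -> 0 < (p@_m)@_r.

(* The Laurent expansion of [w] in [v] exists and has positive coefficients; it
   is unique since a cluster is a transcendence basis. *)
Definition laurent_positive (v : 'I_5 -> {fraction A6}) (w : {fraction A6}) : Prop :=
  exists (p : {mpoly coef_ring[5]}) (m : 'X_{1..5}),
    w = mmap coef_emb v p / mmap1 v m /\ positive_coefs p.

End LPAStructure.

End CayleyPlane.

(* Main.v *)
Require Import Defs.
From HB Require Import structures.
From mathcomp Require Import all_boot all_order all_algebra.
From mathcomp Require Import reals complex mpoly.
From mathcomp Require Import ring zify.
Set Implicit Arguments.
Unset Strict Implicit.
Unset Printing Implicit Defensive.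
Import Order.TTheory GRing.Theory Num.Theory.

(** The structure is finite, and symmetric enough for a finite proof.

    The 44 generators are the frozen [a_i] and the elements [x_i], [y_i], [z_k],
    [t_k], [u_i]. A dihedral group of order 24, generated by the shift of all
    indices and by the reflection [x_i -> x_(-i)], [a_i -> a_(7-i)], permutes
    them and preserves their relations. Up to this group and up to non-zero
    constants, mutation of the initial seed only leads to 15 seeds, and in each
    of them the exchange polynomials are sums of monomials with coefficient 1.
    The list [seeds] gives one seed of each orbit and, for each of its
    variables, the variable that replaces it and the orbit and symmetry that
    describe the mutated seed. The invariant [framed] says that a seed is, up to
    constants [c] on its variables and [e] on its exchange polynomials, the
    image of a listed seed by a symmetry; [framed_initial] and
    [framed_mutation] show that every seed of the structure has this form.

    Mutation is characterised by divisibility properties in a ring of Laurent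
    polynomials, so [framed_mutation] has to show that these properties leave a single
    solution.
    - The exponents of the exchange Laurent polynomials are all 0 or 1
      ([exch_exponents_expo]). A division of polynomials bounds an exponent
      from below; a point where the divisor vanishes and the quotient does not
      bounds it from above.
    - A mutated exchange polynomial [F'] is irreducible, so it is enough to find
      a non-unit that divides it ([irreducible_laurent_dvd]). The tabulated
      polynomial [T'] generates a prime ideal of the Laurent ring, because it is
      of degree 1 in some variable ([linear_laurent_prime]). It divides the
      result [G] of the substitution, and it does not divide [h0], as it has a
      zero where [h0] does not vanish. So it divides none of the common factors
      removed from [G], hence it divides [F'] ([mutated_exch_unique]).
    - The new variable is the tabulated generator because of a relation among
      the generators. Where [x_1] is invertible, the quadrics express ten of
      the [x], [a] and [z] through the others, and the definitions give [y],
      [t] and [u]; substituting these expressions proves every relation that is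
      used ([chart_relation]).

    For the expansions, the exchange relations and three further relations
    express all 32 cluster variables one after the other, from any of the 15
    clusters, as positive polynomials in the ones already obtained divided by
    monomials of the cluster ([chain_expansions]).

    It remains to see that the constants of a normalised seed are positive. The
    cone contains the point [a_i = 1], [x_i = 3] for odd [i], [x_i = 5] for even
    [i], [z_k = 6], where all the generators are positive. If two generators
    are proportional, comparing their values at this point shows that the
    ratio is positive ([proportional_gt0]). In a normalised seed the variables
    and their replacements are proportional to generators both by hypothesis
    and by the invariant, which determines the signs of all [c] and [e]. *)

(** * Positive polynomials as lists of monomials *)

(** Generators are numbered, a monomial is a list of generators with
    repetitions, and a polynomial is a list of monomials. All coefficients are
    thus natural numbers, and positivity is built in. *)

Definition mon := seq nat.
Definition ppoly := seq mon.

Definition pvar (k : nat) : ppoly := [:: [:: k]].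
Definition padd (p q : ppoly) : ppoly := p ++ q.
Definition pmul (p q : ppoly) : ppoly := [seq m1 ++ m2 | m1 <- p, m2 <- q].
Definition pexp (p : ppoly) (n : nat) : ppoly := iter n (pmul p) [:: [::]].

Definition ev (S : comNzRingType) (rho : nat -> S) (p : ppoly) : S :=
  (\sum_(m <- p) \prod_(k <- m) rho k)%R.

Definition prename (g : nat -> nat) (p : ppoly) : ppoly := map (map g) p.

(** Lexicographic order on sorted monomials, where the smallest number is the
    largest generator and a monomial comes before its proper prefixes. It is
    compatible with products, so that the head of [nf q] is a leading
    monomial. *)
Fixpoint lexle (m d : mon) : bool :=
  match m, d with
  | _, [::] => true
  | [::], _ :: _ => false
  | x :: m', y :: d' => (x < y) || (x == y) && lexle m' d'
  end.

Definition nfm : mon -> mon := sort leq.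
Definition nf (p : ppoly) : ppoly := sort lexle (map nfm p).
Definition peq (p q : ppoly) : bool := nf p == nf q.

Definition pfree (v : nat) (p : ppoly) : bool := all (fun m => v \notin m) p.

(** The part of degree 0 in [v], and the quotient by [v] of the rest. *)
Definition pcoef0 (v : nat) (p : ppoly) : ppoly := [seq m <- p | v \notin m].
Definition pquo (v : nat) (p : ppoly) : ppoly := [seq rem v m | m <- p & v \in m].

(** Division by leading monomials. It yields the quotient when [q] divides [p];
    this is only relied upon after the product has been compared to [p]. *)
Fixpoint pquotient_rec (n : nat) (p q : ppoly) : ppoly :=
  if n is n'.+1 then
    if p is m :: _ then
      let e := foldr (fun v r => rem v r) m (head [::] q) in
      e :: pquotient_rec n' (foldr (fun d r => rem (nfm (e ++ d)) r) p q) q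
    else [::]
  else [::].
Definition pquotient (p q : ppoly) : ppoly := pquotient_rec (size p) (nf p) (nf q).

(** [dn ^ D] times the value of [p] at [v := nu / dn]. *)
Definition psubst (v : nat) (nu : ppoly) (dn : mon) (D : nat) (p : ppoly) : ppoly :=
  flatten [seq pmul (pmul [:: [seq k <- m | k != v]] (pexp nu (count_mem v m)))
                    (pexp [:: dn] (D - count_mem v m)) | m <- p].
Definition pdeg (v : nat) (p : ppoly) : nat := foldr maxn 0 (map (count_mem v) p).

(** A point is given by the coordinates that differ from 1. *)
Definition point := seq (nat * int).
Definition pt (z : point) (k : nat) : int :=
  nth 1%R (unzip2 z) (index k (unzip1 z)).
Definition evalz (z : nat -> int) (p : ppoly) : int :=
  foldr (fun m s => (foldr (fun k t => z k * t) 1 m + s)%R) 0%R p.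

(** * Generators, their relations and their symmetries *)

(** The numbers 0 to 43 stand for [a], [x], [z], [y], [t] and [u], in this
    order; in particular 13 is [x_1]. The number 44 is left for its inverse. *)

Definition ax (i : nat) := i %% 12.
Definition xx (i : nat) := 12 + i %% 12.
Definition zx (i : nat) := 24 + i %% 3.
Definition yx (i : nat) := 27 + i %% 12.
Definition tx (i : nat) := 39 + i %% 3.
Definition ux (i : nat) := 42 + i %% 2.

(** An equation between two positive polynomials: the terms of negative sign are
    moved to the other side. *)
Definition prel := (ppoly * ppoly)%type.

Definition quad5 (i : nat) : prel :=
  ([:: [:: xx i; xx (i + 5)]],
   [:: [:: ax (i + 5); xx (i + 2)]; [:: ax i; zx (i + 1)];
       [:: ax (i + 7); xx (i + 3)]; [:: ax (i + 2); ax (i + 10)]]).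
Definition quad4 (i : nat) : prel :=
  ([:: [:: xx i; xx (i + 4)]; [:: ax (i + 2); xx (i + 1)];
       [:: ax (i + 9); xx (i + 3)]],
   [:: [:: xx (i + 2); zx (i + 2)]; [:: ax i; ax (i + 11)]]).
Definition quadz (i : nat) : prel :=
  ([:: [:: zx i; zx (i + 1)]],
   [:: [:: xx (i + 2); xx (i + 8)]; [:: xx (i + 5); xx (i + 11)];
       [:: ax (i + 1); ax (i + 7)]; [:: ax (i + 4); ax (i + 10)]]).
Definition defy (i : nat) : prel :=
  ([:: [:: yx i]; [:: ax i; xx (i + 11)]; [:: ax (i + 7); xx (i + 1)]],
   [:: [:: xx i; zx i]]).
Definition deft (i : nat) : prel :=
  ([:: [:: tx i]; [:: ax (i + 2); ax (i + 5); ax (i + 8); ax (i + 11)]],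
   [:: [:: xx i; xx (i + 3); xx (i + 6); xx (i + 9)]]).
Definition defu (i : nat) : prel :=
  ([:: [:: ux i]; [:: ax (i + 3); ax (i + 4); xx i];
       [:: ax (i + 7); ax (i + 8); xx (i + 4)];
       [:: ax (i + 11); ax i; xx (i + 8)];
       [:: ax i; ax (i + 4); ax (i + 8)];
       [:: ax (i + 3); ax (i + 7); ax (i + 11)]],
   [:: [:: xx i; xx (i + 4); xx (i + 8)]]).

(** The cubics of [u_1] and [u_2] take the same value after a shift of the
    indices by 2, but only modulo the quadrics: the relations [defu 3] and
    [defu 4] make [base] stable under the shift, while [base0] holds by
    definition. *)
Definition base0 : seq prel :=
  map quad5 (iota 0 12) ++ map quad4 (iota 0 12) ++ map quadz (iota 0 3)
  ++ map defy (iota 0 12) ++ map deft (iota 0 3) ++ map defu (iota 1 2).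
Definition base : seq prel := base0 ++ map defu (iota 3 2).

Definition rot (v : nat) : nat :=
  if v < 12 then ax (v + 1) else if v < 24 then xx (v - 12 + 1)
  else if v < 27 then zx (v - 24 + 1) else if v < 39 then yx (v - 27 + 1)
  else if v < 42 then tx (v - 39 + 1) else ux (v - 42 + 1).
(** The reflection [x_i -> x_(-i)], [a_i -> a_(7-i)]. *)
Definition refl (v : nat) : nat :=
  if v < 12 then ax (19 - v) else if v < 24 then xx (24 - v)
  else if v < 27 then zx (27 - v) else if v < 39 then yx (39 - v)
  else if v < 42 then tx (42 - v) else v.

Definition act (g : bool * nat) (v : nat) : nat :=
  iter g.2 rot (if g.1 then refl v else v).

Definition pres (g : nat -> nat) : bool :=
  all (fun r => has (fun r' => peq (prename g r.1) r'.1 && peq (prename g r.2) r'.2) base)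
      base.
(** A symmetry is tabulated, as it is applied many times. *)
Definition acttab (g : bool * nat) : seq nat := mkseq (act g) 44.
Definition tact (g : bool * nat) : nat -> nat :=
  let tb := acttab g in fun v => nth 44 tb v.

(** * The seeds up to symmetry *)

(** The data about one variable [evar] of a seed: its exchange polynomial
    [epoly], an integral zero [ezero] of it where all cluster variables are 1,
    a proof [eprime] that it is prime (see [primeb]), and the generator
    [epartner] that replaces [evar] by mutation. The mutated seed is the image
    of the seed number [etarget] of the list by the symmetry [eact]. *)
Record entry := Entry {
  evar : nat;
  epoly : ppoly;
  ezero : point;
  eprime : seq (nat * point);
  epartner : nat;
  etarget : nat;
  eact : bool * nat }.

(** The relation [rvar * rden = rpoly], where [rden] is a monomial. *)
Record relation := Relation { rvar : nat; rden : mon; rpoly : ppoly }.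

Section Data.
Local Notation a1 := 1 (only parsing).
Local Notation a2 := 2 (only parsing).
Local Notation a3 := 3 (only parsing).
Local Notation a4 := 4 (only parsing).
Local Notation a5 := 5 (only parsing).
Local Notation a6 := 6 (only parsing).
Local Notation a7 := 7 (only parsing).
Local Notation a8 := 8 (only parsing).
Local Notation a9 := 9 (only parsing).
Local Notation a10 := 10 (only parsing).
Local Notation a11 := 11 (only parsing).
Local Notation a12 := 0 (only parsing).
Local Notation x1 := 13 (only parsing).
Local Notation x2 := 14 (only parsing).
Local Notation x3 := 15 (only parsing).
Local Notation x4 := 16 (only parsing).
Local Notation x5 := 17 (only parsing).
Local Notation x6 := 18 (only parsing).
Local Notation x7 := 19 (only parsing).
Local Notation x8 := 20 (only parsing).
Local Notation x9 := 21 (only parsing).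
Local Notation x10 := 22 (only parsing).
Local Notation x11 := 23 (only parsing).
Local Notation x12 := 12 (only parsing).
Local Notation z1 := 25 (only parsing).
Local Notation z2 := 26 (only parsing).
Local Notation z3 := 24 (only parsing).
Local Notation y1 := 28 (only parsing).
Local Notation y2 := 29 (only parsing).
Local Notation y3 := 30 (only parsing).
Local Notation y4 := 31 (only parsing).
Local Notation y5 := 32 (only parsing).
Local Notation y6 := 33 (only parsing).
Local Notation y7 := 34 (only parsing).
Local Notation y8 := 35 (only parsing).
Local Notation y9 := 36 (only parsing).
Local Notation y10 := 37 (only parsing).
Local Notation y11 := 38 (only parsing).
Local Notation y12 := 27 (only parsing).
Local Notation t1 := 40 (only parsing).
Local Notation t2 := 41 (only parsing).
Local Notation t3 := 39 (only parsing).
Local Notation u1 := 43 (only parsing).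
Local Notation u2 := 42 (only parsing).

Local Coercion pvar : nat >-> ppoly.
Local Notation "p + q" := (padd p q).
Local Notation "p * q" := (pmul p q).

Definition seeds : seq (seq entry) := [::
  [:: Entry x1
      (a12 * a1 + y3)
      [:: (a12, -1)]%Z [:: (y3, [::])]
      x5 0 (true, 6);
    Entry x2
      (a12 * a1 * a9 * x3 + a12 * a4 * x1 * x3 + a2 * a10 * x1 * x4 + a2 * x1
      * y3 + a7 * x1 * x3 * x4 + a9 * x3 * y3)
      [:: (a12, -2)]%Z [:: (a7, [::])]
      y5 1 (false, 0);
    Entry x3
      (a3 * x2 + a10 * x4 + y3)
      [:: (a3, -2)]%Z [:: (a3, [::])]
      z3 2 (false, 0);
    Entry x4
      (a1 * a9 * x3 + a3 * a11 * x2 + a4 * x1 * x3 + a6 * x2 * x3 + a11 * y3)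
      [:: (a1, 0); (a3, -3)]%Z [:: (a4, [::])]
      y1 3 (false, 0);
    Entry y3
      (a12 * a1 * a9 * x3 + a12 * a3 * a11 * x2 + a12 * a4 * x1 * x3 + a12 *
      a6 * x2 * x3 + a12 * a8 * x2 * x4 + a2 * a10 * x1 * x4 + a5 * x1 * x2 *
      x4 + a7 * x1 * x3 * x4)
      [:: (a12, -1); (a1, -1)]%Z [:: (a5, [::])]
      y2 0 (true, 5)];

  [:: Entry x1
      (a12 * a1 + y3)
      [:: (a12, -1)]%Z [:: (y3, [::])]
      x5 3 (false, 2);
    Entry x3
      (a2 * a3 + y5)
      [:: (a2, -1)]%Z [:: (y5, [::])]
      x7 4 (false, 0);
    Entry x4
      (a12 * a1 * a3 * a9 * a11 * x3 + a12 * a1 * a6 * a9 * x3 * x3 + a12 * a3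
      * a4 * a11 * x1 * x3 + a12 * a4 * a6 * x1 * x3 * x3 + a1 * a9 * x1 * x3
      * y5 + a2 * a3 * a11 * x1 * y3 + a2 * a6 * x1 * x3 * y3 + a3 * a9 * a11
      * x3 * y3 + a4 * x1 * x1 * x3 * y5 + a6 * a9 * x3 * x3 * y3 + a11 * x1 *
      y3 * y5)
      [:: (a12, -3); (a1, 0)]%Z [:: (a2, [:: (a3, -1)]%Z); (a6, [::])]
      u1 5 (false, 0);
    Entry y3
      (a12 * a3 * a11 + a12 * a6 * x3 + a12 * a8 * x4 + a5 * x1 * x4 + x1 *
      y5)
      [:: (a12, 2); (a3, -3)]%Z [:: (a5, [::])]
      z2 6 (false, 0);
    Entry y5
      (a12 * a1 * a9 * x3 + a12 * a4 * x1 * x3 + a2 * a10 * x1 * x4 + a2 * x1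
      * y3 + a7 * x1 * x3 * x4 + a9 * x3 * y3)
      [:: (a12, -2)]%Z [:: (a7, [::])]
      x2 0 (false, 0)];

  [:: Entry x1
      (a12 * a1 + y3)
      [:: (a12, -1)]%Z [:: (y3, [::])]
      x5 2 (true, 6);
    Entry x2
      (a12 * a1 * a9 + a12 * a4 * x1 + a2 * x1 * z3 + a7 * x1 * x4 + a9 * y3)
      [:: (a12, -1); (a1, 2)]%Z [:: (a2, [::])]
      x7 7 (false, 0);
    Entry x4
      (a1 * a9 + a4 * x1 + a6 * x2 + a11 * z3)
      [:: (a6, -3)]%Z [:: (a4, [::])]
      x11 6 (false, 10);
    Entry y3
      (a12 * a1 * a3 * a9 * x2 + a12 * a1 * a9 * a10 * x4 + a12 * a3 * a4 * x1
      * x2 + a12 * a3 * a6 * x2 * x2 + a12 * a3 * a11 * x2 * z3 + a12 * a4 *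
      a10 * x1 * x4 + a12 * a6 * a10 * x2 * x4 + a12 * a8 * x2 * x4 * z3 + a2
      * a10 * x1 * x4 * z3 + a3 * a7 * x1 * x2 * x4 + a5 * x1 * x2 * x4 * z3 +
      a7 * a10 * x1 * x4 * x4)
      [:: (a12, -1); (a1, -1)]%Z [:: (a5, [::])]
      y12 6 (true, 5);
    Entry z3
      (a3 * x2 + a10 * x4 + y3)
      [:: (a3, -2)]%Z [:: (a3, [::])]
      x3 0 (false, 0)];

  [:: Entry x1
      (a12 * a1 + y3)
      [:: (a12, -1)]%Z [:: (y3, [::])]
      x5 1 (true, 6);
    Entry x2
      (a12 * a1 * a9 * x3 * y1 + a12 * a4 * x1 * x3 * y1 + a1 * a2 * a9 * a10
      * x1 * x3 + a1 * a7 * a9 * x1 * x3 * x3 + a2 * a4 * a10 * x1 * x1 * x3 +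
      a2 * a10 * a11 * x1 * y3 + a2 * x1 * y1 * y3 + a4 * a7 * x1 * x1 * x3 *
      x3 + a7 * a11 * x1 * x3 * y3 + a9 * x3 * y1 * y3)
      [:: (a12, 0); (a1, -3)]%Z [:: (a12, [:: (a1, -1)]%Z); (a4, [::])]
      u1 8 (false, 0);
    Entry x3
      (a10 * a11 + y1)
      [:: (a10, -1)]%Z [:: (y1, [::])]
      x11 1 (false, 10);
    Entry y1
      (a1 * a9 * x3 + a3 * a11 * x2 + a4 * x1 * x3 + a6 * x2 * x3 + a11 * y3)
      [:: (a1, -3); (a3, 0)]%Z [:: (a4, [::])]
      x4 0 (false, 0);
    Entry y3
      (a12 * a8 * x2 + a12 * y1 + a2 * a10 * x1 + a5 * x1 * x2 + a7 * x1 * x3)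
      [:: (a12, -2); (a2, 2)]%Z [:: (a5, [::])]
      x12 0 (true, 4)];

  [:: Entry x1
      (a12 * a1 + y3)
      [:: (a12, -1)]%Z [:: (y3, [::])]
      x5 1 (true, 8);
    Entry x4
      (a12 * a1 * a2 * a3 * a6 * a9 + a12 * a1 * a3 * a9 * a11 * x7 + a12 * a1
      * a6 * a9 * y5 + a12 * a2 * a3 * a4 * a6 * x1 + a12 * a3 * a4 * a11 * x1
      * x7 + a12 * a4 * a6 * x1 * y5 + a1 * a9 * x1 * x7 * y5 + a2 * a3 * a6 *
      a9 * y3 + a2 * a6 * x1 * x7 * y3 + a3 * a9 * a11 * x7 * y3 + a4 * x1 *
      x1 * x7 * y5 + a6 * a9 * y3 * y5 + a11 * x1 * x7 * x7 * y3)
      [:: (a12, -2); (a6, 0)]%Z [:: (a4, [:: (a2, -3)]%Z); (x7, [:: (a12,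
      -1)]%Z); (y5, [::])]
      u1 9 (false, 0);
    Entry x7
      (a2 * a3 + y5)
      [:: (a2, -1)]%Z [:: (y5, [::])]
      x3 1 (false, 0);
    Entry y3
      (a12 * a2 * a3 * a6 + a12 * a3 * a11 * x7 + a12 * a6 * y5 + a12 * a8 *
      x4 * x7 + a5 * x1 * x4 * x7 + x1 * x7 * y5)
      [:: (a3, -2)]%Z [:: (a5, [::])]
      z2 7 (true, 8);
    Entry y5
      (a12 * a1 * a3 * a9 + a12 * a3 * a4 * x1 + a3 * a7 * x1 * x4 + a3 * a9 *
      y3 + a10 * x1 * x4 * x7 + x1 * x7 * y3)
      [:: (a12, -2)]%Z [:: (a10, [::])]
      z3 7 (false, 0)];

  [:: Entry x1
      (a12 * a1 + y3)
      [:: (a12, -1)]%Z [:: (y3, [::])]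
      x5 8 (false, 2);
    Entry x3
      (a2 * a3 + y5)
      [:: (a2, -1)]%Z [:: (y5, [::])]
      x7 9 (false, 0);
    Entry y3
      (a12 * a1 * a8 * a9 + a12 * a4 * a8 * x1 + a1 * a5 * a9 * x1 + a4 * a5 *
      x1 * x1 + x1 * u1)
      [:: (a12, -2); (a4, 0)]%Z [:: (u1, [::])]
      y11 10 (false, 0);
    Entry y5
      (a2 * a3 * a10 * a11 + a2 * a6 * a10 * x3 + a3 * a7 * a11 * x3 + a6 * a7
      * x3 * x3 + x3 * u1)
      [:: (a2, -2); (a6, 0)]%Z [:: (u1, [::])]
      y1 8 (false, 0);
    Entry u1
      (a12 * a1 * a3 * a9 * a11 * x3 + a12 * a1 * a6 * a9 * x3 * x3 + a12 * a3
      * a4 * a11 * x1 * x3 + a12 * a4 * a6 * x1 * x3 * x3 + a1 * a9 * x1 * x3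
      * y5 + a2 * a3 * a11 * x1 * y3 + a2 * a6 * x1 * x3 * y3 + a3 * a9 * a11
      * x3 * y3 + a4 * x1 * x1 * x3 * y5 + a6 * a9 * x3 * x3 * y3 + a11 * x1 *
      y3 * y5)
      [:: (a12, 2); (a1, -2)]%Z [:: (a2, [:: (a3, -1)]%Z); (a6, [::])]
      x4 1 (false, 0)];

  [:: Entry x1
      (a1 * z2 + a3 * a11 + a6 * x3 + a8 * x4)
      [:: (a1, -3)]%Z [:: (a1, [::])]
      x6 2 (false, 2);
    Entry x3
      (a2 * a3 + y5)
      [:: (a2, -1)]%Z [:: (y5, [::])]
      x7 7 (true, 8);
    Entry x4
      (a1 * a9 * x3 * z2 + a2 * a3 * a11 * x1 + a2 * a6 * x1 * x3 + a3 * a9 *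
      a11 * x3 + a4 * x1 * x3 * z2 + a6 * a9 * x3 * x3 + a11 * x1 * y5)
      [:: (a1, 2); (a2, -3)]%Z [:: (a4, [::])]
      y11 11 (false, 0);
    Entry y5
      (a12 * a1 * a9 * x3 * z2 + a12 * a2 * a3 * a11 * x1 + a12 * a2 * a6 * x1
      * x3 + a12 * a2 * a8 * x1 * x4 + a12 * a3 * a9 * a11 * x3 + a12 * a4 *
      x1 * x3 * z2 + a12 * a6 * a9 * x3 * x3 + a12 * a8 * a9 * x3 * x4 + a2 *
      a5 * x1 * x1 * x4 + a2 * a10 * x1 * x4 * z2 + a5 * a9 * x1 * x3 * x4 +
      a7 * x1 * x3 * x4 * z2)
      [:: (a12, -1); (a2, -3)]%Z [:: (a7, [::])]
      y2 2 (true, 5);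
    Entry z2
      (a12 * a3 * a11 + a12 * a6 * x3 + a12 * a8 * x4 + a5 * x1 * x4 + x1 *
      y5)
      [:: (a12, -1); (a3, 0)]%Z [:: (a5, [::])]
      y3 1 (false, 0)];

  [:: Entry x1
      (a12 * a1 + y3)
      [:: (a12, -1)]%Z [:: (y3, [::])]
      x5 6 (true, 8);
    Entry x4
      (a12 * a1 * a6 * a9 + a12 * a4 * a6 * x1 + a1 * a9 * x1 * x7 + a2 * a6 *
      x1 * z3 + a4 * x1 * x1 * x7 + a6 * a9 * y3 + a11 * x1 * x7 * z3)
      [:: (a12, -2); (a1, 2)]%Z [:: (a11, [::])]
      y9 12 (false, 0);
    Entry x7
      (a12 * a1 * a9 + a12 * a4 * x1 + a2 * x1 * z3 + a7 * x1 * x4 + a9 * y3)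
      [:: (a12, -1); (a1, 2)]%Z [:: (a2, [::])]
      x2 2 (false, 0);
    Entry y3
      (a12 * a12 * a1 * a3 * a6 * a9 + a12 * a12 * a3 * a4 * a6 * x1 + a12 *
      a1 * a3 * a9 * x1 * x7 + a12 * a2 * a3 * a6 * x1 * z3 + a12 * a3 * a4 *
      x1 * x1 * x7 + a12 * a3 * a6 * a7 * x1 * x4 + a12 * a3 * a11 * x1 * x7 *
      z3 + a12 * a6 * a10 * x1 * x4 * x7 + a12 * a8 * x1 * x4 * x7 * z3 + a3 *
      a7 * x1 * x1 * x4 * x7 + a5 * x1 * x1 * x4 * x7 * z3 + a10 * x1 * x1 *
      x4 * x7 * x7)
      [:: (a12, -3)]%Z [:: (a5, [::])]
      t1 13 (false, 0);
    Entry z3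
      (a12 * a1 * a3 * a9 + a12 * a3 * a4 * x1 + a3 * a7 * x1 * x4 + a3 * a9 *
      y3 + a10 * x1 * x4 * x7 + x1 * x7 * y3)
      [:: (a12, -2)]%Z [:: (a10, [::])]
      y5 4 (false, 0)];

  [:: Entry x1
      (a12 * a1 + y3)
      [:: (a12, -1)]%Z [:: (y3, [::])]
      x5 5 (true, 6);
    Entry x3
      (a10 * a11 + y1)
      [:: (a10, -1)]%Z [:: (y1, [::])]
      x11 5 (false, 10);
    Entry y1
      (a2 * a3 * a10 * a11 + a2 * a6 * a10 * x3 + a3 * a7 * a11 * x3 + a6 * a7
      * x3 * x3 + x3 * u1)
      [:: (a2, -2); (a3, 0)]%Z [:: (u1, [::])]
      y5 5 (false, 0);
    Entry y3
      (a12 * a1 * a8 * a9 + a12 * a4 * a8 * x1 + a1 * a5 * a9 * x1 + a4 * a5 *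
      x1 * x1 + x1 * u1)
      [:: (a1, -2); (a5, 0)]%Z [:: (u1, [::])]
      y11 5 (true, 4);
    Entry u1
      (a12 * a1 * a9 * x3 * y1 + a12 * a4 * x1 * x3 * y1 + a1 * a2 * a9 * a10
      * x1 * x3 + a1 * a7 * a9 * x1 * x3 * x3 + a2 * a4 * a10 * x1 * x1 * x3 +
      a2 * a10 * a11 * x1 * y3 + a2 * x1 * y1 * y3 + a4 * a7 * x1 * x1 * x3 *
      x3 + a7 * a11 * x1 * x3 * y3 + a9 * x3 * y1 * y3)
      [:: (a12, 2); (a1, -2)]%Z [:: (a12, [:: (a1, -1)]%Z); (a4, [::])]
      x2 3 (false, 0)];

  [:: Entry x1
      (a12 * a1 + y3)
      [:: (a12, -1)]%Z [:: (y3, [::])]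
      x5 5 (true, 8);
    Entry x7
      (a2 * a3 + y5)
      [:: (a2, -1)]%Z [:: (y5, [::])]
      x3 5 (false, 0);
    Entry y3
      (a12 * a1 * a8 * a9 + a12 * a4 * a8 * x1 + a1 * a5 * a9 * x1 + a4 * a5 *
      x1 * x1 + x1 * u1)
      [:: (a12, -2); (a4, 0)]%Z [:: (u1, [::])]
      y11 14 (false, 0);
    Entry y5
      (a2 * a3 * a6 * a7 + a2 * a6 * a10 * x7 + a3 * a7 * a11 * x7 + a10 * a11
      * x7 * x7 + x7 * u1)
      [:: (a2, -2); (a7, 0)]%Z [:: (u1, [::])]
      y9 14 (true, 2);
    Entry u1
      (a12 * a1 * a2 * a3 * a6 * a9 + a12 * a1 * a3 * a9 * a11 * x7 + a12 * a1
      * a6 * a9 * y5 + a12 * a2 * a3 * a4 * a6 * x1 + a12 * a3 * a4 * a11 * x1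
      * x7 + a12 * a4 * a6 * x1 * y5 + a1 * a9 * x1 * x7 * y5 + a2 * a3 * a6 *
      a9 * y3 + a2 * a6 * x1 * x7 * y3 + a3 * a9 * a11 * x7 * y3 + a4 * x1 *
      x1 * x7 * y5 + a6 * a9 * y3 * y5 + a11 * x1 * x7 * x7 * y3)
      [:: (a12, -2); (a1, 0)]%Z [:: (a4, [:: (a2, -3)]%Z); (x7, [:: (a12,
      -1)]%Z); (y5, [::])]
      x4 4 (false, 0)];

  [:: Entry x1
      (a8 * a9 + y11)
      [:: (a8, -1)]%Z [:: (y11, [::])]
      x9 14 (true, 4);
    Entry x3
      (a2 * a3 + y5)
      [:: (a2, -1)]%Z [:: (y5, [::])]
      x7 14 (false, 0);
    Entry y5
      (a2 * a3 * a10 * a11 + a2 * a6 * a10 * x3 + a3 * a7 * a11 * x3 + a6 * a7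
      * x3 * x3 + x3 * u1)
      [:: (a2, -2); (a6, 0)]%Z [:: (u1, [::])]
      y1 5 (true, 4);
    Entry y11
      (a12 * a1 * a8 * a9 + a12 * a4 * a8 * x1 + a1 * a5 * a9 * x1 + a4 * a5 *
      x1 * x1 + x1 * u1)
      [:: (a12, -2); (a1, 0)]%Z [:: (u1, [::])]
      y3 5 (false, 0);
    Entry u1
      (a12 * a2 * a3 * a8 * a11 * x1 + a12 * a2 * a6 * a8 * x1 * x3 + a12 * a3
      * a8 * a9 * a11 * x3 + a12 * a3 * a11 * x3 * y11 + a12 * a6 * a8 * a9 *
      x3 * x3 + a12 * a6 * x3 * x3 * y11 + a12 * a8 * a11 * x1 * y5 + a2 * a3
      * a5 * a11 * x1 * x1 + a2 * a5 * a6 * x1 * x1 * x3 + a3 * a5 * a9 * a11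
      * x1 * x3 + a5 * a6 * a9 * x1 * x3 * x3 + a5 * a11 * x1 * x1 * y5 + x1 *
      x3 * y5 * y11)
      [:: (a12, -2); (a2, -3)]%Z [:: (y5, [:: (a12, -2)]%Z); (x3, [::])]
      z2 11 (false, 0)];

  [:: Entry x1
      (a8 * a9 + y11)
      [:: (a8, -1)]%Z [:: (y11, [::])]
      x9 12 (false, 2);
    Entry x3
      (a2 * a3 + y5)
      [:: (a2, -1)]%Z [:: (y5, [::])]
      x7 12 (true, 2);
    Entry y5
      (a12 * a2 * a8 * x1 + a12 * a8 * a9 * x3 + a12 * x3 * y11 + a2 * a5 * x1
      * x1 + a2 * a10 * x1 * z2 + a5 * a9 * x1 * x3 + a7 * x1 * x3 * z2)
      [:: (a12, -2); (a5, 2)]%Z [:: (a7, [::])]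
      x12 6 (true, 4);
    Entry y11
      (a1 * a9 * x3 * z2 + a2 * a3 * a11 * x1 + a2 * a6 * x1 * x3 + a3 * a9 *
      a11 * x3 + a4 * x1 * x3 * z2 + a6 * a9 * x3 * x3 + a11 * x1 * y5)
      [:: (a1, 2); (a2, -3)]%Z [:: (a4, [::])]
      x4 6 (false, 0);
    Entry z2
      (a12 * a2 * a3 * a8 * a11 * x1 + a12 * a2 * a6 * a8 * x1 * x3 + a12 * a3
      * a8 * a9 * a11 * x3 + a12 * a3 * a11 * x3 * y11 + a12 * a6 * a8 * a9 *
      x3 * x3 + a12 * a6 * x3 * x3 * y11 + a12 * a8 * a11 * x1 * y5 + a2 * a3
      * a5 * a11 * x1 * x1 + a2 * a5 * a6 * x1 * x1 * x3 + a3 * a5 * a9 * a11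
      * x1 * x3 + a5 * a6 * a9 * x1 * x3 * x3 + a5 * a11 * x1 * x1 * y5 + x1 *
      x3 * y5 * y11)
      [:: (a12, 0); (a2, -2)]%Z [:: (y5, [:: (a12, -2)]%Z); (x3, [::])]
      u1 10 (false, 0)];

  [:: Entry x1
      (a12 * a1 + y3)
      [:: (a12, -1)]%Z [:: (y3, [::])]
      x5 11 (false, 4);
    Entry x7
      (a6 * a7 + y9)
      [:: (a6, -1)]%Z [:: (y9, [::])]
      x11 11 (false, 10);
    Entry y3
      (a12 * a3 * a6 * a7 + a12 * a3 * y9 + a12 * a6 * a10 * x7 + a12 * a8 *
      x7 * z3 + a3 * a7 * x1 * x7 + a5 * x1 * x7 * z3 + a10 * x1 * x7 * x7)
      [:: (a12, -1); (a5, 2)]%Z [:: (a5, [::])]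
      x10 7 (false, 6);
    Entry y9
      (a12 * a1 * a6 * a9 + a12 * a4 * a6 * x1 + a1 * a9 * x1 * x7 + a2 * a6 *
      x1 * z3 + a4 * x1 * x1 * x7 + a6 * a9 * y3 + a11 * x1 * x7 * z3)
      [:: (a12, 2); (a1, -2)]%Z [:: (a11, [::])]
      x4 7 (false, 0);
    Entry z3
      (a12 * a1 * a3 * a6 * a7 * a9 + a12 * a1 * a3 * a9 * y9 + a12 * a1 * a6
      * a9 * a10 * x7 + a12 * a3 * a4 * a6 * a7 * x1 + a12 * a3 * a4 * x1 * y9
      + a12 * a4 * a6 * a10 * x1 * x7 + a1 * a3 * a7 * a9 * x1 * x7 + a1 * a9
      * a10 * x1 * x7 * x7 + a3 * a4 * a7 * x1 * x1 * x7 + a3 * a6 * a7 * a9 *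
      y3 + a3 * a9 * y3 * y9 + a4 * a10 * x1 * x1 * x7 * x7 + a6 * a9 * a10 *
      x7 * y3 + x1 * x7 * y3 * y9)
      [:: (a12, 0); (a1, -3)]%Z [:: (y3, [:: (a3, -1)]%Z); (x1, [::])]
      u1 14 (true, 2)];

  [:: Entry x1
      (a12 * a3 * a6 * a9 + t1)
      [:: (a12, -1)]%Z [:: (t1, [::])]
      x10 13 (false, 3);
    Entry x4
      (a12 * a3 * a6 * a9 + t1)
      [:: (a12, -1)]%Z [:: (t1, [::])]
      x10 13 (false, 6);
    Entry x7
      (a12 * a3 * a6 * a9 + t1)
      [:: (a3, -1)]%Z [:: (t1, [::])]
      x10 13 (false, 9);
    Entry z3
      (a12 * a3 * a6 * a9 + a12 * a6 * x1 * x7 + a3 * a9 * x1 * x7 + x1 * x1 *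
      x7 * x7 + t1)
      [:: (a12, -2); (a3, 0)]%Z [:: (t1, [::])]
      z2 13 (true, 8);
    Entry t1
      (a12 * a12 * a1 * a3 * a6 * a9 + a12 * a12 * a3 * a4 * a6 * x1 + a12 *
      a1 * a3 * a9 * x1 * x7 + a12 * a2 * a3 * a6 * x1 * z3 + a12 * a3 * a4 *
      x1 * x1 * x7 + a12 * a3 * a6 * a7 * x1 * x4 + a12 * a3 * a11 * x1 * x7 *
      z3 + a12 * a6 * a10 * x1 * x4 * x7 + a12 * a8 * x1 * x4 * x7 * z3 + a3 *
      a7 * x1 * x1 * x4 * x7 + a5 * x1 * x1 * x4 * x7 * z3 + a10 * x1 * x1 *
      x4 * x7 * x7)
      [:: (a12, -3)]%Z [:: (a5, [::])]
      y3 7 (false, 0)];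

  [:: Entry x1
      (a8 * a9 + y11)
      [:: (a8, -1)]%Z [:: (y11, [::])]
      x9 10 (false, 6);
    Entry x7
      (a2 * a3 + y5)
      [:: (a2, -1)]%Z [:: (y5, [::])]
      x3 10 (false, 0);
    Entry y5
      (a2 * a3 * a6 * a7 + a2 * a6 * a10 * x7 + a3 * a7 * a11 * x7 + a10 * a11
      * x7 * x7 + x7 * u1)
      [:: (a2, -2); (a7, 0)]%Z [:: (u1, [::])]
      y9 9 (false, 6);
    Entry y11
      (a12 * a1 * a8 * a9 + a12 * a4 * a8 * x1 + a1 * a5 * a9 * x1 + a4 * a5 *
      x1 * x1 + x1 * u1)
      [:: (a12, -2); (a1, 0)]%Z [:: (u1, [::])]
      y3 9 (false, 0);
    Entry u1
      (a12 * a2 * a3 * a6 * a8 * a9 + a12 * a2 * a3 * a6 * y11 + a12 * a2 * a6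
      * a8 * x1 * x7 + a12 * a3 * a8 * a9 * a11 * x7 + a12 * a3 * a11 * x7 *
      y11 + a12 * a6 * a8 * a9 * y5 + a12 * a6 * y5 * y11 + a12 * a8 * a11 *
      x1 * x7 * x7 + a2 * a3 * a5 * a6 * a9 * x1 + a2 * a5 * a6 * x1 * x1 * x7
      + a3 * a5 * a9 * a11 * x1 * x7 + a5 * a6 * a9 * x1 * y5 + a5 * a11 * x1
      * x1 * x7 * x7 + x1 * x7 * y5 * y11)
      [:: (a12, 0); (a2, -2)]%Z [:: (y5, [:: (a12, -1)]%Z); (x7, [::])]
      z2 12 (true, 2)]].

(** These are not the exchange relations of a listed seed; they complete the
    chains of positive expansions below. *)
Definition extra_relations : seq relation := [::
  Relation u2 [:: x1]
    (a12 * a1 * a8 * a9 + a12 * a6 * a8 * x2 + a1 * a3 * a9 * x12 + a1 * x10 *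
    y2 + a3 * a6 * x12 * x2 + a3 * a11 * y12 + a6 * a10 * y2 + a8 * x4 * y12);
  Relation y8 [:: x1]
    (a12 * a6 * a8 + a1 * x10 * z2 + a3 * a6 * x12 + a3 * a11 * x10 + a6 * a10
    * z2 + a8 * x4 * x10);
  Relation t3 [:: x1]
    (a12 * a2 * a8 * a8 * a11 + a12 * a8 * a11 * x3 * x9 + a1 * x12 * x3 * x9
    * z2 + a2 * a3 * a8 * a11 * x12 + a2 * a6 * a8 * x12 * x3 + a2 * a8 * a10
    * a11 * z2 + a3 * a11 * x12 * x3 * x9 + a4 * a8 * x12 * x3 * z2 + a5 * a8
    * a9 * a11 * x3 + a6 * x12 * x3 * x3 * x9 + a7 * a8 * a11 * x3 * z2 + a8 *
    a9 * x12 * x3 * x6)].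
End Data.

(** For each seed of the list, the order in which the other cluster variables are
    expanded: a pair [(k, g)] is the relation number [k], moved by [g]. *)
Definition expansion_chains : seq (seq (nat * (bool * nat))) := [::
  [:: (0, (false, 0)); (1, (false, 0)); (2, (false, 0)); (3, (false, 0)); (4,
  (false, 0)); (4, (true, 6)); (5, (false, 1)); (5, (false, 2)); (5, (true,
  4)); (5, (true, 5)); (7, (false, 0)); (8, (false, 0)); (8, (true, 6)); (11,
  (false, 1)); (11, (false, 2)); (11, (true, 5)); (13, (false, 0)); (13,
  (true, 6)); (16, (false, 1)); (27, (false, 0)); (27, (true, 6)); (32,
  (false, 10)); (32, (false, 11)); (32, (true, 7)); (38, (false, 0)); (38,
  (true, 6)); (77, (false, 0))];
  [:: (0, (false, 0)); (0, (false, 2)); (7, (false, 0)); (8, (false, 0)); (8,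
  (true, 8)); (9, (false, 0)); (12, (false, 0)); (12, (true, 5)); (12, (true,
  8)); (13, (false, 0)); (13, (true, 8)); (27, (false, 0)); (27, (false, 2));
  (27, (true, 6)); (27, (true, 8)); (33, (false, 0)); (35, (true, 5)); (38,
  (false, 0)); (38, (false, 2)); (38, (true, 6)); (62, (true, 8)); (75,
  (false, 0)); (76, (true, 2)); (0, (false, 3)); (2, (false, 10)); (3, (false,
  9)); (3, (true, 5))];
  [:: (0, (false, 0)); (11, (false, 0)); (12, (false, 0)); (13, (false, 0));
  (13, (true, 6)); (14, (false, 0)); (14, (false, 3)); (14, (false, 9)); (15,
  (false, 3)); (15, (true, 3)); (32, (false, 10)); (34, (false, 1)); (34,
  (false, 4)); (34, (false, 7)); (34, (false, 10)); (34, (true, 2)); (34,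
  (true, 5)); (34, (true, 8)); (34, (true, 11)); (35, (true, 2)); (38, (false,
  0)); (38, (true, 6)); (59, (false, 1)); (75, (false, 1)); (2, (false, 1));
  (2, (false, 11)); (77, (false, 0))];
  [:: (0, (false, 0)); (0, (true, 4)); (8, (false, 10)); (8, (true, 6)); (16,
  (false, 0)); (18, (false, 0)); (18, (true, 4)); (27, (false, 0)); (27,
  (false, 10)); (27, (true, 4)); (27, (true, 6)); (30, (false, 1)); (30,
  (true, 3)); (38, (false, 0)); (38, (false, 10)); (38, (true, 4)); (4,
  (false, 0)); (4, (false, 10)); (4, (true, 6)); (5, (false, 1)); (5, (true,
  3)); (8, (false, 0)); (11, (false, 1)); (13, (false, 10)); (13, (true, 6));
  (75, (false, 0)); (76, (false, 0))];
  [:: (0, (false, 0)); (0, (true, 8)); (8, (false, 0)); (8, (true, 8)); (9,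
  (false, 0)); (9, (true, 8)); (12, (false, 0)); (12, (true, 8)); (13, (false,
  0)); (13, (true, 8)); (21, (false, 0)); (27, (false, 0)); (27, (false, 2));
  (27, (true, 6)); (27, (true, 8)); (33, (false, 0)); (33, (true, 8)); (35,
  (false, 3)); (35, (true, 5)); (38, (false, 0)); (38, (false, 2)); (38,
  (true, 6)); (62, (false, 0)); (75, (false, 0)); (2, (false, 4)); (3, (false,
  3)); (3, (false, 9))];
  [:: (0, (false, 0)); (0, (false, 2)); (27, (false, 0)); (27, (false, 2));
  (27, (true, 6)); (27, (true, 8)); (29, (false, 0)); (29, (true, 4)); (31,
  (true, 4)); (31, (true, 6)); (44, (false, 0)); (54, (false, 0)); (62, (true,
  8)); (76, (false, 0)); (77, (true, 4)); (2, (false, 0)); (2, (false, 10));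
  (4, (false, 0)); (4, (true, 6)); (12, (false, 9)); (12, (true, 5)); (38,
  (false, 2)); (38, (true, 6)); (75, (false, 2)); (76, (false, 2)); (76,
  (true, 2)); (3, (false, 11))];
  [:: (0, (false, 2)); (12, (true, 5)); (12, (true, 8)); (13, (true, 8)); (14,
  (false, 2)); (14, (false, 5)); (32, (false, 0)); (33, (false, 0)); (34,
  (false, 0)); (34, (false, 3)); (34, (true, 7)); (34, (true, 10)); (35,
  (true, 5)); (38, (false, 2)); (38, (true, 8)); (59, (false, 0)); (62, (true,
  8)); (72, (false, 0)); (72, (true, 10)); (0, (true, 4)); (2, (false, 1));
  (8, (true, 8)); (9, (false, 0)); (34, (false, 9)); (34, (true, 1)); (75,
  (false, 0)); (77, (false, 2))];
  [:: (0, (false, 0)); (12, (false, 3)); (13, (false, 0)); (14, (false, 0));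
  (30, (true, 5)); (33, (true, 8)); (34, (false, 1)); (34, (false, 10)); (34,
  (true, 5)); (34, (true, 8)); (35, (false, 3)); (35, (true, 5)); (36, (false,
  0)); (38, (false, 0)); (38, (true, 6)); (62, (false, 0)); (64, (false, 0));
  (68, (false, 0)); (72, (false, 10)); (72, (true, 8)); (75, (false, 0)); (76,
  (false, 0)); (0, (true, 2)); (2, (false, 1)); (3, (false, 9)); (9, (true,
  8)); (77, (false, 0))];
  [:: (0, (false, 0)); (0, (true, 4)); (27, (false, 0)); (27, (false, 10));
  (27, (true, 4)); (27, (true, 6)); (29, (false, 0)); (29, (true, 4)); (31,
  (false, 0)); (31, (true, 4)); (44, (false, 0)); (54, (false, 0)); (2,
  (false, 0)); (2, (false, 10)); (4, (false, 0)); (4, (false, 10)); (4, (true,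
  6)); (12, (false, 11)); (12, (true, 5)); (12, (true, 7)); (38, (false, 0));
  (38, (false, 10)); (38, (true, 4)); (75, (false, 0)); (76, (false, 0)); (76,
  (false, 2)); (76, (true, 2))];
  [:: (0, (false, 0)); (0, (true, 8)); (27, (false, 0)); (27, (false, 2));
  (27, (true, 6)); (27, (true, 8)); (31, (false, 4)); (31, (true, 4)); (49,
  (false, 0)); (49, (false, 6)); (74, (false, 0)); (74, (true, 2)); (9,
  (false, 0)); (9, (true, 8)); (12, (false, 9)); (12, (true, 11)); (33,
  (false, 0)); (33, (true, 8)); (38, (false, 0)); (38, (false, 2)); (38,
  (true, 6)); (76, (false, 0)); (76, (true, 8)); (2, (false, 4)); (3, (false,
  3)); (3, (false, 9)); (75, (false, 0))];
  [:: (0, (false, 2)); (0, (true, 2)); (27, (false, 2)); (27, (false, 8));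
  (27, (true, 2)); (27, (true, 8)); (29, (false, 0)); (29, (true, 4)); (31,
  (false, 10)); (31, (true, 6)); (44, (false, 0)); (54, (false, 0)); (62,
  (false, 8)); (62, (true, 8)); (76, (false, 0)); (77, (false, 0)); (77,
  (true, 4)); (2, (false, 0)); (2, (false, 10)); (4, (false, 2)); (4, (false,
  8)); (4, (true, 2)); (4, (true, 8)); (12, (false, 9)); (33, (false, 0));
  (75, (false, 0)); (77, (false, 2))];
  [:: (0, (false, 2)); (0, (true, 2)); (57, (false, 0)); (57, (true, 4)); (59,
  (false, 0)); (62, (false, 8)); (62, (true, 8)); (72, (false, 0)); (72,
  (false, 6)); (72, (true, 4)); (72, (true, 10)); (76, (false, 0)); (77,
  (false, 0)); (77, (true, 4)); (0, (false, 0)); (0, (true, 4)); (4, (false,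
  2)); (4, (false, 8)); (4, (true, 2)); (4, (true, 8)); (8, (false, 2)); (8,
  (true, 2)); (9, (false, 0)); (12, (false, 9)); (33, (false, 0)); (75,
  (false, 0)); (77, (false, 2))];
  [:: (0, (false, 0)); (0, (false, 6)); (57, (true, 2)); (57, (true, 8)); (62,
  (false, 0)); (62, (false, 6)); (64, (false, 0)); (72, (false, 4)); (72,
  (false, 10)); (72, (true, 2)); (72, (true, 8)); (76, (true, 2)); (76, (true,
  8)); (77, (true, 2)); (0, (true, 2)); (0, (true, 8)); (4, (false, 0)); (4,
  (false, 6)); (4, (true, 0)); (4, (true, 6)); (8, (false, 0)); (8, (true,
  0)); (9, (true, 2)); (9, (true, 8)); (38, (false, 0)); (75, (false, 0));
  (77, (false, 0))];
  [:: (65, (false, 0)); (68, (false, 0)); (69, (false, 0)); (69, (false, 3));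
  (69, (false, 6)); (69, (false, 9)); (69, (true, 2)); (69, (true, 5)); (69,
  (true, 8)); (69, (true, 11)); (70, (false, 0)); (70, (false, 3)); (70,
  (false, 6)); (70, (true, 2)); (70, (true, 5)); (70, (true, 8)); (75, (false,
  3)); (3, (false, 9)); (12, (false, 3)); (12, (true, 5)); (34, (false, 1));
  (34, (false, 4)); (34, (false, 10)); (75, (false, 0)); (77, (false, 0));
  (77, (true, 2)); (2, (false, 1))];
  [:: (0, (true, 2)); (0, (true, 8)); (27, (false, 2)); (27, (false, 8)); (27,
  (true, 2)); (27, (true, 8)); (31, (false, 4)); (31, (false, 10)); (49,
  (false, 0)); (49, (false, 6)); (74, (false, 0)); (74, (true, 2)); (9,
  (false, 0)); (9, (false, 6)); (12, (true, 5)); (12, (true, 11)); (33,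
  (false, 0)); (33, (false, 6)); (38, (false, 2)); (38, (true, 2)); (76,
  (true, 2)); (76, (true, 8)); (77, (true, 2)); (2, (false, 4)); (3, (false,
  3)); (3, (false, 9)); (75, (false, 0))]].

(** * Checks on the list of seeds *)

Definition no_entry := Entry 0 [::] [::] [::] 0 0 (false, 0).
Definition seedn (n : nat) : seq entry := nth [::] seeds n.
Definition ids (es : seq entry) : seq nat := map evar es.
Definition entry_at (es : seq entry) (v : nat) : entry :=
  nth no_entry es (index v (ids es)).

Definition tinv (g : bool * nat) : nat -> nat :=
  let tb := acttab g in fun v => index v tb.

Definition pdvd (p q : ppoly) : bool := peq (pmul (pquotient p q) q) p.
(** Whether [q] occurs in the denominator of the exchange Laurent polynomial of
    [p]. After the substitution of [F_q / q] for [q] in [F_p], all the terms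
    are multiples of [F_q], except those of degree 0 in [q]. *)
Definition expo (es : seq entry) (p q : nat) : bool :=
  pdvd (pcoef0 q (epoly (entry_at es p))) (epoly (entry_at es q)).

(** A proof that [T] is prime: [T = al * w + be] is of degree 1 in [w], and [al]
    is invertible, or is itself prime and has a zero [z] where [T] does not
    vanish, so that [al] has no common factor with [be]. *)
Fixpoint primeb (pc : seq (nat * point)) (T : ppoly) : bool :=
  if pc is (w, z) :: pc' then
    [&& all (fun m => count_mem w m <= 1) T, pcoef0 w T != [::], pquo w T != [::] &
        (pquo w T == [:: head [::] (pquo w T)])
          && all (leq 12) (head [::] (pquo w T))
        || [&& primeb pc' (pquo w T), all (fun k => k < 12) (unzip1 z),
               evalz (pt z) (pquo w T) == 0%R & evalz (pt z) T != 0%R]]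
  else false.

Definition wf_poly (vs : seq nat) (p : ppoly) : bool :=
  all (all (fun k => (k < 12) || (k \in vs))) p.

Definition entry_ok (vs : seq nat) (e : entry) : bool :=
  [&& wf_poly vs (epoly e), pfree (evar e) (epoly e),
      all (fun v => ~~ all (fun m => v \in m) (epoly e)) vs,
      all (fun k => k < 12) (unzip1 (ezero e)),
      evalz (pt (ezero e)) (epoly e) == 0%R &
      primeb (eprime e) (epoly e)].

Definition seed_ok (es : seq entry) : bool :=
  [&& size es == 5, uniq (ids es), all (fun v => 12 <= v < 44) (ids es) &
      all (entry_ok (ids es)) es].

Definition at0 (z : nat -> int) (v : nat) : nat -> int :=
  fun k => if k == v then 0%R else z k.

(** If the exponent is at least 1, the quotient of the substituted polynomial by
    [F_q] is [B + q^-1 * C], where [C] is what [pquo q Tp] becomes under the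
    substitution. At a zero of [F_q] with [q = 1] its value is that of
    [B + pquo q Tp] at [q := 0]: if it is not 0, the exponent is exactly 1. *)
Definition expo_ok (es : seq entry) (p q : nat) : bool :=
  let Tp := epoly (entry_at es p) in
  let Tq := epoly (entry_at es q) in
  let z := at0 (pt (ezero (entry_at es q))) q in
  if expo es p q then
    let B := pquotient (pcoef0 q Tp) Tq in
    [&& wf_poly (ids es) B, pfree q B & evalz z (B ++ pquo q Tp) != 0%R]
  else evalz z Tp != 0%R.

Definition denom (es : seq entry) (p : nat) : mon :=
  [seq q <- ids es | (q != p) && expo es p q].

(** A polynomial that takes distinct values at [two_at p] and at the point 1
    depends on [p]. *)
Definition two_at (p : nat) : nat -> int := fun k => if k == p then 2%R else 1%R.

(** That the entry [e'] of the mutated seed, moved by [g], is the effect on an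
    exchange polynomial of the mutation of [p] into [w], with denominator
    [dn]. In the main case, its polynomial [T'] divides the result of the
    substitution, and has a zero where [F_p] at [v := 0] does not vanish. *)
Definition mut_poly_ok (es : seq entry) (p : nat) (g : bool * nat) (w : nat)
    (dn : mon) (e' : entry) : bool :=
  let f := tact g in
  let f' := tinv g in
  let T' := prename f (epoly e') in
  let v := f (evar e') in
  let Tp := epoly (entry_at es p) in
  let Tq := epoly (entry_at es v) in
  if v == w then peq Tp T' else
  if pfree p Tq then peq Tq T' else
  [&& ~~ expo es p v, evalz (two_at p) Tq != evalz (fun=> 1%R) Tq,
      pdvd (psubst p (pcoef0 v Tp) (w :: dn) (pdeg p Tq) Tq) T' &
      evalz (fun u => pt (ezero e') (f' u)) (pcoef0 v Tp) != 0%R].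

Definition mut_ok (es : seq entry) (e : entry) : bool :=
  let p := evar e in
  let w := epartner e in
  let es' := seedn (etarget e) in
  let g := eact e in
  let f := tact g in
  let f' := tinv g in
  let mid := map (fun v => if v == p then w else v) (ids es) in
  [&& etarget e < size seeds, w \notin ids es, 12 <= w < 44,
      all (fun q => (q == p) || expo_ok es p q) (ids es),
      all (fun v => f' v \in ids es') mid,
      all (fun v => f v \in mid) (ids es') &
      all (mut_poly_ok es p g w (denom es p)) es'].

(** * A chart of the cone, where [x_1] is invertible *)

(** A difference of two positive polynomials. *)
Definition spoly := (ppoly * ppoly)%type.
Definition sadd (p q : spoly) : spoly := (p.1 ++ q.1, p.2 ++ q.2).
Definition sopp (p : spoly) : spoly := (p.2, p.1).
Definition smul (p q : spoly) : spoly :=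
  (pmul p.1 q.1 ++ pmul p.2 q.2, pmul p.1 q.2 ++ pmul p.2 q.1).

(** A chart gives expressions for some of the generators in terms of the others
    and of the inverse 44 of [x_1]. *)
Definition chart := seq (nat * spoly).
Definition chart_var (t : chart) (v : nat) : spoly :=
  if v \in unzip1 t then nth ([::], [::]) (unzip2 t) (index v (unzip1 t))
  else (pvar v, [::]).
Definition chart_mon (t : chart) (m : mon) : spoly :=
  foldr (fun v => smul (chart_var t v)) ([:: [::]], [::]) m.
Definition chart_poly (t : chart) (p : ppoly) : spoly :=
  foldr (fun m => sadd (chart_mon t m)) ([::], [::]) p.

(** Removes the products of [x_1] and its inverse. *)
Definition cancel (m : mon) : mon :=
  iter (minn (count_mem 13 m) (count_mem 44 m)) (fun d => rem 13 (rem 44 d)) m.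

(** Solves the relation for the generator [v], which occurs in it only through
    the monomial [v], or [v * x_1] if the boolean is true. *)
Definition solve (t : chart) (st : nat * bool * prel) : chart :=
  let: (v, b, r) := st in
  let m := if b then nfm [:: 13; v] else [:: v] in
  let L := map nfm r.1 in
  let R := map nfm r.2 in
  let sol p q :=
    let d := sadd (chart_poly t p) (sopp (chart_poly t q)) in
    (v, if b then smul (pvar 44, [::]) d else d) :: t in
  if m \in L then sol R (rem m L) else if m \in R then sol L (rem m R) else t.

(** Each relation involves, besides the generator for which it is solved, only
    generators that are free or have been solved before. *)
Definition chart_steps : seq (nat * bool * prel) :=
  [:: (xx 6, true, quad5 1); (xx 8, true, quad5 8); (xx 5, true, quad4 1);
      (xx 9, true, quad4 9); (xx 7, true, quadz 2); (ax 4, true, quad5 11);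
      (ax 5, true, quad5 10); (ax 2, true, quad4 0); (ax 7, true, quad4 10);
      (zx 1, true, quad4 11)]
  ++ [seq (yx i, false, defy i) | i <- iota 0 12]
  ++ [seq (tx i, false, deft i) | i <- iota 0 3]
  ++ [seq (ux i, false, defu i) | i <- iota 1 2].

Definition x1_chart : chart := foldl solve [::] chart_steps.

(** The relation itself must not contain 44, whose value is only chosen together
    with the chart. *)
Definition rel_ok (t : chart) (r : prel) : bool :=
  let p := chart_poly t r.1 in
  let q := chart_poly t r.2 in
  all (all (fun v => v < 44)) (r.1 ++ r.2) &&
  peq (map cancel (p.1 ++ q.2)) (map cancel (q.1 ++ p.2)).

Definition relation_prel (r : relation) : prel := ([:: rvar r :: rden r], rpoly r).
Definition exch_relation (es : seq entry) (e : entry) : relation :=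
  Relation (epartner e) (evar e :: denom es (evar e)) (epoly e).
Definition relations : seq relation :=
  flatten [seq [seq exch_relation es e | e <- es] | es <- seeds] ++ extra_relations.

(** * Chains of positive expansions *)

(** Only cluster variables are inverted, whereas the numerators may contain all
    the variables that have been expanded before. *)

Fixpoint chain_ok (rels : seq relation) (vs known : seq nat)
    (ch : seq (nat * (bool * nat))) : bool :=
  if ch is (k, g) :: ch' then
    let r := nth (Relation 0 [::] [::]) rels k in
    let f := tact g in
    [&& k < size rels, all (fun v => f v \in vs) (rden r),
        all (all (fun v => (f v < 12) || (f v \in known))) (rpoly r) &
        chain_ok rels vs (f (rvar r) :: known) ch']
  else all (fun k => k \in known) (iota 12 32).

(** * Divisibility of Laurent polynomials *)

Section Laurent.
Local Open Scope ring_scope.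

Variables (A : idomainType) (n : nat).
Local Notation P := {mpoly A[n]}.
Local Notation K := {fraction P}.

Lemma mpolyX_neq0 (m : 'X_{1..n}) : 'X_[m] != 0 :> P.
Proof. by rewrite -msupp_eq0 msuppX. Qed.

Lemma frac_mpolyX_neq0 (m : 'X_{1..n}) : (tofrac ('X_[m] : P) : K) != 0.
Proof. by rewrite tofrac_eq0 mpolyX_neq0. Qed.

Lemma laurent_tofrac (p : P) : laurent (tofrac p : K).
Proof. by exists p, 0%MM; rewrite mpolyX0 tofrac1 divr1. Qed.

Lemma laurent1 : laurent (1 : K).
Proof. by rewrite -tofrac1; exact: laurent_tofrac. Qed.

Lemma laurentM (f g : K) : laurent f -> laurent g -> laurent (f * g).
Proof.
move=> [p [m ->]] [q [d ->]]; exists (p * q), (m + d)%MM.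
by rewrite mpolyXD !tofracM mulf_div.
Qed.

Lemma laurent_prod (I : Type) (r : seq I) (Q : pred I) (G : I -> K) :
  (forall i, Q i -> laurent (G i)) -> laurent (\prod_(i <- r | Q i) G i).
Proof. by move=> h; apply: big_ind => //; [exact: laurent1|exact: laurentM]. Qed.

Lemma laurentXV (i : 'I_n) : laurent ((ratX A i)^-1).
Proof. by exists 1, U_(i)%MM; rewrite tofrac1 div1r. Qed.

Lemma laurentX (f : K) k : laurent f -> laurent (f ^+ k).
Proof.
move=> hf; elim: k => [|k ih]; first exact: laurent1.
by rewrite exprS; apply: laurentM.
Qed.

Lemma ratX_neq0 (i : 'I_n) : ratX A i != 0.
Proof. exact: frac_mpolyX_neq0. Qed.

Lemma laurent_monom (e : 'I_n -> int) : laurent (\prod_(k < n) ratX A k ^ e k).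
Proof.
apply: laurent_prod => k _; case: (e k) => j.
  by rewrite -exprnP; apply/laurentX/laurent_tofrac.
by rewrite NegzE -exprnN -exprVn; apply/laurentX/laurentXV.
Qed.

Lemma laurent_dvdM (f g h : K) :
  laurent h -> laurent_dvd f g -> laurent_dvd f (h * g).
Proof.
by move=> hh [q lq ->]; exists (h * q); [exact: laurentM|rewrite mulrA].
Qed.

(** ** Values of Laurent polynomials *)

Section Evaluation.
Variables (E : fieldType) (h : {rmorphism P -> E}).
Hypothesis hX : forall i, h 'X_i != 0.

Lemma hom_mpolyX_neq0 (m : 'X_{1..n}) : h 'X_[m] != 0.
Proof.
rewrite mpolyXE_id rmorph_prod; apply/prodf_neq0 => i _.
by rewrite rmorphXn expf_neq0.
Qed.

(** [v] is the value at [f] of the extension of [h] to Laurent polynomials;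
    a relation saves the construction of the extended morphism. *)
Definition lval (f : K) (v : E) : Prop :=
  exists (p : P) (m : 'X_{1..n}),
    f = tofrac p / tofrac ('X_[m] : P) /\ v = h p / h 'X_[m].

Lemma laurent_lval f : laurent f -> exists v, lval f v.
Proof. by move=> [p [m e]]; exists (h p / h 'X_[m]), p, m. Qed.

Lemma lval_laurent f v : lval f v -> laurent f.
Proof. by move=> [p [m [-> _]]]; exists p, m. Qed.

Lemma lval_inj f v w : lval f v -> lval f w -> v = w.
Proof.
move=> [p [m [-> ->]]] [q [d [e ->]]].
apply/eqP; rewrite eqr_div ?hom_mpolyX_neq0 //.
move/eqP: e; rewrite eqr_div ?frac_mpolyX_neq0 // -!tofracM tofrac_eq => /eqP e.
by rewrite -!rmorphM e.
Qed.

Lemma lval_tofrac p : lval (tofrac p) (h p).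
Proof. by exists p, 0%MM; rewrite mpolyX0 !rmorph1 !divr1. Qed.

Lemma lvalD f g v w : lval f v -> lval g w -> lval (f + g) (v + w).
Proof.
move=> [p [m [-> ->]]] [q [d [-> ->]]].
exists (p * 'X_[d] + q * 'X_[m]), (m + d)%MM; split.
  by rewrite addf_div ?frac_mpolyX_neq0 // mpolyXD tofracD !tofracM.
by rewrite addf_div ?hom_mpolyX_neq0 // mpolyXD rmorphD !rmorphM.
Qed.

Lemma lvalM f g v w : lval f v -> lval g w -> lval (f * g) (v * w).
Proof.
move=> [p [m [-> ->]]] [q [d [-> ->]]].
exists (p * q), (m + d)%MM; split.
  by rewrite mpolyXD !tofracM mulf_div.
by rewrite mpolyXD !rmorphM mulf_div.
Qed.

Lemma lvalXV (i : 'I_n) : lval ((ratX A i)^-1) ((h 'X_i)^-1).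
Proof. by exists 1, U_(i)%MM; rewrite tofrac1 rmorph1 !div1r. Qed.

Lemma lval_prod (I : Type) (r : seq I) (Q : pred I) (G : I -> K) (G' : I -> E) :
  (forall i, Q i -> lval (G i) (G' i)) ->
  lval (\prod_(i <- r | Q i) G i) (\prod_(i <- r | Q i) G' i).
Proof.
move=> hG; elim/big_ind2: _ => //; last by move=> *; apply: lvalM.
by rewrite -(rmorph1 h) -tofrac1; exact: lval_tofrac.
Qed.

Lemma lval_sum (I : Type) (r : seq I) (Q : pred I) (G : I -> K) (G' : I -> E) :
  (forall i, Q i -> lval (G i) (G' i)) ->
  lval (\sum_(i <- r | Q i) G i) (\sum_(i <- r | Q i) G' i).
Proof.
move=> hG; elim/big_ind2: _ => //; last by move=> *; apply: lvalD.
by rewrite -(rmorph0 h) -tofrac0; exact: lval_tofrac.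
Qed.

(** This is how non-divisibility is proved: a multiple of [a] vanishes at every
    zero of [a] where the variables are invertible. *)
Lemma laurent_dvd_root (a : P) f v :
  h a = 0 -> laurent_dvd (tofrac a) f -> lval f v -> v = 0.
Proof.
move=> ha [g lg ->] hv; have [w hw] := laurent_lval lg.
have := lvalM hw (lval_tofrac a).
by rewrite ha mulr0 => /(lval_inj hv).
Qed.

End Evaluation.

Definition laurent_prime (a : P) : Prop :=
  forall f g : K, laurent f -> laurent g ->
    laurent_dvd (tofrac a) (f * g) ->
    laurent_dvd (tofrac a) f \/ laurent_dvd (tofrac a) g.

Lemma laurent_dvd_tofrac (a b : P) :
  laurent_dvd (tofrac a : K) (tofrac b) ->
  exists (q : P) (m : 'X_{1..n}), 'X_[m] * b = q * a.
Proof.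
move=> [f [q [m ->]] e]; exists q, m; apply/eqP.
rewrite -tofrac_eq !tofracM e mulrA [X in X * _]mulrC.
by rewrite divfK ?frac_mpolyX_neq0.
Qed.

Lemma laurent_prime_prod (a : P) (ds : seq K) (f : K) :
  laurent_prime a -> (forall d, d \in ds -> laurent d) -> laurent f ->
  laurent_dvd (tofrac a) ((\prod_(d <- ds) d) * f) ->
  (exists2 d, d \in ds & laurent_dvd (tofrac a) d) \/ laurent_dvd (tofrac a) f.
Proof.
move=> pa + lf; elim: ds => [|d ds ih] lds; first by rewrite big_nil mul1r; right.
have ld: laurent d by apply: lds; rewrite mem_head.
have {}lds e : e \in ds -> laurent e by move=> h; apply: lds; rewrite inE h orbT.
rewrite big_cons -mulrA => /pa [//| |h|/ih [//| |h]].
- by apply: laurentM => //; rewrite big_seq; apply: laurent_prod.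
- by left; exists d; rewrite ?mem_head.
- by move=> [e he h]; left; exists e; rewrite // inE he orbT.
- by right.
Qed.


(** [p] is a polynomial expression in the constants and the variables. *)
Lemma mpoly_gen_ind (S : P -> Prop) :
  (forall c, S c%:MP) -> (forall i, S 'X_i) ->
  (forall p q, S p -> S q -> S (p + q)) ->
  (forall p q, S p -> S q -> S (p * q)) -> forall p, S p.
Proof.
move=> SC SX SD SM p; rewrite (mpolyE p).
apply: big_ind => [|//|m _]; first by rewrite -mpolyC0; exact: SC.
rewrite -mul_mpolyC; apply: (SM _ _ (SC _)); rewrite mpolyXE_id.
apply: big_ind => [|//|i _]; first by rewrite -mpolyC1; exact: SC.
elim: (m i) => [|k ih]; first by rewrite expr0 -mpolyC1; exact: SC.
by rewrite exprS; apply: SM.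
Qed.

(** The difference of [p] and its value at ['X_j := 0] is always a multiple of
    ['X_j], by induction on [p]. *)
Lemma mpolyX_dvd (j : 'I_n) (p : P) :
  mmap (@mpolyC n A) [eta (fun i => 'X_i : P) with j |-> 0] p = 0 ->
  exists q, p = q * 'X_j.
Proof.
pose z : {rmorphism P -> P} :=
  mmap (@mpolyC n A) [eta (fun i => 'X_i : P) with j |-> 0].
rewrite -[mmap _ _ _]/(z p) => hp; suff: exists q, p - z p = q * 'X_j by rewrite hp subr0.
elim/mpoly_gen_ind: p {hp} => [c|i|p q [p' hp] [q' hq]|p q [p' hp] [q' hq]].
- by exists 0; rewrite /= mmapC subrr mul0r.
- rewrite /= mmapX mmap1U /=; case: eqP => [->|_].
    by exists 1; rewrite subr0 mul1r.
  by exists 0; rewrite subrr mul0r.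
- by exists (p' + q'); rewrite rmorphD mulrDl -hp -hq; ring.
exists (p' * q + z p * q'); rewrite rmorphM mulrDl mulrAC -hp -mulrA -hq.
by ring.
Qed.

Lemma mpolyX_prime (j : 'I_n) (p q r : P) :
  p * q = r * 'X_j -> (forall q', q <> q' * 'X_j) -> exists p', p = p' * 'X_j.
Proof.
move=> e nq; pose z : {rmorphism P -> P} :=
  mmap (@mpolyC n A) [eta (fun i => 'X_i : P) with j |-> 0].
have zX : z 'X_j = 0 by rewrite /= mmapX mmap1U /= eqxx.
have /eqP: z p * z q = 0 by rewrite -rmorphM e rmorphM [X in _ * X]zX mulr0.
rewrite mulf_eq0 => /orP[] /eqP /mpolyX_dvd // [q'] /nq.
by [].
Qed.

(** Some product of [F] by a monomial is a multiple of [T]. The variables are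
    prime and do not divide [T], so they can be cancelled one at a time, and
    [T] divides [F] as a polynomial. *)
Lemma irreducible_laurent_dvd (T F : P) :
  irreducible_elt F -> T \isn't a GRing.unit ->
  (forall j q, T <> q * 'X_j) ->
  laurent_dvd (tofrac T : K) (tofrac F) ->
  exists2 c : A, c \is a GRing.unit & F = c *: T.
Proof.
move=> [_ _ irrF] nuT nX /laurent_dvd_tofrac [q [m]].
elim: {m}(mdeg m) {-2}m (erefl (mdeg m)) q => [|k ih] m hm q e.
  move/eqP: hm; rewrite mdeg_eq0 => /eqP m0.
  move: e; rewrite m0 mpolyX0 mul1r => e.
  case: (irrF _ _ e) => [uq|uT]; last by rewrite uT in nuT.
  have /andP [/eqP qc uc] : mpoly_unit q := uq.
  by exists q@_0; rewrite // -mul_mpolyC -qc.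
have [j hj] : exists j, (0 < m j)%N.
  apply/existsP; apply: contra_eqT hm; rewrite negb_exists => /forallP h.
  suff -> : m = 0%MM by rewrite mdeg0.
  by apply/mnmP => i; rewrite mnm0E; apply/eqP; rewrite -leqn0 leqNgt h.
have em : m = (m - U_(j) + U_(j))%MM.
  by rewrite submK //; apply/mnm_lepP => i; rewrite mnm1E; case: eqP => [<-|].
have e' : q * T = ('X_[(m - U_(j))%MM] * F) * 'X_j.
  by rewrite -e mulrAC -mpolyXD -em.
have [q' hq'] := mpolyX_prime e' (nX j).
apply: (ih (m - U_(j))%MM _ q').
  by apply/eqP; rewrite -(eqn_add2r 1) -(mdeg1 j) -mdegD -em hm mdeg1 addn1.
apply: (mulIf (mpolyX_neq0 U_(j)%MM)).
by rewrite -e' hq'; ring.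
Qed.

End Laurent.

(** * Values of positive polynomials *)

Section Evaluation.
Local Open Scope ring_scope.

Lemma ev_cat (S : comNzRingType) (rho : nat -> S) p q :
  ev rho (p ++ q) = ev rho p + ev rho q.
Proof. by rewrite /ev big_cat. Qed.

Lemma ev_cons (S : comNzRingType) (rho : nat -> S) m p :
  ev rho (m :: p) = \prod_(k <- m) rho k + ev rho p.
Proof. by rewrite /ev big_cons. Qed.

Lemma ev_pmul (S : comNzRingType) (rho : nat -> S) p q :
  ev rho (pmul p q) = ev rho p * ev rho q.
Proof.
rewrite /ev /pmul big_allpairs_dep /= big_distrl /=; apply: eq_bigr => m _.
by rewrite big_distrr /=; apply: eq_bigr => d _; rewrite big_cat.
Qed.

Lemma ev_one (S : comNzRingType) (rho : nat -> S) : ev rho [:: [::]] = 1.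
Proof. by rewrite /ev big_seq1 big_nil. Qed.

Lemma ev_mon (S : comNzRingType) (rho : nat -> S) m :
  ev rho [:: m] = \prod_(k <- m) rho k.
Proof. by rewrite /ev big_seq1. Qed.

Lemma ev_pexp (S : comNzRingType) (rho : nat -> S) p n :
  ev rho (pexp p n) = ev rho p ^+ n.
Proof.
elim: n => [|n ih]; first by rewrite ev_one.
by rewrite exprS -ih -ev_pmul.
Qed.

Lemma ev_nf (S : comNzRingType) (rho : nat -> S) p : ev rho (nf p) = ev rho p.
Proof.
rewrite /ev /nf (perm_big _ (permEl (perm_sort _ _))) /= big_map.
by apply: eq_bigr => m _; rewrite (perm_big _ (permEl (perm_sort _ _))).
Qed.

Lemma peq_ev (S : comNzRingType) (rho : nat -> S) p q :
  peq p q -> ev rho p = ev rho q.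
Proof. by move=> /eqP e; rewrite -ev_nf e ev_nf. Qed.

Lemma pdvd_ev (S : comNzRingType) (rho : nat -> S) p q :
  pdvd p q -> ev rho p = ev rho (pquotient p q) * ev rho q.
Proof. by move=> /(peq_ev rho) <-; rewrite ev_pmul. Qed.

Lemma ev_prename (S : comNzRingType) (rho : nat -> S) g p :
  ev rho (prename g p) = ev (rho \o g) p.
Proof.
by rewrite /ev /prename big_map; apply: eq_bigr => m _; rewrite big_map.
Qed.

Lemma eq_ev (S : comNzRingType) (D : pred nat) (rho rho' : nat -> S) p :
  all (all D) p -> {in D, rho =1 rho'} -> ev rho p = ev rho' p.
Proof.
move=> /allP hp e; rewrite /ev big_seq [RHS]big_seq; apply: eq_bigr => m /hp.
move/allP=> hm; rewrite big_seq [RHS]big_seq; apply: eq_bigr => k /hm.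
exact: e.
Qed.

Lemma eq_ev_free (S : comNzRingType) (rho rho' : nat -> S) v p :
  pfree v p -> (forall k, k != v -> rho k = rho' k) -> ev rho p = ev rho' p.
Proof.
move=> /allP hp e; apply: (@eq_ev _ (predC1 v)) => [|k hk]; last exact: e.
by apply/allP => m /hp hm; apply/allP => k km; apply: contraNneq hm => <-.
Qed.

Lemma pfree_pcoef0 v p : pfree v (pcoef0 v p).
Proof. by apply/allP => m; rewrite mem_filter => /andP[]. Qed.

Lemma ev_split (S : comNzRingType) (rho : nat -> S) v p :
  ev rho p = ev rho (pcoef0 v p) + rho v * ev rho (pquo v p).
Proof.
elim: p => [|m p ih]; first by rewrite /ev !big_nil mulr0 addr0.
rewrite ev_cons ih /pcoef0 /pquo /=; case: (boolP (v \in m)) => hv /=.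
  rewrite ev_cons (perm_big _ (perm_to_rem hv)) /= big_cons; ring.
by rewrite ev_cons addrA.
Qed.

Lemma ev_at0 (S : comNzRingType) (rho : nat -> S) v p :
  ev [eta rho with v |-> 0] p = ev rho (pcoef0 v p).
Proof.
rewrite (ev_split _ v) /= eqxx mul0r addr0.
by apply: (eq_ev_free (pfree_pcoef0 v p)) => k /negPf /= ->.
Qed.

Lemma rmorph_ev (S T : comNzRingType) (h : {rmorphism S -> T}) (rho : nat -> S) p :
  h (ev rho p) = ev (h \o rho) p.
Proof.
by rewrite /ev rmorph_sum; apply: eq_bigr => m _; rewrite rmorph_prod.
Qed.

Lemma eq_ev_ext (S : comNzRingType) (rho rho' : nat -> S) p :
  rho =1 rho' -> ev rho p = ev rho' p.
Proof.
by move=> e; apply: eq_bigr => m _; apply: eq_bigr => k _; exact: e.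
Qed.

Lemma ev_psubst (E : fieldType) (rho : nat -> E) v nu dn D p :
  \prod_(k <- dn) rho k != 0 -> (pdeg v p <= D)%N ->
  ev rho (psubst v nu dn D p) =
    (\prod_(k <- dn) rho k) ^+ D *
    ev [eta rho with v |-> ev rho nu / \prod_(k <- dn) rho k] p.
Proof.
move=> dn0; elim: p => [|m p ih] /=; first by rewrite /ev !big_nil mulr0.
rewrite /pdeg /= geq_max => /andP[hm hp].
rewrite ev_cat ih // ev_cons mulrDr; congr (_ + _).
rewrite !ev_pmul !ev_pexp !ev_mon big_filter /=.
rewrite [X in _ = _ * X](bigID (fun k => k != v)) /=.
rewrite [X in _ * (_ * X)](eq_bigr (fun=> ev rho nu / \prod_(k <- dn) rho k));
  last by move=> k; rewrite negbK => ->.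
rewrite [X in _ * (X * _)](eq_bigr rho); last by move=> k /negPf ->.
have hc : count (fun k => ~~ (k != v)) m = count_mem v m.
  by apply: eq_count => k /=; case: (k == v).
rewrite big_const_seq hc iter_mulr mulr1 expr_div_n.
rewrite -[in RHS](subnK hm) exprD.
set d := \prod_(k <- dn) rho k in dn0 *; set c := count_mem v m.
set t := \prod_(_ <- m | _) _.
have e : d ^+ c / d ^+ c = 1 by rewrite divff ?expf_neq0.
transitivity (t * ev rho nu ^+ c * d ^+ (D - c) * (d ^+ c / d ^+ c)); last by ring.
by rewrite e mulr1.
Qed.

Lemma evalzE (z : nat -> int) p : evalz z p = ev z p.
Proof.
rewrite /ev unlock; by elim: p => [|m p ih] //=; rewrite ih.
Qed.

Lemma evalz_intr (S : comNzRingType) (z : nat -> int) p :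
  (evalz z p)%:~R = ev (fun k => (z k)%:~R : S) p.
Proof. by rewrite evalzE (rmorph_ev (intmul 1)). Qed.

Lemma ev_ones (S : comNzRingType) p : ev (fun=> 1 : S) p = (size p)%:R.
Proof.
rewrite /ev (eq_bigr (fun=> 1)); last by move=> m _; rewrite big1.
by rewrite big_const_seq count_predT iter_addr addr0.
Qed.

End Evaluation.

(** * Polynomials in the variables of a seed *)

(** Computations modulo [t] after multiplication by a power of [al]; they are used
    below for [al * w = - be] modulo [al * w + be]. *)
Section Congruences.
Local Open Scope ring_scope.
Variables (S : comNzRingType) (al t p q p' q' p2 q2 : S) (k l : nat).

Lemma expD_add :
  al ^+ l * (al ^+ k * p) + al ^+ k * (al ^+ l * q) = al ^+ (k + l) * (p + q).
Proof. by rewrite exprD; ring. Qed.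

Lemma expD_mul : (al ^+ k * p) * (al ^+ l * q) = al ^+ (k + l) * (p * q).
Proof. by rewrite exprD; ring. Qed.

Lemma morph_comb (S' : comNzRingType) (h : {rmorphism S -> S'}) (x y : S') :
  h p' = h al ^+ k * x -> h q' = h al ^+ l * y ->
  h (al ^+ l * p' + al ^+ k * q') = h al ^+ (k + l) * (x + y).
Proof.
by move=> ep eq; rewrite rmorphD !rmorphM !rmorphXn ep eq exprD; ring.
Qed.

Lemma exp0_mul : p = al ^+ 0 * p.
Proof. by rewrite expr0 mul1r. Qed.

Lemma congr_refl : al ^+ 0 * p = p + 0 * t.
Proof. by rewrite -exp0_mul mul0r addr0. Qed.

Hypotheses (ep : al ^+ k * p = p' + p2 * t) (eq : al ^+ l * q = q' + q2 * t).

Lemma congr_addM : al ^+ (k + l) * (p + q) =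
  al ^+ l * p' + al ^+ k * q' + (al ^+ l * p2 + al ^+ k * q2) * t.
Proof. by rewrite -expD_add ep eq; ring. Qed.

Lemma congr_mulM : al ^+ (k + l) * (p * q) =
  p' * q' + (p2 * (al ^+ l * q) + p' * q2) * t.
Proof. by rewrite -expD_mul ep eq; ring. Qed.

End Congruences.

Section Frame.
Local Open Scope ring_scope.
Variable R : realType.
Local Notation C := (complex R).
Local Notation A := (coef_ring R).
Local Notation P := {mpoly A[5]}.
Local Notation K := {fraction P}.

Definition cst (c : C) : P := ((c%:MP : A))%:MP.

Lemma cst_is_zmod_morphism : zmod_morphism cst.
Proof. by move=> c d; rewrite /cst !rmorphB. Qed.
Lemma cst_is_monoid_morphism : monoid_morphism cst.
Proof. by split=> [|c d]; rewrite /cst ?rmorph1 ?rmorphM. Qed.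
HB.instance Definition _ :=
  GRing.isZmodMorphism.Build C P cst cst_is_zmod_morphism.
HB.instance Definition _ :=
  GRing.isMonoidMorphism.Build C P cst cst_is_monoid_morphism.

Definition kidx (kap : 'I_5 -> nat) (v : nat) : 'I_5 :=
  odflt ord0 [pick l | kap l == v].

Lemma kidxK kap : injective kap -> forall l, kidx kap (kap l) = l.
Proof.
move=> inj l; rewrite /kidx; case: pickP => [l' /eqP /inj // |/(_ l)].
by rewrite eqxx.
Qed.

(** A frame identifies the generators with elements of the polynomial ring of a
    seed. The [l]-th cluster variable is [c l] times the image by the symmetry
    [gam] of the generator [kap l]; so this generator is [(c l)^-1 * 'X_l]. The
    function [kidx kap] is the inverse of [kap]. *)
Definition frame_env (gam : nat -> nat) (kap : 'I_5 -> nat) (c : 'I_5 -> C) (v : nat) : P :=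
  if (v < 12)%N then frz R (gam v)
  else cst (c (kidx kap v))^-1 * 'X_(kidx kap v).

Section Spec.
Variables (gam del : nat -> nat) (kap : 'I_5 -> nat) (c : 'I_5 -> C).
Hypothesis gamP : forall k, (k < 12)%N ->
  [/\ (gam k < 12)%N, (del k < 12)%N, del (gam k) = k & gam (del k) = k].
Hypothesis kap_inj : injective kap.
Hypothesis kap12 : forall l, (12 <= kap l)%N.
Hypothesis c0 : forall l, c l != 0.

Local Notation env := (frame_env gam kap c).

Section Morphism.
Variables (E : comNzRingType) (iota : {rmorphism C -> E}) (val : nat -> E).

(** The specialisation [frame_spec] is the ring morphism out of the polynomial
    ring that sends the generators, as elements of the frame, to prescribed
    values; [del] is the inverse of [gam] on the frozen variables. *)
Definition spec_coef : A -> E := mmap iota (fun k : 'I_12 => val (del k)).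
HB.instance Definition _ := GRing.RMorphism.copy spec_coef
  (mmap iota (fun k : 'I_12 => val (del k))).

Definition frame_spec : P -> E := mmap spec_coef (fun l => iota (c l) * val (kap l)).
HB.instance Definition _ := GRing.RMorphism.copy frame_spec
  (mmap spec_coef (fun l => iota (c l) * val (kap l))).

Lemma spec_cst d : frame_spec (cst d) = iota d.
Proof. by rewrite /frame_spec /cst mmapC /= /spec_coef mmapC. Qed.

Lemma specX l : frame_spec 'X_l = iota (c l) * val (kap l).
Proof. by rewrite /frame_spec mmapX mmap1U. Qed.

Lemma spec_env_frozen v : (v < 12)%N -> frame_spec (env v) = val v.
Proof.
move=> hv; rewrite /frame_env hv /frame_spec /frz mmapC /= /spec_coef mmapX mmap1U /=.
by have [g1 _ g2 _] := gamP hv; rewrite modn_small // g2.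
Qed.

Lemma env_kap l : env (kap l) = cst (c l)^-1 * 'X_l.
Proof. by rewrite /frame_env ltnNge kap12 kidxK. Qed.

Lemma spec_env_kap l : frame_spec (env (kap l)) = val (kap l).
Proof.
rewrite env_kap rmorphM /= spec_cst specX mulrA -rmorphM mulVf ?c0 //.
by rewrite rmorph1 mul1r.
Qed.

Lemma spec_ev vs p : {subset vs <= codom kap} -> wf_poly vs p ->
  frame_spec (ev env p) = ev val p.
Proof.
move=> hvs hp; rewrite rmorph_ev.
apply: (eq_ev (D := fun k => (k < 12)%N || (k \in vs))) => // k.
rewrite unfold_in => /orP[|/hvs /codomP [l ->]]; first exact: spec_env_frozen.
exact: spec_env_kap.
Qed.

End Morphism.

Lemma frame_ind (S : P -> Prop) :
  (forall d, S (cst d)) -> (forall v, (v < 12)%N -> S (env v)) ->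
  (forall l, S (env (kap l))) ->
  (forall p q, S p -> S q -> S (p + q)) ->
  (forall p q, S p -> S q -> S (p * q)) -> forall p, S p.
Proof.
move=> Sc Sf Sk SD SM; apply: mpoly_gen_ind => // [a|l].
  apply: (mpoly_gen_ind (S := fun a : {mpoly C[12]} => S (a%:MP))) => //.
  - move=> k; have [h1 h2 h3 h4] := gamP (ltn_ord k).
    have := Sf _ h2; rewrite /frame_env h2 h4 /frz; congr (S _%:MP).
    by congr ('X_ _); apply: val_inj; rewrite /= modn_small.
  - by move=> p q; rewrite rmorphD; exact: SD.
  - by move=> p q; rewrite rmorphM; exact: SM.
have -> : 'X_l = cst (c l) * env (kap l).
  by rewrite env_kap mulrA -rmorphM divff ?c0 // rmorph1 mul1r.
exact: SM.
Qed.

Local Notation ehat := (ev env).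

Definition iotaC (z : nat -> int) (k : nat) : C := (z k)%:~R.

Lemma spec_int vs p (z : nat -> int) : {subset vs <= codom kap} ->
  wf_poly vs p -> frame_spec idfun (iotaC z) (ehat p) = (evalz z p)%:~R.
Proof. by move=> hvs hp; rewrite (spec_ev _ _ hvs hp) evalz_intr. Qed.

(** The coefficients are positive, so that the value at the point 1 is not 0. *)
Lemma ehat_neq0 vs p : {subset vs <= codom kap} ->
  wf_poly vs p -> p != [::] -> ehat p != 0.
Proof.
move=> hvs hp; apply: contraNneq => h.
have := spec_ev idfun (fun=> 1) hvs hp; rewrite h rmorph0 ev_ones => /esym/eqP.
by rewrite pnatr_eq0 size_eq0.
Qed.

Lemma wf_pcoef0 vs v p : wf_poly vs p -> wf_poly vs (pcoef0 v p).
Proof. by move=> /allP h; apply/allP => m; rewrite mem_filter => /andP[_ /h]. Qed.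

Lemma wf_pquo vs v p : wf_poly vs p -> wf_poly vs (pquo v p).
Proof.
move=> /allP h; apply/allP => m /mapP [d]; rewrite mem_filter => /andP[_ /h].
by move=> /allP hd ->; apply/allP => k /mem_rem; exact: hd.
Qed.

Lemma pfree_pquo v p : all (fun m => count_mem v m <= 1)%N p -> pfree v (pquo v p).
Proof.
move=> /allP h; apply/allP => m /mapP [d]; rewrite mem_filter => /andP[hv /h].
rewrite (permP (perm_to_rem hv)) /= eqxx add1n ltnS leqn0 => hd ->.
by rewrite -has_pred1 has_count -leqNgt leqn0.
Qed.

(** The values of the generators where [w] solves the equation [T = 0]. *)
Definition solve_val (w : nat) (T : ppoly) (v : nat) : K :=
  if v == w then - (tofrac (ehat (pcoef0 w T)) / tofrac (ehat (pquo w T)))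
  else tofrac (env v).

(** Let [T = al * w + be]. The substitution [w := - be / al] is a morphism to a
    field that kills [T]. Conversely, if it kills [f], then [T] divides
    [al ^+ k * f] for some [k], since [al * w = - be] modulo [T]; as [al] can be
    cancelled, [T] divides [f]. So the multiples of [T] are the kernel of a
    morphism to a field. *)
Lemma linear_laurent_prime vs w T : {subset vs <= codom kap} -> wf_poly vs T ->
  all (fun m => count_mem w m <= 1)%N T -> pcoef0 w T != [::] ->
  pquo w T != [::] ->
  (forall f : K, laurent f ->
     laurent_dvd (tofrac (ehat T)) (tofrac (ehat (pquo w T)) * f) ->
     laurent_dvd (tofrac (ehat T)) f) ->
  laurent_prime (ehat T).
Proof.
move=> hvs hT hc hb ha cancel.
set al := ehat (pquo w T) in cancel *; set be := ehat (pcoef0 w T).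
have al0 : al != 0 by apply: (ehat_neq0 hvs) => //; exact: wf_pquo.
have be0 : be != 0 by apply: (ehat_neq0 hvs) => //; exact: wf_pcoef0.
have eT : ehat T = be + env w * al by rewrite (ev_split env w).
pose iK : {rmorphism C -> K} := @tofrac P \o cst.
pose th : {rmorphism P -> K} := frame_spec iK (solve_val w T).
have thE p : th p = frame_spec iK (solve_val w T) p by [].
have thX l : th 'X_l != 0.
  rewrite thE specX mulf_neq0 //; first by rewrite fmorph_eq0.
  rewrite /solve_val; case: (kap l =P w) => _.
    by rewrite oppr_eq0 mulf_neq0 ?invr_eq0 ?tofrac_eq0.
  by rewrite env_kap tofracM mulf_neq0 ?ratX_neq0 // (fmorph_eq0 iK) invr_eq0.
have thT : th (ehat T) = 0.
  rewrite thE (spec_ev _ _ hvs hT) (ev_split _ w) {2}/solve_val eqxx.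
  have e k : k != w -> solve_val w T k = tofrac (env k).
    by rewrite /solve_val => /negPf ->.
  rewrite (eq_ev_free (pfree_pcoef0 w T) e) (eq_ev_free (pfree_pquo hc) e).
  have tf p : ev (fun k => tofrac (env k)) p = tofrac (ehat p).
    by rewrite (rmorph_ev (@tofrac P)).
  by rewrite !tf mulNr divfK ?subrr // tofrac_eq0.
(* after multiplication by a power of [al], [p] is congruent to its value *)
have red p : exists k p' q, tofrac p' = tofrac al ^+ k * th p /\
                            al ^+ k * p = p' + q * ehat T.
  have gen v : th (env v) = solve_val w T v -> exists k p' q,
      tofrac p' = tofrac al ^+ k * th (env v) /\
      al ^+ k * env v = p' + q * ehat T.
    rewrite /solve_val => ->; case: (v =P w) => [->|_].
      exists 1%N, (- be), 1; split; last first.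
        by rewrite expr1 mul1r eT addKr mulrC.
      by rewrite expr1 tofracN mulrN mulrCA divff ?mulr1 ?tofrac_eq0.
    exists 0%N, (env v), 0; split; [exact: exp0_mul|exact: congr_refl].
  elim/frame_ind: p => [d|v hv|l|p q|p q].
  - exists 0%N, (cst d), 0; split; last exact: congr_refl.
    by rewrite thE spec_cst; exact: exp0_mul.
  - by apply: gen; apply: spec_env_frozen.
  - by apply: gen; apply: spec_env_kap.
  - move=> [k [p' [p2 [ep e]]]] [l [q' [q2 [eq e']]]].
    exists (k + l)%N, (al ^+ l * p' + al ^+ k * q'), (al ^+ l * p2 + al ^+ k * q2).
    split; last exact: congr_addM e e'.
    rewrite (rmorphD th); exact: (morph_comb (h := @tofrac P) ep eq).
  - move=> [k [p' [p2 [ep e]]]] [l [q' [q2 [eq e']]]].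
    exists (k + l)%N, (p' * q'), (p2 * (al ^+ l * q) + p' * q2).
    split; last exact: congr_mulM e e'.
    by rewrite !tofracM ep eq rmorphM; exact: expD_mul.
have root0 f : laurent f -> lval th f 0 -> laurent_dvd (tofrac (ehat T)) f.
  move=> lf [p [m [ef /esym/eqP]]].
  rewrite mulf_eq0 invr_eq0 (negPf (hom_mpolyX_neq0 thX m)) orbF => /eqP thp.
  have [k [p' [q [ep e]]]] := red p.
  move: ep; rewrite thp mulr0 => /eqP; rewrite tofrac_eq0 => /eqP p0.
  rewrite {}p0 add0r in e.
  have : laurent_dvd (tofrac (ehat T)) (tofrac al ^+ k * f).
    exists (tofrac q / tofrac ('X_[m] : P)); first by exists q, m.
    by rewrite ef mulrA -tofracXn -tofracM e tofracM mulrAC.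
  elim: k {e} => [|k ih]; first by rewrite expr0 mul1r.
  rewrite exprS -mulrA => /cancel h; apply/ih/h.
  by apply: laurentM => //; rewrite -tofracXn; exact: laurent_tofrac.
move=> f g lf lg dv.
have [vf hf] := laurent_lval th lf; have [vg hg] := laurent_lval th lg.
have /eqP := laurent_dvd_root thX thT dv (lvalM hf hg).
rewrite mulf_eq0 => /orP[] /eqP e; [left|right]; apply: root0 => //.
  by rewrite -e.
by rewrite -e.
Qed.

End Spec.
End Frame.

(** * Exchange polynomials are prime *)

Lemma pt_default (z : point) v : v \notin unzip1 z -> pt z v = 1%R.
Proof.
by move=> hv; rewrite /pt nth_default // memNindex // !size_map.
Qed.

Lemma pt12 (z : point) v : all (fun k => k < 12) (unzip1 z) -> 12 <= v -> pt z v = 1%R.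
Proof.
move=> /allP hz hv; apply: pt_default; apply/negP => /hz; by rewrite ltnNge hv.
Qed.

Section Prime.
Local Open Scope ring_scope.
Variable R : realType.
Local Notation C := (complex R).
Local Notation A := (coef_ring R).
Local Notation P := {mpoly A[5]}.
Local Notation K := {fraction P}.

Lemma ratC_is_zmod_morphism : zmod_morphism (@ratC A 5).
Proof. by move=> c d; rewrite /ratC !rmorphB. Qed.
Lemma ratC_is_monoid_morphism : monoid_morphism (@ratC A 5).
Proof. by split=> [|c d]; rewrite /ratC ?rmorph1 ?rmorphM. Qed.
HB.instance Definition _ :=
  GRing.isZmodMorphism.Build A K (@ratC A 5) ratC_is_zmod_morphism.
HB.instance Definition _ :=
  GRing.isMonoidMorphism.Build A K (@ratC A 5) ratC_is_monoid_morphism.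

Variables (gam del : nat -> nat) (kap : 'I_5 -> nat) (c : 'I_5 -> C).
Hypothesis gamP : forall k, (k < 12)%N ->
  [/\ (gam k < 12)%N, (del k < 12)%N, del (gam k) = k & gam (del k) = k].
Hypothesis kap_inj : injective kap.
Hypothesis kap12 : forall l, (12 <= kap l)%N.
Hypothesis c0 : forall l, c l != 0.

Local Notation env := (frame_env gam kap c).
Local Notation ehat := (ev env).
Local Notation spec := (frame_spec del kap c).

Lemma spec_int_X (z : nat -> int) : (forall l, z (kap l) = 1) ->
  forall l, spec idfun (iotaC R z) 'X_l != 0.
Proof. by move=> hz l; rewrite specX /iotaC hz mulr1; exact: c0. Qed.

Lemma laurent_env_inv l : laurent (tofrac (env (kap l)) : K)^-1.
Proof.
rewrite (env_kap _ _ kap_inj kap12) tofracM invfM.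
apply: laurentM; last exact: laurentXV.
rewrite -(fmorphV (@tofrac P \o @cst R)); exact: laurent_tofrac.
Qed.

(** By induction on the proof: [al] can be cancelled from a multiple of [T] because
    it is a unit, or because it is prime and does not divide [T]. *)
Lemma primeb_laurent_prime vs pc T : {subset vs <= codom kap} ->
  wf_poly vs T -> primeb pc T -> laurent_prime (ehat T).
Proof.
move=> hvs; elim: pc T => [//|[w z] pc ih] T hT /= /and4P [hc hb ha hcase].
apply: (linear_laurent_prime gamP kap_inj kap12 c0 hvs hT hc hb ha) => f lf [g lg e].
(* [e] says that [al * f = g * T]: it remains to divide [g] by [al] *)
have hq := wf_pquo w hT.
have aneq0 := ehat_neq0 gamP kap_inj kap12 c0 hvs hq ha.
case/orP: hcase => [/andP [/eqP em hm]|/and4P [hp hz /eqP za zT]].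
  set m := head _ _ in em hm.
  exists ((tofrac (ehat (pquo w T)))^-1 * g); last first.
    by rewrite -mulrA -e mulKf // tofrac_eq0.
  apply: laurentM lg; rewrite em ev_mon rmorph_prod /= -prodfV big_seq.
  apply: laurent_prod => k km; have h12 := allP hm _ km.
  have : k \in vs.
    move: hq; rewrite em /= andbT => /allP /(_ _ km) /orP[|//].
    by rewrite ltnNge h12.
  by move=> /hvs /codomP [l ->]; exact: laurent_env_inv.
have pal := ih _ hq hp.
have : laurent_dvd (tofrac (ehat (pquo w T))) (g * tofrac (ehat T)).
  by rewrite -e; exists f => //; rewrite mulrC.
case/pal => //; first exact: laurent_tofrac.
  move=> [g' lg' eg]; exists g' => //.
  apply: (mulfI (x := tofrac (ehat (pquo w T)))); first by rewrite tofrac_eq0.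
  by rewrite e eg [RHS]mulrCA mulrA.
move=> dv; exfalso; move/negP: zT; apply.
have hX : forall l, spec idfun (iotaC R (pt z)) 'X_l != 0.
  by apply: spec_int_X => l; apply: pt12.
have h0 : spec idfun (iotaC R (pt z)) (ehat (pquo w T)) = 0.
  by rewrite (spec_int gamP kap_inj kap12 c0 _ hvs hq) za.
have := laurent_dvd_root hX h0 dv (lval_tofrac _ _).
by rewrite /= (spec_int gamP kap_inj kap12 c0 _ hvs hT) => /eqP; rewrite intr_eq0.
Qed.

Lemma entry_nonunit vs e : {subset vs <= codom kap} -> entry_ok vs e ->
  ehat (epoly e) \isn't a GRing.unit.
Proof.
move=> hvs /and5P [hT _ _ _ /andP [/eqP h _]]; apply/negP => u.
have := rmorph_unit (spec idfun (iotaC R (pt (ezero e)))) u.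
by rewrite /= (spec_int gamP kap_inj kap12 c0 _ hvs hT) h unitr0.
Qed.

Lemma entry_X_free vs e : vs =i codom kap -> entry_ok vs e ->
  forall j q, ehat (epoly e) <> q * 'X_j.
Proof.
move=> hvs /and5P [hT _ hX _ _] j q eT.
have hvs' : {subset vs <= codom kap} by move=> v; rewrite hvs.
pose val v : C := if v == kap j then 0 else 1.
have := spec_ev gamP kap_inj kap12 c0 idfun val hvs' hT.
have v0 : val (kap j) = 0 by rewrite /val eqxx.
rewrite eT rmorphM /= specX v0 mulr0 mulr0.
rewrite -[ev val _]/(ev [eta (fun=> 1) with kap j |-> 0] _) ev_at0 ev_ones.
move/esym/eqP; rewrite pnatr_eq0 size_filter.
have /(allP hX) : kap j \in vs by rewrite hvs codom_f.
rewrite -has_predC has_count lt0n => /negPf h.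
by rewrite -[X in X == _]/(count (predC (fun m => kap j \in m)) (epoly e)) h.
Qed.

End Prime.

(** * Exponents of the exchange Laurent polynomials *)

Section Algebra.
Local Open Scope ring_scope.
Lemma factor_out (K : fieldType) (ei ej cj x b f t : K) :
  (ei * (b * (ej^-1 * f) + cj^-1 * (f / x) * t) =
  f * (ei * (ej^-1 * b + cj^-1 * (x^-1 * t))))%R.
Proof. by ring. Qed.

Lemma move_square (K : fieldType) (f g t : K) : f * (g * t ^+ 2) = t * (f * g * t).
Proof. by ring. Qed.

Lemma zero_value (K : fieldType) (ei ej cj b t : K) :
  ei != 0 -> ej != 0 -> cj != 0 ->
  ei * (ej^-1 * b + cj^-1 * ((cj * (ej / cj ^+ 2))^-1 * t)) = 0 -> b + t = 0.
Proof.
move=> i0 j0 c0; have -> : ei * (ej^-1 * b + cj^-1 * ((cj * (ej / cj ^+ 2))^-1 * t))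
    = ei * ej^-1 * (b + t).
  by field; rewrite j0 c0.
by move/eqP; rewrite !mulf_eq0 invr_eq0 (negPf i0) (negPf j0) => /eqP.
Qed.
End Algebra.

Section Step.
Local Open Scope ring_scope.
Variable R : realType.
Local Notation C := (complex R).
Local Notation A := (coef_ring R).
Local Notation P := {mpoly A[5]}.
Local Notation K := {fraction P}.

Lemma entry_atP es v : v \in ids es ->
  (forall a, all a es -> a (entry_at es v)) /\ evar (entry_at es v) = v.
Proof.
move=> hv; have hi : (index v (ids es) < size es)%N.
  by rewrite -(size_map evar) index_mem.
split; first by move=> a /all_nthP; apply.
by rewrite /entry_at -(nth_map _ 0%N) // nth_index.
Qed.

Lemma lval_ev (E : fieldType) (h : {rmorphism P -> E}) (hX : forall i, h 'X_i != 0)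
    (D : pred nat) (rho : nat -> K) (rho' : nat -> E) p :
  all (all D) p -> (forall k, D k -> lval h (rho k) (rho' k)) ->
  lval h (ev rho p) (ev rho' p).
Proof.
move=> /allP hp hr; rewrite /ev big_seq [X in lval _ _ X]big_seq.
apply: (lval_sum hX) => m /hp /allP hm; rewrite big_seq [X in lval _ _ X]big_seq.
by apply: lval_prod => k /hm; exact: hr.
Qed.

Definition iotaK (d : C) : K := tofrac (cst d).
HB.instance Definition _ := GRing.RMorphism.copy iotaK (@tofrac P \o @cst R).

Lemma iotaK_neq0 d : d != 0 -> iotaK d != 0.
Proof. by move=> h; rewrite (fmorph_eq0 iotaK). Qed.

Variables (gam del : nat -> nat) (kap : 'I_5 -> nat) (c : 'I_5 -> C).
Hypothesis gamP : forall k, (k < 12)%N ->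
  [/\ (gam k < 12)%N, (del k < 12)%N, del (gam k) = k & gam (del k) = k].
Hypothesis kap_inj : injective kap.
Hypothesis kap12 : forall l, (12 <= kap l)%N.
Hypothesis c0 : forall l, c l != 0.

Local Notation env := (frame_env gam kap c).
Local Notation ehat := (ev env).
Local Notation spec := (frame_spec del kap c).

(** Values of the generators when the cluster variables take the values [u] and
    the frozen variables are unchanged. *)
Definition mval (u : 'I_5 -> K) (v : nat) : K :=
  if (v < 12)%N then tofrac (env v)
  else iotaK (c (kidx kap v))^-1 * u (kidx kap v).

Lemma mval_frozen u v : (v < 12)%N -> mval u v = tofrac (env v).
Proof. by rewrite /mval => ->. Qed.

Lemma mval_kap u l : mval u (kap l) = iotaK (c l)^-1 * u l.
Proof. by rewrite /mval ltnNge kap12 kidxK. Qed.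

Lemma mval_kap_ratX u l : u l = ratX A l -> mval u (kap l) = tofrac (env (kap l)).
Proof. by move=> e; rewrite mval_kap e (env_kap _ _ kap_inj kap12) tofracM. Qed.

Lemma mmap_cst u d : mmap (@ratC A 5) u (cst d) = iotaK d.
Proof. exact: mmapC. Qed.

Lemma mmap_ev u p : mmap (@ratC A 5) u (ehat p) = ev (mval u) p.
Proof.
rewrite (rmorph_ev (mmap (@ratC A 5) u)); apply: eq_ev_ext => v /=.
rewrite /mval /frame_env; case: ifP => _; first exact: mmapC.
by rewrite rmorphM /= mmap_cst mmapX mmap1U.
Qed.

Variables (es : seq entry).
Hypothesis hes : seed_ok es.
Hypothesis hcod : codom kap =i ids es.
Local Notation T v := (epoly (entry_at es v)).

Lemma ids_codom : {subset ids es <= codom kap}.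
Proof. by move=> v; rewrite hcod. Qed.

Lemma kap_ids l : kap l \in ids es.
Proof. by rewrite -hcod codom_f. Qed.

Lemma entry_okP l : entry_ok (ids es) (entry_at es (kap l)) /\
  evar (entry_at es (kap l)) = kap l.
Proof.
have [h1 h2] := entry_atP (kap_ids l); split=> //.
by have /and4P [_ _ _ /h1] := hes.
Qed.

Lemma T_wf l : wf_poly (ids es) (T (kap l)).
Proof. by have [/and5P []] := entry_okP l. Qed.

Lemma T_free l : pfree (kap l) (T (kap l)).
Proof. by have [/and5P [_ +]] := entry_okP l; move=> + _ _ _ e; rewrite {1}e. Qed.

Lemma T_zero l : evalz (pt (ezero (entry_at es (kap l)))) (T (kap l)) = 0.
Proof. by have [/and5P [_ _ _ _ /andP [/eqP]]] := entry_okP l. Qed.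

Lemma T_zero12 l v : (12 <= v)%N -> pt (ezero (entry_at es (kap l))) v = 1.
Proof. by have [/and5P [_ _ _ h _] _] := entry_okP l; exact: pt12. Qed.

Variables (F : fieldType) (s : seed A 5 F) (e : 'I_5 -> C).
Hypothesis e0 : forall l, e l != 0.
Hypothesis hs : forall l, exch s l = cst (e l) * ehat (T (kap l)).

(** Let [z] be the zero of [F_j] in the table. The cluster variable [j] does not
    occur in [F_j], so its value [y] is free at this zero, where [F_j / x_j] is
    0. If [expo] fails, then the substituted polynomial takes at this zero the
    value of [F_i] at [x_j := 0], which is not 0, and [F_j] does not divide it.
    Otherwise [F_j] divides it, and the value of the quotient at the zero is
    not 0 either. *)
Lemma exch_exponents_expo i m : exch_exponents s i m ->
  (forall j, j != i -> expo_ok es (kap i) (kap j)) ->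
  forall j, j != i -> m j = expo es (kap i) (kap j).
Proof.
move=> hm hok j ji; have /hm [] := ji; have := hok j ji.
set Fj := tofrac _; set u : 'I_5 -> K := [eta _ with j |-> _].
have ul l : l != j -> u l = ratX A l by rewrite /u /= => /negPf ->.
have uj : u j = Fj / ratX A j by rewrite /u /= eqxx.
rewrite hs rmorphM /= mmap_cst mmap_ev.
have eFj : Fj = iotaK (e j) * tofrac (ehat (T (kap j))) by rewrite /Fj hs tofracM.
have Fj0 : Fj != 0.
  rewrite eFj mulf_neq0 ?iotaK_neq0 ?e0 // tofrac_eq0.
  apply: (ehat_neq0 gamP kap_inj kap12 c0 ids_codom (T_wf j)).
  have [/and5P [_ _ /allP /(_ _ (kap_ids j)) + _ _] _] := entry_okP j.
  by apply: contraNneq => ->.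
(* the zero of [F_j], where the value of the generator [kap j] is still free *)
pose val (y : C) : nat -> C :=
  [eta iotaC R (pt (ezero (entry_at es (kap j)))) with kap j |-> y].
have valT y : spec idfun (val y) (ehat (T (kap j))) = 0.
  rewrite (spec_ev gamP kap_inj kap12 c0 _ _ ids_codom (T_wf j)).
  rewrite (eq_ev_free (T_free j) (rho' := iotaC R (pt (ezero (entry_at es (kap j)))))).
    by rewrite -evalz_intr T_zero.
  by move=> k /negPf hk; rewrite /val /= hk.
have valF y : spec idfun (val y) (exch s j) = 0.
  by rewrite hs rmorphM /= valT mulr0.
have valX y : y != 0 -> forall l, spec idfun (val y) 'X_l != 0.
  move=> y0 l; rewrite specX mulf_neq0 ?c0 // /val /=.
  by case: ifP => // _; rewrite /iotaC T_zero12 ?kap12 ?oner_eq0.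
pose z0 := at0 (pt (ezero (entry_at es (kap j)))) (kap j).
have lmval y p : y != 0 -> wf_poly (ids es) p ->
    lval (spec idfun (val y)) (ev (mval u) p) (evalz z0 p)%:~R.
  move=> y0 hp; rewrite evalz_intr.
  apply: (lval_ev (valX _ y0) hp) => k /orP[k12|/ids_codom /codomP [l ->]].
    rewrite mval_frozen //.
    have -> : (z0 k)%:~R = spec idfun (val y) (env k).
      rewrite (spec_env_frozen _ _ gamP) // /val /= /z0 /at0.
      by case: eqP => // ek; move: k12; rewrite ek ltnNge kap12.
    exact: lval_tofrac.
  case: (eqVneq l j) => [->|lj].
    rewrite mval_kap uj /z0 /at0 eqxx.
    rewrite -[X in lval _ _ X]/(0 : C).
    have <- : spec idfun (val y) (cst (c j)^-1) *
              (spec idfun (val y) (exch s j) * (spec idfun (val y) 'X_j)^-1) = 0 :> C.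
      by rewrite hs rmorphM /= valT mulr0 mul0r mulr0.
    apply: lvalM; first exact: lval_tofrac.
    by apply: lvalM; [exact: lval_tofrac|exact: lvalXV].
  rewrite mval_kap_ratX ?ul //.
  have -> : (z0 (kap l))%:~R = spec idfun (val y) (env (kap l)).
    rewrite (spec_env_kap _ _ kap_inj kap12 c0) /val /= /z0 /at0.
    by rewrite (inj_eq kap_inj) (negPf lj).
  exact: lval_tofrac.
rewrite /expo_ok; case: ifP => hx.
  move=> /and3P [hB fB hz] dv mx; apply/eqP; rewrite eqn_leq.
  set B := pquotient _ _ in hB fB hz.
  have eQ : iotaK (e i) * ev (mval u) (T (kap i)) =
      Fj * (iotaK (e i) * (iotaK (e j)^-1 * tofrac (ehat B) +
            iotaK (c j)^-1 * ((ratX A j)^-1 * ev (mval u) (pquo (kap j) (T (kap i)))))).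
    rewrite (ev_split _ (kap j)) mval_kap uj (pdvd_ev _ hx) -/B.
    have tf p : pfree (kap j) p -> wf_poly (ids es) p ->
        ev (mval u) p = tofrac (ehat p).
      move=> fp wp; rewrite (rmorph_ev (@tofrac P)).
      apply: (eq_ev (D := fun k => ((k < 12)%N || (k \in ids es)) && (k != kap j))).
        apply/allP => d hd; apply/allP => k hk; rewrite (allP (allP wp _ hd) _ hk).
        by apply: contraNneq (allP fp _ hd) => <-.
      move=> k /andP [/orP[k12 _|/ids_codom /codomP [l ->]]].
        by rewrite mval_frozen.
      by rewrite (inj_eq kap_inj) => lj; rewrite mval_kap_ratX ?ul.
    rewrite (tf _ fB hB) (tf _ (T_free j) (T_wf j)).
    have -> : tofrac (ehat (T (kap j))) = iotaK (e j)^-1 * Fj.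
      rewrite eFj (fmorphV iotaK) mulKf; first by [].
      exact: iotaK_neq0.
    rewrite !(fmorphV iotaK); exact: factor_out.
  set Q := (X in Fj * X) in eQ.
  (* the choice that gives the two terms of the quotient [Q] the same scaling *)
  pose y := e j / c j ^+ 2.
  have y0 : y != 0 by rewrite mulf_neq0 ?invr_eq0 ?expf_neq0 ?c0 ?e0.
  have hQ := lvalM (lval_tofrac (spec idfun (val y)) (cst (e i)))
    (lvalD (valX _ y0)
       (lvalM (lval_tofrac _ (cst (e j)^-1)) (lval_tofrac _ (ehat B)))
       (lvalM (lval_tofrac _ (cst (c j)^-1))
          (lvalM (lvalXV _ j) (lmval _ _ y0 (wf_pquo (kap j) (T_wf i)))))).
  rewrite -[X in lval _ X _]/Q in hQ.
  rewrite eQ in dv mx; apply/andP; split; last first.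
    apply: mx; rewrite expr1; exists Q; [exact: lval_laurent hQ|exact: mulrC].
  rewrite leqNgt; apply/negP => m1; move/negP: hz; apply.
  have dvQ : laurent_dvd Fj Q.
    case: dv => f lf eF; exists (f * Fj ^+ (m j - 2)).
      by apply: laurentM => //; apply/laurentX/laurent_tofrac.
    apply: (mulfI Fj0); rewrite eF -{1}(subnK m1) exprD; exact: move_square.
  have := laurent_dvd_root (valX _ y0) (valF y) dvQ hQ.
  have hBv : spec idfun (val y) (ehat B) = (evalz z0 B)%:~R.
    rewrite (spec_ev gamP kap_inj kap12 c0 _ _ ids_codom hB) evalz_intr.
    by apply: (eq_ev_free fB) => k /negPf hk; rewrite /val /z0 /at0 /= hk.
  have vy : val y (kap j) = y by rewrite /val /= eqxx.
  rewrite /= !spec_cst hBv specX vy.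
  move/(zero_value (e0 i) (e0 j) (c0 j)) => /eqP.
  by rewrite -intrD intr_eq0 !evalzE -ev_cat.
move=> hz dv mx.
case: (m j) dv {mx} => [//|r]; rewrite exprS => dv.
have y0 : (1 : C) != 0 by exact: oner_neq0.
have hl := lvalM (lval_tofrac (spec idfun (val 1)) (cst (e i))) (lmval _ _ y0 (T_wf i)).
have dv1 : laurent_dvd Fj (iotaK (e i) * ev (mval u) (T (kap i))).
  case: dv => f lf ->; exists (f * Fj ^+ r); last by rewrite [Fj * _]mulrC mulrA.
  by apply: laurentM => //; apply/laurentX/laurent_tofrac.
have /eqP := laurent_dvd_root (valX _ y0) (valF _) dv1 hl.
by rewrite /= spec_cst mulf_eq0 (negPf (e0 _)) /= intr_eq0 (negPf hz).
Qed.

End Step.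

(** * Mutated exchange polynomials *)

Section Scaling.
Local Open Scope ring_scope.
Variable K : fieldType.

Lemma mutation_scaling (ei ci a p X x : K) :
  ei != 0 -> ci != 0 -> p != 0 -> X != 0 -> x != 0 ->
  ci^-1 * (ei * a * X^-1 / x) = a / ((ei / ci * p)^-1 * x * (p * X)).
Proof. by move=> *; field; apply/and5P. Qed.

Lemma divide_out (e q t v M : K) : M != 0 -> q * t = M * v ->
  e * v = e * (q / M) * t.
Proof. by move=> M0 h; rewrite -mulrA [q / M * t]mulrAC h mulrAC divff ?mul1r. Qed.
End Scaling.

Section Mutation.
Local Open Scope ring_scope.
Variable R : realType.
Local Notation C := (complex R).
Local Notation A := (coef_ring R).
Local Notation P := {mpoly A[5]}.
Local Notation K := {fraction P}.

Lemma unit_cst (a : A) : a \is a GRing.unit ->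
  exists2 d : C, d != 0 & a%:MP = cst d :> P.
Proof.
move=> ua; have /andP [/eqP ea ud] : mpoly_unit (a : {mpoly C[12]}) := ua.
by exists (a@_0); [rewrite unitfE in ud | rewrite /cst -ea].
Qed.

Lemma laurent_dvd_trans (f g h : K) :
  laurent_dvd f g -> laurent_dvd g h -> laurent_dvd f h.
Proof.
move=> [a la ->] [b lb ->]; exists (b * a); first exact: laurentM.
by rewrite mulrA.
Qed.

Variables (gam del : nat -> nat) (kap : 'I_5 -> nat) (c : 'I_5 -> C).
Hypothesis gamP : forall k, (k < 12)%N ->
  [/\ (gam k < 12)%N, (del k < 12)%N, del (gam k) = k & gam (del k) = k].
Hypothesis kap_inj : injective kap.
Hypothesis kap12 : forall l, (12 <= kap l)%N.
Hypothesis c0 : forall l, c l != 0.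

Local Notation env := (frame_env gam kap c).

Variables (es : seq entry).
Hypothesis hes : seed_ok es.
Hypothesis hcod : codom kap =i ids es.
Local Notation T v := (epoly (entry_at es v)).

Variables (F : fieldType) (s : seed A 5 F) (e : 'I_5 -> C).
Hypothesis e0 : forall l, e l != 0.
Hypothesis hs : forall l, exch s l = cst (e l) * ev env (T (kap l)).

Variables (i : 'I_5) (w : nat).
Hypothesis w12 : (12 <= w)%N.
Hypothesis wids : w \notin ids es.

(** The frame of the mutated seed, before the symmetry that relates it to the list
    is applied: the generator [w] takes the place of [kap i], and [newc] is the
    constant that comes with it. *)
Definition kmid (l : 'I_5) : nat := if l == i then w else kap l.

Definition newc : C :=
  e i * (c i)^-1 * \prod_(l | (l != i) && expo es (kap i) (kap l)) (c l)^-1.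
Definition cmid (l : 'I_5) : C := if l == i then newc else c l.

Local Notation menv := (frame_env gam kmid cmid).

Lemma newc_neq0 : newc != 0.
Proof.
rewrite /newc !mulf_neq0 ?invr_eq0 //.
by apply/prodf_neq0 => l _; rewrite invr_eq0.
Qed.

Lemma cmid_neq0 l : cmid l != 0.
Proof. by rewrite /cmid; case: ifP => // _; exact: newc_neq0. Qed.

Lemma kmid12 l : (12 <= kmid l)%N.
Proof. by rewrite /kmid; case: ifP. Qed.

Lemma w_kap l : w != kap l.
Proof. by apply: contraNneq wids => ->; exact: kap_ids. Qed.

Lemma kmid_inj : injective kmid.
Proof.
move=> l l'; rewrite /kmid; case: eqP => [->|_]; case: eqP => [->|_] //.
- by move/eqP; rewrite (negPf (w_kap _)).
- by move/esym/eqP; rewrite (negPf (w_kap _)).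
- exact: kap_inj.
Qed.

Lemma menv_frozen v : (v < 12)%N -> menv v = env v.
Proof. by rewrite /frame_env => ->. Qed.

Lemma menv_kap l : l != i -> menv (kap l) = env (kap l).
Proof.
move=> li; have e1 : kmid l = kap l by rewrite /kmid (negPf li).
rewrite -{1}e1 (env_kap _ _ kmid_inj kmid12) (env_kap _ _ kap_inj kap12).
by rewrite /cmid (negPf li).
Qed.

Lemma menv_w : menv w = cst newc^-1 * 'X_i.
Proof.
have e1 : kmid i = w by rewrite /kmid eqxx.
by rewrite -{1}e1 (env_kap _ _ kmid_inj kmid12) /cmid eqxx.
Qed.

Lemma ev_menv p : wf_poly (ids es) p -> pfree (kap i) p -> ev menv p = ev env p.
Proof.
move=> wp fp.
apply: (eq_ev (D := fun k => ((k < 12)%N || (k \in ids es)) && (k != kap i))).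
  apply/allP => d hd; apply/allP => k hk; rewrite (allP (allP wp _ hd) _ hk).
  by apply: contraNneq (allP fp _ hd) => <-.
move=> k /andP [/orP[k12 _|/(ids_codom hcod) /codomP [l ->]]].
  exact: menv_frozen.
by rewrite (inj_eq kap_inj); exact: menv_kap.
Qed.

Local Notation S := (fun l => (l != i) && expo es (kap i) (kap l)).

Lemma prod_denom (E : comNzRingType) (f : nat -> E) :
  \prod_(k <- denom es (kap i)) f k = \prod_(l | S l) f (kap l).
Proof.
rewrite big_filter (perm_big (codom kap)) /=.
  rewrite big_image_cond /=; apply: eq_bigl => l.
  by rewrite (inj_eq kap_inj).
have /and4P [_ u _ _] := hes.
by apply: uniq_perm => [//||v]; [exact/injectiveP|rewrite hcod].
Qed.

Variables (m : 'I_5 -> nat) (j : 'I_5).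
Hypothesis ji : j != i.
Hypothesis hm : forall l, l != i -> m l = expo es (kap i) (kap l).
Hypothesis mj : ~~ expo es (kap i) (kap j).

Local Notation A0 := (pcoef0 (kap j) (T (kap i))).
Local Notation h0 := (exch_laurent0 s i m j).
Local Notation M := (menv w * \prod_(k <- denom es (kap i)) menv k).

(** The exponent of [j] is 0, so the value 0 of [x_j] is not inverted; and [F_i],
    which does not depend on [x_i], is the same in the old and new frames. *)
Lemma h0E : h0 = iotaK (e i) * tofrac (ev menv A0) * \prod_(l | S l) (ratX A l)^-1.
Proof.
rewrite /exch_laurent0 /exch_laurent hs rmorphM /= mmap_cst.
rewrite mmap_ev; congr (_ * _ * _).
  rewrite ev_menv; first last.
  - apply/allP => d; rewrite mem_filter => /andP [_].
    by move/(allP (T_free hes hcod i)).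
  - exact: wf_pcoef0 (T_wf hes hcod i).
  rewrite (rmorph_ev (@tofrac P)) -ev_at0.
  apply: (eq_ev (T_wf hes hcod i)) => k /orP [k12|/(ids_codom hcod) /codomP [l ->]].
    rewrite mval_frozen // /=; case: eqP => // ek.
    by move: k12; rewrite ek ltnNge kap12.
  rewrite (mval_kap _ _ kap_inj kap12) /= (inj_eq kap_inj).
  case: eqP => [_|_]; first by rewrite mulr0.
  by rewrite (env_kap _ _ kap_inj kap12) tofracM.
rewrite [LHS](bigID (fun l => expo es (kap i) (kap l))) /=.
rewrite [X in _ * X]big1 ?mulr1.
  apply: eq_bigr => l /andP [li hl].
  rewrite (hm li) hl expr1; case: eqP => // lj.
  by move: mj; rewrite -lj hl.
by move=> l /andP [li /negPf hl]; rewrite (hm li) hl expr0 invr1.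
Qed.

Lemma menv_lift (f : nat -> K) p : wf_poly (ids es) p ->
  (forall k, (k < 12)%N -> f k = tofrac (menv k)) ->
  (forall l, l != i -> f (kap l) = tofrac (menv (kap l))) ->
  ev f p = ev [eta (@tofrac P \o menv) with kap i |-> f (kap i)] p.
Proof.
move=> wp f12 fk; apply: (eq_ev wp) => k.
rewrite unfold_in => /orP [k12|/(ids_codom hcod) /codomP [l ->]] /=.
  by case: eqP => [<-//|_]; exact: f12.
by rewrite (inj_eq kap_inj); case: eqP => [->//|/eqP]; exact: fk.
Qed.

Lemma iotaKV d : iotaK d^-1 = (iotaK d)^-1 :> K.
Proof. exact: (fmorphV (@iotaK R)). Qed.

Lemma iotaK_newc : iotaK newc = iotaK (e i) / iotaK (c i) *
  \prod_(l | S l) iotaK (c l)^-1.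
Proof.
rewrite /newc (rmorphM (@iotaK R)) (rmorphM (@iotaK R) (e i)).
by rewrite (rmorph_prod (@iotaK R)) (fmorphV (@iotaK R) (c i)).
Qed.

(** The element substituted for the generator [kap i] is, in the new frame, the
    quotient by [w] of the exchange Laurent polynomial at [x_j := 0], without
    any constant: this is what the value of [newc] is made for. *)
Lemma mutated_value :
  let u := [eta @ratX A 5 with i |-> h0 / ratX A i] in
  iotaK (c i)^-1 * u i = ev (@tofrac P \o menv) A0 /
    \prod_(k <- w :: denom es (kap i)) (@tofrac P \o menv) k.
Proof.
rewrite /= eqxx h0E -(rmorph_ev (@tofrac P)) big_cons prod_denom /=.
rewrite [X in _ = _ / (_ * X)](eq_bigr (fun l => iotaK (c l)^-1 * ratX A l)); last first.
  move=> l /andP [li _]; rewrite menv_kap // (env_kap _ _ kap_inj kap12).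
  by rewrite tofracM.
rewrite big_split prodfV menv_w tofracM /=.
rewrite -[tofrac (cst newc^-1)]/(iotaK newc^-1) !iotaKV iotaK_newc.
apply: mutation_scaling; rewrite ?iotaK_neq0 ?ratX_neq0 //.
- by apply/prodf_neq0 => l _; rewrite iotaK_neq0 // invr_eq0.
- by apply/prodf_neq0 => l _; exact: ratX_neq0.
Qed.

Variables (T' : ppoly) (vs' : seq nat) (zm : nat -> int).
Hypothesis hvs' : {subset vs' <= codom kmid}.
Hypothesis wfT' : wf_poly vs' T'.
Hypothesis T'_prime : laurent_prime (ev menv T').
Hypothesis T'_nonunit : ev menv T' \isn't a GRing.unit.
Hypothesis T'_X_free : forall l q, ev menv T' <> q * 'X_l.
Hypothesis zm1 : forall l, zm (kmid l) = 1.
Hypothesis zmT' : evalz zm T' = 0.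
Hypothesis zmA0 : evalz zm A0 != 0.
Hypothesis dvdT' : pdvd
  (psubst (kap i) A0 (w :: denom es (kap i)) (pdeg (kap i) (T (kap j))) (T (kap j)))
  T'.

Lemma menv_mono_neq0 :
  \prod_(k <- w :: denom es (kap i)) (@tofrac P \o menv) k != 0.
Proof.
rewrite big_cons prod_denom mulf_neq0 //=.
  rewrite menv_w tofracM mulf_neq0 ?ratX_neq0 //.
  by apply: iotaK_neq0; rewrite invr_eq0 newc_neq0.
apply/prodf_neq0 => l /andP [li _].
rewrite menv_kap // (env_kap _ _ kap_inj kap12) tofracM mulf_neq0 ?ratX_neq0 //.
by apply: iotaK_neq0; rewrite invr_eq0.
Qed.

Lemma menv_mono_inv :
  laurent (\prod_(k <- w :: denom es (kap i)) (@tofrac P \o menv) k)^-1.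
Proof.
rewrite big_cons prod_denom invfM -prodfV; apply: laurentM.
  have e1 : kmid i = w by rewrite /kmid eqxx.
  by rewrite -e1; exact: (laurent_env_inv gam cmid kmid_inj kmid12).
apply: laurent_prod => l /andP [li _] /=; rewrite menv_kap //.
exact: (laurent_env_inv gam c kap_inj kap12).
Qed.

Lemma mutated_dvd :
  laurent_dvd (tofrac (ev menv T'))
    (mmap (@ratC A 5) [eta @ratX A 5 with i |-> h0 / ratX A i] (exch s j)).
Proof.
rewrite hs rmorphM /= mmap_cst mmap_ev.
set u := [eta _ with i |-> _].
rewrite (@menv_lift (mval gam kap c u) _ (T_wf hes hcod j)); first last.
- move=> l li; rewrite (mval_kap_ratX _ _ kap_inj kap12) ?menv_kap //.
  by rewrite /u /= (negPf li).
- by move=> k k12; rewrite (menv_frozen k12); exact: mval_frozen.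
rewrite (mval_kap _ _ kap_inj kap12) mutated_value.
have := ev_psubst (rho := @tofrac P \o menv) (v := kap i) A0 menv_mono_neq0
  (leqnn (pdeg (kap i) (T (kap j)))).
rewrite (pdvd_ev _ dvdT'); set M' := \prod_(_ <- _) _; set D := pdeg _ _.
set V := ev _ (T (kap j)); set Q := ev _ _ => eM.
have M0 : M' ^+ D != 0 by rewrite expf_neq0 // menv_mono_neq0.
exists (iotaK (e j) * (Q / M' ^+ D)).
  apply: laurentM; first exact: laurent_tofrac.
  apply: laurentM; last by rewrite -exprVn; apply/laurentX/menv_mono_inv.
  by rewrite /Q -(rmorph_ev (@tofrac P)); exact: laurent_tofrac.
rewrite (rmorph_ev (@tofrac P)); apply: (divide_out _ M0).
by rewrite -eM.
Qed.

(** [T'] is prime and divides [G], the product of the [ds] and [H]. It does not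
    divide any of the [ds], which divide [h0], because [h0] is not 0 at the zero
    [zm] of [T']. So it divides [H], and [F'], which is irreducible. *)
Lemma mutated_exch_unique F' : irreducible_elt F' -> mutated_exch s i m j F' ->
  exists2 a : C, a != 0 & F' = cst a * ev menv T'.
Proof.
move=> irr [ds [H [x [eG hds lH _ eF]]]].
have h0X l : frame_spec del kmid cmid idfun (iotaC R zm) 'X_l != 0.
  by apply: (spec_int_X _ cmid_neq0).
have := mutated_dvd; rewrite eG.
case/(laurent_prime_prod T'_prime (fun d hd => proj1 (hds d hd)) lH).
  move=> [d /hds [_ dh0] /laurent_dvd_trans /(_ dh0) {dh0 eG hds}].
  rewrite h0E => dv; exfalso; move/negP: zmA0; apply.
  have wA : wf_poly (ids es) A0 by apply: wf_pcoef0 (T_wf hes hcod i).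
  have hl := lvalM (lvalM (lval_tofrac (frame_spec del kmid cmid idfun (iotaC R zm))
      (cst (e i))) (lval_tofrac _ (ev menv A0)))
    (lval_prod (index_enum 'I_5) (fun l (_ : S l) => lvalXV _ l)).
  have zT : frame_spec del kmid cmid idfun (iotaC R zm) (ev menv T') = 0.
    by rewrite (spec_int gamP kmid_inj kmid12 cmid_neq0 _ hvs' wfT') zmT'.
  have /eqP := laurent_dvd_root h0X zT dv hl.
  rewrite !mulf_eq0 /= spec_cst (negPf (e0 _)) /=.
  have /negPf -> : \prod_(l | S l)
      (frame_spec del kmid cmid idfun (iotaC R zm) 'X_l)^-1 != 0.
    by apply/prodf_neq0 => l _; rewrite invr_eq0.
  rewrite orbF rmorph_ev.
  rewrite (eq_ev (D := fun k => ((k < 12)%N || (k \in ids es)) && (k != kap i))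
     (rho' := iotaC R zm)) -?evalz_intr ?intr_eq0 //.
    apply/allP => d' hd; apply/allP => k hk; rewrite (allP (allP wA _ hd) _ hk) /=.
    move: hd; rewrite mem_filter => /andP [_ /(allP (T_free hes hcod i))].
    by apply: contraNneq => <-.
  move=> k /andP [/orP[k12 _|/(ids_codom hcod) /codomP [l ->]]] /=.
    exact: (spec_env_frozen _ _ gamP).
  rewrite (inj_eq kap_inj) => li.
  have {1 2}-> : kap l = kmid l by rewrite /kmid (negPf li).
  exact: (spec_env_kap _ _ kmid_inj kmid12 cmid_neq0).
move=> dvH.
have dvF : laurent_dvd (tofrac (ev menv T')) (tofrac F').
  by rewrite eF mulrC; apply: laurent_dvdM => //; exact: laurent_monom.
have [a ua ->] := irreducible_laurent_dvd irr T'_nonunit T'_X_free dvF.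
have [d d0 ed] := unit_cst ua.
by exists d => //; rewrite -ed mul_mpolyC.
Qed.

End Mutation.

(** * Symmetries of the relations *)

Section Relations.
Local Open Scope ring_scope.

Definition sat (S : comNzRingType) (rho : nat -> S) (r : prel) : Prop :=
  ev rho r.1 = ev rho r.2.
Definition sats (S : comNzRingType) (rho : nat -> S) (rs : seq prel) : Prop :=
  forall r, r \in rs -> sat rho r.

Definition small (r : prel) : bool := all (all (fun v => v < 44)%N) (r.1 ++ r.2).

Lemma eq_sat (S : comNzRingType) (rho rho' : nat -> S) r :
  small r -> (forall v, (v < 44)%N -> rho v = rho' v) -> sat rho r -> sat rho' r.
Proof.
rewrite /small all_cat => /andP [h1 h2] e; rewrite /sat => h.
by rewrite -(eq_ev (rho := rho) h1 e) -(eq_ev (rho := rho) h2 e).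
Qed.

Lemma small_base : all small base.
Proof. by vm_compute. Qed.

Lemma eq_sats (S : comNzRingType) (rho rho' : nat -> S) :
  (forall v, (v < 44)%N -> rho v = rho' v) -> sats rho base -> sats rho' base.
Proof.
move=> e h r hr; apply: (eq_sat _ e (h _ hr)); exact: (allP small_base).
Qed.

(** A permutation of the generators that is compatible with all solutions of the
    relations; [d] is the inverse permutation. *)
Definition symmetry (g d : nat -> nat) : Prop :=
  [/\ forall k, (k < 12 -> g k < 12 /\ d k < 12)%N,
      forall k, (12 <= k < 44 -> 12 <= g k < 44 /\ 12 <= d k < 44)%N,
      forall k, (k < 44)%N -> d (g k) = k /\ g (d k) = k &
      forall (S : comNzRingType) (rho : nat -> S),
        sats rho base -> sats (rho \o g) base].

Lemma symmetry_lt44 g d k : symmetry g d -> (k < 44)%N -> (g k < 44 /\ d k < 44)%N.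
Proof.
move=> [h1 h2 _ _] k44; case: (ltnP k 12) => k12.
  have [/ltn_trans a /ltn_trans b] := h1 _ k12; split; [exact: a|exact: b].
by have [/andP [_ ->] /andP [_ ->]] := h2 k (introT andP (conj k12 k44)).
Qed.

Lemma symmetry_id : symmetry id id.
Proof. by split. Qed.

Lemma symmetry_comp g d g' d' : symmetry g d -> symmetry g' d' ->
  symmetry (g \o g') (d' \o d).
Proof.
move=> sg sg'; have lt := symmetry_lt44 sg; have lt' := symmetry_lt44 sg'.
move: sg sg' => [a1 a2 a3 a4] [b1 b2 b3 b4]; split=> [k hk|k hk|k hk|S rho h].
- by split; [have [/a1 []] := b1 k hk | have [_ /b1 []] := a1 k hk].
- by split; [have [/a2 []] := b2 k hk | have [_ /b2 []] := a2 k hk].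
- split; first by rewrite /= (a3 _ (lt' _ hk).1).1 (b3 _ hk).1.
  by rewrite /= (b3 _ (lt _ hk).2).2 (a3 _ hk).2.
exact: (b4 S (rho \o g) (a4 S rho h)).
Qed.

Lemma eq_symmetry g d g' d' : symmetry g d ->
  (forall k, (k < 44)%N -> g k = g' k) -> (forall k, (k < 44)%N -> d k = d' k) ->
  symmetry g' d'.
Proof.
move=> sg eg ed; have lt := symmetry_lt44 sg; move: sg => [a1 a2 a3 a4].
split=> [k hk|k hk|k hk|S rho h].
- by rewrite -eg ?(ltn_trans hk) // -ed ?(ltn_trans hk) //; exact: a1.
- by have /andP [_ k44] := hk; rewrite -eg // -ed //; exact: a2.
- split; first by rewrite -(eg k hk) -(ed _ (lt k hk).1) (a3 k hk).1.
  by rewrite -(ed k hk) -(eg _ (lt k hk).2) (a3 k hk).2.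
by apply: (eq_sats _ (a4 S rho h)) => v hv /=; rewrite eg.
Qed.

Lemma pres_sats g (S : comNzRingType) (rho : nat -> S) :
  pres g -> sats rho base -> sats (rho \o g) base.
Proof.
move=> /allP hp h r /hp /hasP [r' /h hr' /andP [e1 e2]].
by rewrite /sat -(ev_prename rho g r.1) -(ev_prename rho g r.2) (peq_ev _ e1) (peq_ev _ e2).
Qed.

Lemma symmetry_rot : symmetry rot (iter 11 rot).
Proof.
split=> [k hk|k hk|k hk|S rho]; last by apply: pres_sats; vm_compute.
- have : all (fun k => (rot k < 12) && (iter 11 rot k < 12))%N (iota 0 12) by [].
  by move/allP/(_ k); rewrite mem_iota hk => /(_ isT) /andP.
- have : all (fun k => (12 <= rot k < 44) && (12 <= iter 11 rot k < 44))%N (iota 12 32).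
    by vm_compute.
  by move/allP/(_ k); rewrite mem_iota hk => /(_ isT) /andP.
- have : all (fun k => (iter 11 rot (rot k) == k) && (rot (iter 11 rot k) == k)) (iota 0 44).
    by vm_compute.
  by move/allP/(_ k); rewrite mem_iota hk => /(_ isT) /andP [/eqP ? /eqP].
Qed.

Lemma symmetry_refl : symmetry refl refl.
Proof.
split=> [k hk|k hk|k hk|S rho]; last by apply: pres_sats; vm_compute.
- have : all (fun k => refl k < 12)%N (iota 0 12) by [].
  by move/allP/(_ k); rewrite mem_iota hk => /(_ isT).
- have : all (fun k => 12 <= refl k < 44)%N (iota 12 32) by [].
  by move/allP/(_ k); rewrite mem_iota hk => /(_ isT).
- have : all (fun k => refl (refl k) == k) (iota 0 44) by [].
  by move/allP/(_ k); rewrite mem_iota hk => /(_ isT) /eqP.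
Qed.

Lemma symmetry_act g : exists d, symmetry (act g) d.
Proof.
case: g => b r; elim: r => [|r [d hd]].
  case: b; first by exists refl; exact: symmetry_refl.
  by exists id; exact: symmetry_id.
exists (d \o iter 11 rot); exact: (symmetry_comp symmetry_rot hd).
Qed.

Lemma tactE g k : (k < 44)%N -> act g k = tact g k.
Proof. by move=> hk; rewrite /tact nth_mkseq. Qed.

Lemma symmetry_tact g : symmetry (tact g) (tinv g).
Proof.
have [d hd] := symmetry_act g.
apply: (eq_symmetry hd) => [|k hk]; first exact: tactE.
have [_ _ h _] := hd; have [_ dk] := symmetry_lt44 hd hk.
have sz : size (acttab g) = 44%N by rewrite size_mkseq.
rewrite /tinv -{2}(h _ hk).2 (tactE _ dk) /tact index_uniq ?sz //.
apply/(uniqP 44) => x y; rewrite !inE sz => hx hy.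
rewrite -[nth _ _ x]/(tact g x) -[nth _ _ y]/(tact g y) -!tactE // => e.
by rewrite -(h x hx).1 e (h y hy).1.
Qed.

End Relations.

(** * Relations that hold where [x_1] is invertible *)

Section Chart.
Local Open Scope ring_scope.
Variables (S : comNzRingType) (rho : nat -> S).

Definition sev (p : spoly) : S := ev rho p.1 - ev rho p.2.

Lemma sev_add p q : sev (sadd p q) = sev p + sev q.
Proof. by rewrite /sev /= !ev_cat; ring. Qed.

Lemma sev_opp p : sev (sopp p) = - sev p.
Proof. by rewrite /sev /= opprB. Qed.

Lemma sev_mul p q : sev (smul p q) = sev p * sev q.
Proof. by rewrite /sev /= !ev_cat !ev_pmul; ring. Qed.

Lemma sev_pos p : sev (p, [::]) = ev rho p.
Proof. by rewrite /sev /= [X in _ - X]/ev big_nil subr0. Qed.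

Lemma ev_pvar v : ev rho (pvar v) = rho v.
Proof. by rewrite /pvar ev_mon big_seq1. Qed.

Definition valid (t : chart) : Prop := forall v, sev (chart_var t v) = rho v.

Lemma valid_mon t m : valid t -> sev (chart_mon t m) = \prod_(k <- m) rho k.
Proof.
move=> ht; elim: m => [|v m ih] /=.
  by rewrite sev_pos ev_one big_nil.
by rewrite sev_mul ih ht big_cons.
Qed.

Lemma valid_poly t p : valid t -> sev (chart_poly t p) = ev rho p.
Proof.
move=> ht; elim: p => [|m p ih] /=; first by rewrite /sev /ev !big_nil subr0.
by rewrite sev_add ih valid_mon // ev_cons.
Qed.

Lemma valid_cons t v p : valid t -> sev p = rho v -> valid ((v, p) :: t).
Proof.
move=> ht hp k; have := ht k; rewrite /chart_var /= inE.
by case: (eqVneq k v) => [->|kv] /= h; rewrite ?eqxx // eq_sym (negPf kv).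
Qed.

Hypothesis inv44 : rho 44 * rho 13 = 1.

Lemma ev_map_nfm p : ev rho (map nfm p) = ev rho p.
Proof.
rewrite /ev big_map; apply: eq_bigr => m _.
by rewrite (perm_big _ (permEl (perm_sort _ _))).
Qed.

(** Any step of the elimination is valid, whatever the order: at worst, the
    generators are not eliminated. *)
Lemma valid_solve t st : valid t -> sat rho st.2 -> valid (solve t st).
Proof.
case: st => [[v b] r] ht /= hr; rewrite /solve.
set m := if b then _ else _.
have hm : (if b then rho 44 else 1) * \prod_(k <- m) rho k = rho v.
  rewrite /m; case: (b); last by rewrite mul1r big_seq1.
  rewrite (perm_big _ (permEl (perm_sort _ _))) /= big_cons big_seq1.
  by rewrite mulrA inv44 mul1r.
have sol p q : m \in q -> ev rho p = ev rho q ->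
    valid ((v, if b then smul (pvar 44, [::])
      (sadd (chart_poly t p) (sopp (chart_poly t (rem m q)))) else
      sadd (chart_poly t p) (sopp (chart_poly t (rem m q)))) :: t).
  move=> mq e; apply: (valid_cons ht).
  have e1 : sev (sadd (chart_poly t p) (sopp (chart_poly t (rem m q)))) =
      \prod_(k <- m) rho k.
    rewrite sev_add sev_opp !valid_poly // e /ev.
    by rewrite (perm_big _ (perm_to_rem mq)) big_cons /= addrK.
  rewrite -hm; case: (b); last by rewrite e1 mul1r.
  by rewrite sev_mul sev_pos ev_pvar e1.
have e : ev rho (map nfm r.1) = ev rho (map nfm r.2) by rewrite !ev_map_nfm.
case: ifP => [mL|_]; first by apply: sol.
by case: ifP => [mR|_ //]; apply: sol.
Qed.

Lemma valid_nil : valid [::].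
Proof. by move=> v; rewrite /chart_var /= sev_pos ev_pvar. Qed.

Lemma valid_chart sts : (forall st, st \in sts -> sat rho st.2) ->
  valid (foldl solve [::] sts).
Proof.
move=> h; have : valid [::] by exact: valid_nil.
elim: sts [::] h => [|st sts ih] t h ht //=.
apply: ih => [st' hs|]; first by apply: h; rewrite inE hs orbT.
by apply: valid_solve => //; apply: h; rewrite mem_head.
Qed.

Lemma prod_cancel m : \prod_(k <- cancel m) rho k = \prod_(k <- m) rho k.
Proof.
rewrite /cancel; move: (geq_minl (count_mem 13 m) (count_mem 44 m))
  (geq_minr (count_mem 13 m) (count_mem 44 m)).
move: (minn _ _) => n; elim: n m => [//|n ih] m h13 h44.
have m44 : 44%N \in m by rewrite -has_pred1 has_count (leq_trans _ h44).
have m13 : 13%N \in m by rewrite -has_pred1 has_count (leq_trans _ h13).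
have m13' : 13%N \in rem 44 m.
  by have := perm_mem (perm_to_rem m44) 13; rewrite m13 inE.
have p44 := permP (perm_to_rem m44); have p13 := permP (perm_to_rem m13').
rewrite iterSr ih.
- rewrite [RHS](perm_big _ (perm_to_rem m44)) /= [in RHS]big_cons.
  rewrite [in RHS](perm_big _ (perm_to_rem m13')) /= [in RHS]big_cons.
  by rewrite mulrA inv44 mul1r.
- by move: h13; rewrite p44 /= p13.
- by move: h44; rewrite p44 /= p13.
Qed.

Lemma ev_cancel p : ev rho (map cancel p) = ev rho p.
Proof. by rewrite /ev big_map; apply: eq_bigr => m _; rewrite prod_cancel. Qed.

Lemma rel_ok_sat t r : valid t -> rel_ok t r -> sat rho r.
Proof.
move=> ht /andP [_ /(peq_ev rho)]; rewrite !ev_cancel !ev_cat => e.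
rewrite /sat -(valid_poly r.1 ht) -(valid_poly r.2 ht) /sev.
by apply/eqP; rewrite subr_eq addrAC -e addrK.
Qed.

End Chart.

Lemma chart_steps_base0 : all (fun st => st.2 \in base0) chart_steps.
Proof. by vm_compute. Qed.

(** After substitution of the chart, both sides are polynomials in the free
    generators and the inverse of [x_1], and the relation is an identity. *)
Lemma chart_relation (F : fieldType) (rho : nat -> F) r :
  sats rho base0 -> rho 13 != 0%R -> rel_ok x1_chart r -> sat rho r.
Proof.
move=> h h13 hr.
pose rho' := [eta rho with 44 |-> (rho 13)^-1%R].
have e v : v < 44 -> rho v = rho' v by rewrite /rho' /=; case: eqP => // ->.
have smr : small r by have /andP [] := hr.
apply: (eq_sat (rho := rho') smr) => [v hv|]; first by rewrite e.
have inv : (rho' 44 * rho' 13 = 1)%R by rewrite /rho' /= mulVf.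
apply: (rel_ok_sat inv _ hr); apply: valid_chart => // st hst.
have hb := allP chart_steps_base0 _ hst.
apply: (eq_sat (rho := rho) _ e (h _ hb)).
by apply: (allP small_base); rewrite /base mem_cat hb.
Qed.

Lemma base_of_base0 (F : fieldType) (rho : nat -> F) :
  sats rho base0 -> rho 13 != 0%R -> sats rho base.
Proof.
move=> h h13 r; rewrite /base mem_cat => /orP [/h //|hr].
apply: (chart_relation h h13); apply: (allP _ _ hr).
by vm_compute.
Qed.

Lemma relations_ok : all (fun r => rel_ok x1_chart (relation_prel r)) relations.
Proof. by vm_compute. Qed.

Lemma relation_sat (F : fieldType) (rho : nat -> F) r :
  sats rho base -> rho 13 != 0%R -> (r < size relations)%N ->
  sat rho (relation_prel (nth (Relation 0 [::] [::]) relations r)).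
Proof.
move=> h h13 hr; apply: chart_relation => //.
  by move=> r' hr'; apply: h; rewrite /base mem_cat hr'.
exact: (all_nthP _ relations_ok).
Qed.

(** * The generators in the coordinate ring *)

Section Combinations.
Local Open Scope ring_scope.
Variables (S : comNzRingType) (n p q : nat).
Variables (f : 'I_n -> S) (g : 'I_p -> S) (h : 'I_q -> S) (i : 'I_q).

Lemma sum_delta : \sum_(k < q) (k == i)%:R * h k = h i.
Proof.
rewrite (bigD1 i) //= eqxx mul1r big1 ?addr0 // => k /negPf ->.
by rewrite mul0r.
Qed.

Lemma sum_zero (m : nat) (f' : 'I_m -> S) : \sum_(k < m) 0 * f' k = 0.
Proof. by rewrite big1 // => k _; rewrite mul0r. Qed.

Lemma combination1 : h i = \sum_(k < q) (k == i)%:R * h k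
  + \sum_(k < n) 0 * f k + \sum_(k < p) 0 * g k.
Proof. by rewrite sum_delta !sum_zero !addr0. Qed.

Lemma combination2 : h i = \sum_(k < n) 0 * f k
  + \sum_(k < q) (k == i)%:R * h k + \sum_(k < p) 0 * g k.
Proof. by rewrite sum_delta !sum_zero addr0 add0r. Qed.

Lemma combination3 : h i = \sum_(k < n) 0 * f k + \sum_(k < p) 0 * g k
  + \sum_(k < q) (k == i)%:R * h k.
Proof. by rewrite sum_delta !sum_zero !add0r. Qed.

Variables (S' : comNzRingType) (phi : {rmorphism S -> S'}).

Lemma rmorph_combination (f' : 'I_n -> S) (g' : 'I_p -> S) (h' : 'I_q -> S) :
  (forall k, phi (f k) = 0) -> (forall k, phi (g k) = 0) ->
  (forall k, phi (h k) = 0) ->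
  phi (\sum_(k < n) f' k * f k + \sum_(k < p) g' k * g k
       + \sum_(k < q) h' k * h k) = 0.
Proof.
move=> hf hg hh; rewrite !rmorphD !rmorph_sum !big1 ?addr0 // => k _;
  by rewrite rmorphM ?hf ?hg ?hh mulr0.
Qed.

Lemma rmorph_quadric a b c d u v x y t w :
  phi (a * b - (c * d - u * v - x * y + t * w)) =
  phi a * phi b - (phi c * phi d - phi u * phi v - phi x * phi y + phi t * phi w).
Proof. by rewrite rmorphB rmorphD !rmorphB !rmorphM. Qed.

Lemma rmorph_quadric_pos a b c d u v x y t w :
  phi (a * b - (c * d + u * v + x * y + t * w)) =
  phi a * phi b - (phi c * phi d + phi u * phi v + phi x * phi y + phi t * phi w).
Proof. by rewrite rmorphB !rmorphD !rmorphM. Qed.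

Lemma rmorph_cubic a b c a1 b1 c1 a2 b2 c2 a3 b3 c3 a4 b4 c4 a5 b5 c5 :
  phi (a * b * c - a1 * b1 * c1 - a2 * b2 * c2 - a3 * b3 * c3 - a4 * b4 * c4
       - a5 * b5 * c5) =
  phi a * phi b * phi c - phi a1 * phi b1 * phi c1 - phi a2 * phi b2 * phi c2
  - phi a3 * phi b3 * phi c3 - phi a4 * phi b4 * phi c4 - phi a5 * phi b5 * phi c5.
Proof. by rewrite !rmorphB !rmorphM. Qed.
End Combinations.

Section CayleyCone.
Local Open Scope ring_scope.
Variables (R : realType) (A6 : idomainType).
Variable pi : {rmorphism ambient R -> A6}.
Hypothesis hpi : coordinate_ring pi.
Local Notation C := (complex R).
Local Notation A := (coef_ring R).
Local Notation P := {mpoly A[5]}.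
Local Notation F := {fraction A6}.

Definition amb (k : nat) : ambient R :=
  if (k < 12)%N then av R k else if (k < 24)%N then xv R (k - 12)
  else if (k < 27)%N then zv R (k - 24) else if (k < 39)%N then yv R (k - 27)
  else if (k < 42)%N then tv R (k - 39) else if k == 42%N then uv R 2 else uv R 1.

Definition gen_val (k : nat) : F := to_frac pi (amb k).

Lemma av_mod i j : i = j %[mod 12] -> av R i = av R j.
Proof.
move=> e; rewrite /av; congr ('X_ (lshift 3 (lshift 12 _))); exact: val_inj.
Qed.

Lemma xv_mod i j : i = j %[mod 12] -> xv R i = xv R j.
Proof.
move=> e; rewrite /xv; congr ('X_ (lshift 3 (rshift 12 _))); exact: val_inj.
Qed.

Lemma zv_mod i j : i = j %[mod 3] -> zv R i = zv R j.
Proof. by move=> e; rewrite /zv; congr ('X_ (rshift _ _)); exact: val_inj. Qed.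

Lemma amb_ax i : amb (ax i) = av R i.
Proof. by rewrite /amb /ax ltn_pmod //; apply: av_mod; rewrite modn_mod. Qed.

Lemma amb_xx i : amb (xx i) = xv R i.
Proof.
have h : (i %% 12 < 12)%N by rewrite ltn_pmod.
rewrite /amb /xx ltnNge leq_addr /= -[24%N]/(12 + 12)%N ltn_add2l h addKn.
by apply: xv_mod; rewrite modn_mod.
Qed.

Lemma amb_zx i : amb (zx i) = zv R i.
Proof.
have h : (i %% 3 < 3)%N by rewrite ltn_pmod.
rewrite /amb /zx; have -> : (24 + i %% 3 < 12)%N = false by apply/negbTE; lia.
have -> : (24 + i %% 3 < 24)%N = false by apply/negbTE; lia.
have -> : (24 + i %% 3 < 27)%N by lia.
by rewrite addKn; apply: zv_mod; rewrite modn_mod.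
Qed.

Lemma amb_yx i : (i < 12)%N -> amb (yx i) = yv R i.
Proof.
move=> h; rewrite /amb /yx modn_small //.
have -> : (27 + i < 12)%N = false by apply/negbTE; lia.
have -> : (27 + i < 24)%N = false by apply/negbTE; lia.
have -> : (27 + i < 27)%N = false by apply/negbTE; lia.
have -> : (27 + i < 39)%N by lia.
by rewrite addKn.
Qed.

Lemma amb_tx i : (i < 3)%N -> amb (tx i) = tv R i.
Proof. by case: i => [|[|[|]]]. Qed.

Lemma amb_ux i : (1 <= i < 1 + 2)%N -> amb (ux i) = uv R i.
Proof. by move=> hi; have [->|->] : i = 1%N \/ i = 2%N by lia. Qed.

Lemma ideal_pi p : cayley_ideal p -> pi p = 0.
Proof. by move=> h; apply/(proj2 hpi). Qed.

Lemma pi_quadric5 (i : 'I_12) : pi (quadric5 R i) = 0.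
Proof.
apply: ideal_pi; exists (fun k => (k == i)%:R), (fun=> 0), (fun=> 0).
exact: (combination1 (fun k => quadric4 R k) (fun k => quadricz R k)
  (fun k => quadric5 R k) i).
Qed.

Lemma pi_quadric4 (i : 'I_12) : pi (quadric4 R i) = 0.
Proof.
apply: ideal_pi; exists (fun=> 0), (fun k => (k == i)%:R), (fun=> 0).
exact: (combination2 (fun k => quadric5 R k) (fun k => quadricz R k)
  (fun k => quadric4 R k) i).
Qed.

Lemma pi_quadricz (i : 'I_3) : pi (quadricz R i) = 0.
Proof.
apply: ideal_pi; exists (fun=> 0), (fun=> 0), (fun k => (k == i)%:R).
exact: (combination3 (fun k => quadric5 R k) (fun k => quadric4 R k)
  (fun k => quadricz R k) i).
Qed.

Lemma sat_rho r q : pi q = 0 -> ev amb r.1 = ev amb r.2 + q -> sat gen_val r.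
Proof.
move=> hq e; rewrite /sat.
have rE p : ev gen_val p = tofrac (pi (ev amb p)).
  by rewrite (rmorph_ev pi) (rmorph_ev (@tofrac A6)).
by rewrite !rE e rmorphD hq addr0.
Qed.

Lemma sats_cat (S : comNzRingType) (f : nat -> S) r1 r2 :
  sats f r1 -> sats f r2 -> sats f (r1 ++ r2).
Proof. by move=> h1 h2 r; rewrite mem_cat => /orP[/h1|/h2]. Qed.

Lemma sats_map (S : comNzRingType) (f : nat -> S) (g : nat -> prel) a n :
  (forall i, (a <= i < a + n)%N -> sat f (g i)) -> sats f (map g (iota a n)).
Proof.
by move=> h r hr; have /mapP [i hi ->] := hr; apply: h; rewrite -mem_iota.
Qed.

Lemma rho_base0 : sats gen_val base0.
Proof.
repeat apply: sats_cat; apply: sats_map => i hi.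
- apply: (sat_rho (pi_quadric5 (Ordinal hi))).
  rewrite /ev /= !big_cons !big_nil !amb_ax !amb_xx !amb_zx /quadric5 /=; ring.
- apply: (sat_rho (pi_quadric4 (Ordinal hi))).
  rewrite /ev /= !big_cons !big_nil !amb_ax !amb_xx !amb_zx /quadric4 /=; ring.
- apply: (sat_rho (pi_quadricz (Ordinal hi))).
  rewrite /ev /= !big_cons !big_nil !amb_ax !amb_xx !amb_zx /quadricz /=; ring.
- apply: (sat_rho (rmorph0 pi)).
  rewrite /ev /= !big_cons !big_nil !amb_ax !amb_xx !amb_zx amb_yx // /yv; ring.
- apply: (sat_rho (rmorph0 pi)).
  rewrite /ev /= !big_cons !big_nil !amb_ax !amb_xx amb_tx // /tv; ring.
- apply: (sat_rho (rmorph0 pi)).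
  rewrite /ev !big_cons !big_nil amb_ux // !amb_ax !amb_xx /uv; ring.
Qed.

(** A point of the cone where the 44 generators are positive. *)
Definition pos_val (k : nat) : C :=
  if (k < 12)%N then 1 else if (k < 24)%N then (if odd k then 3%:R else 5%:R)
  else 6%:R.

Definition chi : ambient R -> C := mmap idfun (fun k : 'I_(12 + 12 + 3) => pos_val k).
HB.instance Definition _ := GRing.RMorphism.copy chi
  (mmap idfun (fun k : 'I_(12 + 12 + 3) => pos_val k)).

Lemma chi_av i : chi (av R i) = 1.
Proof. by rewrite /chi /av mmapX mmap1U /pos_val /= ltn_pmod. Qed.

Lemma chi_xv i : chi (xv R i) = if odd i then 3%:R else 5%:R.
Proof.
rewrite /chi /xv mmapX mmap1U -[nat_of_ord _]/(12 + i %% 12)%N /pos_val.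
have -> : (12 + i %% 12 < 12)%N = false by apply/negbTE; lia.
have -> : (12 + i %% 12 < 24)%N by have := ltn_pmod i (isT : 0 < 12)%N; lia.
have -> // : odd (12 + i %% 12) = odd i.
by rewrite oddD [in RHS](divn_eq i 12) oddD oddM andbF.
Qed.

Lemma chi_zv i : chi (zv R i) = 6%:R.
Proof.
rewrite /chi /zv mmapX mmap1U -[nat_of_ord _]/(12 + 12 + i %% 3)%N /pos_val.
have -> : (12 + 12 + i %% 3 < 12)%N = false by apply/negbTE; lia.
by have -> : (12 + 12 + i %% 3 < 24)%N = false by apply/negbTE; lia.
Qed.

Lemma chi_quadric5 i : chi (quadric5 R i) = 0.
Proof.
rewrite /quadric5 (rmorph_quadric_pos chi) /= !chi_av !chi_xv !chi_zv.
by rewrite !oddD /=; case: (odd i); ring.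
Qed.

Lemma chi_quadric4 i : chi (quadric4 R i) = 0.
Proof.
rewrite /quadric4 (rmorph_quadric chi) /= !chi_av !chi_xv !chi_zv.
by rewrite !oddD /=; case: (odd i); ring.
Qed.

Lemma chi_quadricz i : chi (quadricz R i) = 0.
Proof.
rewrite /quadricz (rmorph_quadric_pos chi) /= !chi_av !chi_xv !chi_zv.
by rewrite !oddD /=; case: (odd i); ring.
Qed.

Lemma chi_ideal p : cayley_ideal p -> chi p = 0.
Proof.
move=> [b [c [d ->]]]; apply: (rmorph_combination (phi := chi)) => k.
- exact: chi_quadric5.
- exact: chi_quadric4.
- exact: chi_quadricz.
Qed.

Lemma chi_pi p q : pi p = pi q -> chi p = chi q.
Proof.
move=> e; apply/eqP; rewrite -subr_eq0 -rmorphB; apply/eqP/chi_ideal.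
by apply/(proj2 hpi); rewrite rmorphB e subrr.
Qed.

Lemma chi_amb_gt0 k : (k < 44)%N -> 0 < chi (amb k).
Proof.
move=> k44; rewrite /amb; case: ifP => [_|_]; first by rewrite chi_av ltr01.
case: ifP => [_|_]; first by rewrite chi_xv; case: odd; rewrite ltr0n.
case: ifP => [_|_]; first by rewrite chi_zv ltr0n.
case: ifP => [_|_].
  suff -> : chi (yv R (k - 27)) = (if odd (k - 27) then 8%:R else 24%:R).
    by case: odd; rewrite ltr0n.
  rewrite /yv !rmorphB !rmorphM /= !chi_av !chi_xv !chi_zv !oddD /=.
  by case: odd; ring.
case: ifP => [_|_].
  suff -> : chi (tv R (k - 39)) = 224%:R by rewrite ltr0n.
  rewrite /tv !rmorphB !rmorphM /= !chi_av !chi_xv !oddD /=.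
  by case: odd; ring.
have uvE i : chi (uv R i) = (if odd i then 16%:R else 108%:R).
  rewrite /uv (rmorph_cubic chi) /= !chi_av !chi_xv !oddD /=.
  by case: odd; ring.
by case: ifP => _; rewrite uvE /= ltr0n.
Qed.

Lemma rho_neq0 k : (k < 44)%N -> gen_val k != 0.
Proof.
move=> hk; rewrite /gen_val /to_frac tofrac_eq0; apply: contraTneq (chi_amb_gt0 hk).
by rewrite -(rmorph0 pi) => /chi_pi ->; rewrite rmorph0 ltxx.
Qed.

Lemma coef_emb_is_zmod_morphism : zmod_morphism (coef_emb pi).
Proof.
by move=> a b; rewrite /coef_emb /to_frac /coef_incl (rmorphB (comp_mpoly _)) !rmorphB.
Qed.
Lemma coef_emb_is_monoid_morphism : monoid_morphism (coef_emb pi).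
Proof.
split=> [|a b]; rewrite /coef_emb /to_frac /coef_incl.
  by rewrite (rmorph1 (comp_mpoly _)) !rmorph1.
by rewrite (rmorphM (comp_mpoly _)) !rmorphM.
Qed.
HB.instance Definition _ :=
  GRing.isZmodMorphism.Build A F (coef_emb pi) coef_emb_is_zmod_morphism.
HB.instance Definition _ :=
  GRing.isMonoidMorphism.Build A F (coef_emb pi) coef_emb_is_monoid_morphism.

Definition const_emb (c : C) : F := coef_emb pi (c%:MP : A).
HB.instance Definition _ := GRing.RMorphism.copy const_emb (coef_emb pi \o @mpolyC 12 C).

Lemma ecst_ambient c : const_emb c = to_frac pi (c%:MP).
Proof. by rewrite /const_emb /coef_emb /coef_incl comp_mpolyC. Qed.

Lemma coef_embX (k : 'I_12) : coef_emb pi ('X_k : A) = gen_val k.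
Proof.
rewrite /coef_emb /gen_val /coef_incl comp_mpolyXU -tnth_nth tnth_mktuple /amb ltn_ord.
congr (to_frac pi _); rewrite /av; congr ('X_ (lshift 3 (lshift 12 _))).
by apply: val_inj; rewrite /= modn_small.
Qed.

(** Both generators take positive values at the point [pos_val] of the cone. *)
Lemma proportional_gt0 c j k : (j < 44)%N -> (k < 44)%N ->
  gen_val j = const_emb c * gen_val k -> 0 < c.
Proof.
move=> hj hk; rewrite ecst_ambient /gen_val /to_frac -!rmorphM => /eqP.
rewrite tofrac_eq => /eqP /chi_pi; rewrite rmorphM /= [chi _%:MP]mmapC /= => e.
by have := chi_amb_gt0 hj; rewrite e pmulr_lgt0 // chi_amb_gt0.
Qed.

End CayleyCone.

(** * Laurent polynomials with positive coefficients *)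

Lemma rotate_quartic (S : comNzRingType) (x y z t a b c d : S) :
  (x * y * z * t - a * b * c * d = t * x * y * z - d * a * b * c)%R.
Proof. by ring. Qed.

Lemma morph_lin (S T : comNzRingType) (h : {rmorphism S -> T}) p q a b x y :
  (h a = x -> h b = y -> h p * x + h q * y = h (p * a + q * b))%R.
Proof. by move=> <- <-; rewrite rmorphD !rmorphM. Qed.

Section PositiveExpansions.
Local Open Scope ring_scope.
Variables (R : realType) (A6 : idomainType).
Variable pi : {rmorphism ambient R -> A6}.
Hypothesis hpi : coordinate_ring pi.
Local Notation C := (complex R).
Local Notation A := (coef_ring R).
Local Notation P := {mpoly A[5]}.
Local Notation F := {fraction A6}.
Local Notation rho := (gen_val pi).
Local Notation ecst := (const_emb pi).

Lemma representative_rho w : is_representative pi w ->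
  exists2 k, (12 <= k < 44)%N & w = rho k.
Proof.
move=> [p hp ->].
have red x a n g : (forall i, (a <= i < a + n)%N ->
      exists2 k, (12 <= k < 44)%N & g i = amb R k) ->
    x \in [seq g i | i <- iota a n] ->
    exists2 k, (12 <= k < 44)%N & x = amb R k.
  by move=> hg /mapP [i hi ->]; apply: hg; rewrite -mem_iota.
suff [k hk ->] : exists2 k, (12 <= k < 44)%N & p = amb R k by exists k.
move: hp; rewrite !mem_cat => /or4P [|||/orP []]; apply: red => i hi.
- exists (xx i); last by rewrite amb_xx.
  by have := ltn_pmod i (isT : 0 < 12)%N; rewrite /xx; lia.
(* the numbering of generators has [y_0] for [y_12], and [t_0] for [t_3] *)
- exists (yx i).
    by have := ltn_pmod i (isT : 0 < 12)%N; rewrite /yx; lia.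
  case: (eqVneq i 12) => [->|i12]; last by rewrite amb_yx //; lia.
  by rewrite -[yx 12]/(yx 0) amb_yx.
- exists (zx i); last by rewrite amb_zx.
  by have := ltn_pmod i (isT : 0 < 3)%N; rewrite /zx; lia.
- exists (tx i).
    by have := ltn_pmod i (isT : 0 < 3)%N; rewrite /tx; lia.
  case: (eqVneq i 3) => [->|i12]; last by rewrite amb_tx //; lia.
  have ex : xv R (3 + 9) = xv R 0 by exact: xv_mod.
  have ea : av R (3 + 11) = av R (0 + 2) by exact: av_mod.
  rewrite -[tx 3]/(tx 0) (amb_tx _ (isT : (0 < 3)%N)) /tv ex ea.
  exact: rotate_quartic.
- exists (ux i).
    by have := ltn_pmod i (isT : 0 < 2)%N; rewrite /ux; lia.
  by rewrite amb_ux.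
Qed.

Lemma positive_coefsP (p : P) :
  positive_coefs p <-> forall m r, 0 <= ((p@_m) : {mpoly C[12]})@_r.
Proof.
split=> h m r.
  case: (boolP (r \in msupp (p@_m : {mpoly C[12]}))) => [/h /ltW //|].
  by move=> /memN_msupp_eq0 ->.
by rewrite mcoeff_msupp lt_def h andbT.
Qed.

Lemma positive_coefsD (p q : P) :
  positive_coefs p -> positive_coefs q -> positive_coefs (p + q).
Proof.
move=> /positive_coefsP hp /positive_coefsP hq; apply/positive_coefsP => m r.
by rewrite !mcoeffD addr_ge0.
Qed.

Lemma positive_coefsM (p q : P) :
  positive_coefs p -> positive_coefs q -> positive_coefs (p * q).
Proof.
move=> /positive_coefsP hp /positive_coefsP hq; apply/positive_coefsP => m r.
rewrite mcoeffM raddf_sum; apply: sumr_ge0 => k _ /=.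
rewrite (mcoeffM (R := C)); apply: sumr_ge0 => l _.
by apply: mulr_ge0.
Qed.

Lemma positive_coefs_cst (c : C) : 0 <= c -> positive_coefs (cst c).
Proof.
move=> hc; apply/positive_coefsP => m r; rewrite /cst mcoeffC.
case: eqP => _; last by rewrite mulr0 (@mcoeff0 12 C).
by rewrite mulr1 (@mcoeffC 12 C) mulr_ge0 // ler0n.
Qed.

Lemma positive_coefs0 : positive_coefs (0 : P).
Proof.
by apply/positive_coefsP => m r; rewrite mcoeff0 (@mcoeff0 12 C).
Qed.

Lemma positive_coefs1 : positive_coefs (1 : P).
Proof. by rewrite -(rmorph1 (@cst R)); apply: positive_coefs_cst; exact: ler01. Qed.

Lemma positive_coefsX (m : 'X_{1..5}) : positive_coefs ('X_[m] : P).
Proof.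
apply/positive_coefsP => d r; rewrite mcoeffX; case: eqP => _ /=.
  by rewrite (@mcoeff1 12 C) ler0n.
by rewrite (@mcoeff0 12 C).
Qed.

Lemma positive_coefs_frozen k : positive_coefs (('X_k : A)%:MP : P).
Proof.
apply/positive_coefsP => d r; rewrite mcoeffC; case: eqP => _ /=.
  by rewrite mulr1 (@mcoeffX 12 C) ler0n.
by rewrite mulr0 (@mcoeff0 12 C).
Qed.

Lemma positive_coefs_ev (D : pred nat) (f : nat -> P) p :
  all (all D) p -> (forall k, D k -> positive_coefs (f k)) -> positive_coefs (ev f p).
Proof.
move=> /allP hp hf; rewrite /ev big_seq.
apply: (big_ind _ positive_coefs0 positive_coefsD) => m /hp /allP hm.
rewrite big_seq; apply: (big_ind _ positive_coefs1 positive_coefsM) => k /hm.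
exact: hf.
Qed.

Section Cluster.
Variable v : 'I_5 -> F.
Hypothesis v0 : forall l, v l != 0.
Local Notation lp := (laurent_positive pi v).

Lemma mmap1D m d : mmap1 v (m + d)%MM = mmap1 v m * mmap1 v d.
Proof. by apply: commr_mmap1_M => l x; exact: mulrC. Qed.

Lemma mmap1_neq0 m : mmap1 v m != 0.
Proof. by apply/prodf_neq0 => l _; rewrite expf_neq0. Qed.

Lemma lp_poly (p : P) : positive_coefs p -> lp (mmap (coef_emb pi) v p).
Proof. by move=> hp; exists p, 0%MM; rewrite mmap11 divr1. Qed.

Lemma lp1 : lp 1.
Proof. by rewrite -(rmorph1 (mmap (coef_emb pi) v)); exact/lp_poly/positive_coefs1. Qed.

Lemma lpD f g : lp f -> lp g -> lp (f + g).
Proof.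
move=> [p [m [-> hp]]] [q [d [-> hq]]].
exists (p * 'X_[d] + q * 'X_[m]), (m + d)%MM; split.
  rewrite addf_div ?mmap1_neq0 //; congr (_ / _); last by rewrite mmap1D.
  pose h : {rmorphism P -> F} := mmap (coef_emb pi) v.
  have hX (k : 'X_{1..5}) : h 'X_[k] = mmap1 v k by exact: mmapX.
  exact: (morph_lin p q (hX d) (hX m)).
by apply: positive_coefsD; apply: positive_coefsM => //; exact: positive_coefsX.
Qed.

Lemma lpM f g : lp f -> lp g -> lp (f * g).
Proof.
move=> [p [m [-> hp]]] [q [d [-> hq]]].
exists (p * q), (m + d)%MM; split; last exact: positive_coefsM.
rewrite mulf_div mmap1D; congr (_ / _).
pose h : {rmorphism P -> F} := mmap (coef_emb pi) v.
exact: (esym (rmorphM h p q)).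
Qed.

Lemma lp_prod (I : eqType) (r : seq I) (f : I -> F) :
  (forall i, i \in r -> lp (f i)) -> lp (\prod_(i <- r) f i).
Proof.
move=> h; rewrite big_seq; apply: (big_ind lp lp1 lpM) => i; exact: h.
Qed.

Lemma lp0 : lp 0.
Proof.
by rewrite -(rmorph0 (mmap (coef_emb pi) v)); exact/lp_poly/positive_coefs0.
Qed.

Lemma lp_ev (D : pred nat) (f : nat -> F) p :
  all (all D) p -> (forall k, D k -> lp (f k)) -> lp (ev f p).
Proof.
move=> /allP hp hf; rewrite /ev big_seq; apply: (big_ind lp lp0 lpD) => m /hp.
by move=> /allP hm; apply: lp_prod => k /hm; exact: hf.
Qed.

Lemma lp_var l : lp (v l).
Proof. by have := lp_poly (@positive_coefsX U_(l)%MM); rewrite mmapX mmap1U. Qed.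

Lemma lp_inv l : lp (v l)^-1.
Proof.
exists 1, U_(l)%MM; rewrite mmap1U; split; last exact: positive_coefs1.
by rewrite (rmorph1 (mmap _ _)) div1r.
Qed.

Lemma lp_ecst c : 0 < c -> lp (ecst c).
Proof.
move=> hc; have := lp_poly (positive_coefs_cst (ltW hc)).
by rewrite /cst mmapC.
Qed.

Lemma lp_frozen k : (k < 12)%N -> lp (rho k).
Proof.
move=> hk; have := lp_poly (@positive_coefs_frozen (Ordinal hk)).
by rewrite mmapC /= coef_embX.
Qed.


(** Along the chain, each new variable is a positive polynomial in known ones,
    divided by variables of the cluster. Positive Laurent polynomials are stable
    under these operations. *)
Lemma chain_expansions gam del es (kap : 'I_5 -> nat) (c : 'I_5 -> C) ch :
  symmetry gam del -> codom kap =i ids es ->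
  (forall l, 0 < c l) -> (forall l, v l = ecst (c l) * rho (gam (kap l))) ->
  chain_ok relations (ids es) (ids es) ch ->
  forall k, (12 <= k < 44)%N -> lp (rho (gam k)).
Proof.
move=> sg hcod c0 hv hch.
have nz k : (k < 44)%N -> rho k != 0 by exact: rho_neq0.
have hbase := base_of_base0 (rho_base0 hpi) (nz 13 isT).
have hc l : ecst (c l) != 0 by rewrite fmorph_eq0 gt_eqF.
have ecstV l : ecst (c l)^-1 = (ecst (c l))^-1 by exact: (fmorphV (const_emb pi)).
have lk l : lp (rho (gam (kap l))).
  have -> : rho (gam (kap l)) = ecst (c l)^-1 * v l by rewrite hv ecstV mulKf.
  by apply: lpM; [apply: lp_ecst; rewrite invr_gt0|exact: lp_var].
have lkV l : lp (rho (gam (kap l)))^-1.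
  have -> : (rho (gam (kap l)))^-1 = ecst (c l) * (v l)^-1.
    by rewrite hv invfM mulVKf.
  by apply: lpM; [exact: lp_ecst|exact: lp_inv].
have known0 k : k \in ids es -> lp (rho (gam k)).
  by rewrite -hcod => /codomP [l ->].
have knownV k : k \in ids es -> lp (rho (gam k))^-1.
  by rewrite -hcod => /codomP [l ->].
elim: ch {-2}(ids es) known0 hch => [|[n g] ch ih] known hk.
  by rewrite /chain_ok => /allP h k hk'; apply/hk/h; rewrite mem_iota.
rewrite /=; case/and4P => hn /allP hden hpol; apply: ih => k; rewrite inE => /orP[/eqP ->|/hk //].
set r := nth _ _ _ in hden hpol *.
have sg' := symmetry_comp sg (symmetry_tact g).
have [_ _ _ hs'] := sg'.
have h44 k' : (k' < 44)%N -> (gam (tact g k') < 44)%N.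
  by move=> /(symmetry_lt44 sg') [].
have := relation_sat (hs' _ _ hbase) (nz _ (h44 13 isT)) hn.
rewrite -/r /sat /= ev_mon big_cons.
set D := \prod_(_ <- _) _ => e.
have D0 : D != 0.
  rewrite /D prodf_seq_neq0; apply/allP => k' /hden /= hk'.
  move: hk'; rewrite -hcod => /codomP [l ->].
  by move: (v0 l); rewrite hv mulf_eq0 negb_or => /andP [].
rewrite -[X in lp X](mulfK D0) -/(gam _) [X in X / D]e; apply: lpM.
  apply: (lp_ev hpol) => k' /orP [k12|/hk //] /=.
  by apply: lp_frozen; have [/(_ _ k12) [] //] := sg.
by rewrite /D -prodfV; apply: lp_prod => k' /hden /= /knownV.
Qed.

End Cluster.
End PositiveExpansions.

(** * The invariant of mutation *)

Lemma seeds_ok : all seed_ok seeds.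
Proof. by vm_compute. Qed.

Lemma mutations_ok : all (fun es => all (mut_ok es) es) seeds.
Proof. by vm_compute. Qed.

Lemma all_exch_relations (a : pred relation) (ss : seq (seq entry)) rels :
  all a (flatten [seq [seq exch_relation es e | e <- es] | es <- ss] ++ rels) ->
  all (fun es => all (fun e => a (exch_relation es e)) es) ss.
Proof.
elim: ss => [//|es ss ih] /=; rewrite -catA all_cat all_map => /andP [h /ih ->].
by rewrite andbT.
Qed.

Lemma exch_relations_ok : all (fun es =>
  all (fun e => rel_ok x1_chart (relation_prel (exch_relation es e))) es) seeds.
Proof. exact: (all_exch_relations relations_ok). Qed.

Lemma chains_ok : all (fun n => chain_ok relations (ids (seedn n)) (ids (seedn n))
  (nth [::] expansion_chains n)) (iota 0 (size seeds)).
Proof. by vm_compute. Qed.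

Section Dependence.
Local Open Scope ring_scope.
Variables (R : realType).
Local Notation C := (complex R).
Local Notation A := (coef_ring R).
Local Notation P := {mpoly A[5]}.

Lemma mfree_mderiv (i : 'I_5) (p : P) : mderiv i p = 0 -> mfree i p.
Proof.
move=> h; apply/allP => m hm; rewrite -leqn0 leqNgt; apply/negP => mi.
have em : m = (m - U_(i) + U_(i))%MM.
  by rewrite submK //; apply/mnm_lepP => l; rewrite mnm1E; case: eqP => [<-|].
have := mcoeff_deriv i (m - U_(i))%MM p; rewrite h mcoeff0 -em => /esym/eqP.
rewrite -mulr_natr mulf_eq0 mcoeff_eq0 hm /=.
by rewrite -mpolyC_nat mpolyC_eq0 pnatr_eq0.
Qed.

Lemma mderiv_ev (i : 'I_5) gam kap (c : 'I_5 -> C) p :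
  (forall l, (12 <= kap l)%N) -> injective kap -> pfree (kap i) p ->
  wf_poly (codom kap) p -> mderiv i (ev (frame_env gam kap c) p) = 0.
Proof.
move=> kap12 kinj /allP fp /allP wp; rewrite /ev raddf_sum big_seq.
apply: big1 => m hm; have /allP wm := wp _ hm; have fm := fp _ hm.
elim: m {hm} wm fm => [|k m ih] wm fm; first by rewrite big_nil /= -mpolyC1 mderivC.
rewrite big_cons /= mderivM [X in _ + _ * X]ih; first last.
- by apply: contra fm; rewrite inE orbC => ->.
- by move=> k' hk'; apply: wm; rewrite inE hk' orbT.
have hk := wm k (mem_head _ _).
rewrite mulr0 addr0.
have -> : mderiv i (frame_env gam kap c k) = 0; last by rewrite mul0r.
case/orP: hk => [k12|/codomP [l el]].
  by rewrite /frame_env k12 /frz mderivC.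
rewrite el (env_kap _ _ kinj kap12) /cst mul_mpolyC linearZ /= mderivX.
rewrite mnm1E; case: eqP => [li|_]; last by rewrite scale0r scaler0.
by move: fm; rewrite inE el li eqxx.
Qed.

(** Used by contraposition: two points that only differ in one coordinate and
    where [p] takes distinct values show that [p] depends on it. *)
Lemma mfree_spec (i : 'I_5) (del : nat -> nat) (kap : 'I_5 -> nat) (c : 'I_5 -> C)
    (E : comNzRingType) (iota : {rmorphism C -> E}) (val val' : nat -> E)
    (p : P) :
  mfree i p -> (forall k, k != kap i -> val k = val' k) -> injective kap ->
  (forall k : 'I_12, del k != kap i) ->
  frame_spec del kap c iota val p = frame_spec del kap c iota val' p.
Proof.
move=> /allP hp hv kinj hd; rewrite /frame_spec /mmap big_seq [RHS]big_seq.
apply: eq_bigr => m /hp /eqP mi; congr (_ * _).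
  by rewrite /spec_coef; apply: eq_bigr => d _; congr (_ * _); apply: mmap1_eq => k; exact: hv.
apply: eq_bigr => l _; case: (eqVneq l i) => [->|li]; first by rewrite mi !expr0.
by rewrite hv // (inj_eq kinj).
Qed.
End Dependence.

Lemma partner_scaling (K : fieldType) (ei ci p X x w : K) :
  (ci != 0 -> X != 0 ->
  ei * (w * (x * X)) * (p * X^-1) = ci * x * (ei / ci * p * w))%R.
Proof. by move=> ci0 X0; field; rewrite ci0 X0. Qed.

Section Invariant.
Local Open Scope ring_scope.
Variables (R : realType) (A6 : idomainType).
Variable pi : {rmorphism ambient R -> A6}.
Hypothesis hpi : coordinate_ring pi.
Local Notation C := (complex R).
Local Notation A := (coef_ring R).
Local Notation P := {mpoly A[5]}.
Local Notation F := {fraction A6}.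
Local Notation rho := (gen_val pi).
Local Notation ecst := (const_emb pi).

(** The seed [s] is the seed number [n] of the list, moved by the symmetry [gam]
    with inverse [del], with its variables in the order [kap], up to the
    constants [c] and [e]. *)
Record framed (s : cayley_seed R A6) (n : nat) (gam del : nat -> nat)
    (kap : 'I_5 -> nat) (c e : 'I_5 -> C) : Prop := Framed {
  fr_n : (n < size seeds)%N;
  fr_sym : symmetry gam del;
  fr_inj : injective kap;
  fr_cod : codom kap =i ids (seedn n);
  fr_c : forall l, c l != 0;
  fr_e : forall l, e l != 0;
  fr_cluster : forall l, cluster s l = ecst (c l) * rho (gam (kap l));
  fr_exch : forall l, exch s l =
    cst (e l) * ev (frame_env gam kap c) (epoly (entry_at (seedn n) (kap l))) }.

Section Framed.
Variables (s : cayley_seed R A6) (n : nat) (gam del : nat -> nat).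
Variables (kap : 'I_5 -> nat) (c e : 'I_5 -> C).
Hypothesis hs : framed s n gam del kap c e.
Local Notation es := (seedn n).
Local Notation T v := (epoly (entry_at es v)).

Lemma fr_seed_ok : seed_ok es.
Proof. by move/all_nthP: seeds_ok; apply; case: hs. Qed.

Lemma fr_gamP k : (k < 12)%N ->
  [/\ (gam k < 12)%N, (del k < 12)%N, del (gam k) = k & gam (del k) = k].
Proof.
move=> hk; have [h1 _ h3 _] := fr_sym hs; have [a b] := h1 _ hk.
have k44 : (k < 44)%N by exact: ltn_trans hk _.
by have [d f] := h3 k k44; split.
Qed.

Lemma fr_kap_range l : (12 <= kap l < 44)%N.
Proof.
have /and4P [_ _ /allP h _] := fr_seed_ok.
by apply: h; rewrite -(fr_cod hs) codom_f.
Qed.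

Lemma fr_kap12 l : (12 <= kap l)%N.
Proof. by have /andP [] := fr_kap_range l. Qed.

Lemma fr_entry l : mut_ok es (entry_at es (kap l)) /\
  evar (entry_at es (kap l)) = kap l.
Proof.
have hk : kap l \in ids es by rewrite -(fr_cod hs) codom_f.
have [h1 h2] := entry_atP hk; split=> //; apply: h1.
by move/all_nthP: mutations_ok; apply; case: hs.
Qed.

Lemma fr_partner_range l : (12 <= epartner (entry_at es (kap l)) < 44)%N.
Proof.
by have [hm _] := fr_entry l; move: hm; rewrite /mut_ok; case/and5P.
Qed.

Lemma fr_expo_ok i j : j != i -> expo_ok es (kap i) (kap j).
Proof.
move=> ji; have [hm hv] := fr_entry i; move: hm; rewrite /mut_ok hv.
case/and5P => _ _ _ /allP h _.
have := h (kap j); rewrite -(fr_cod hs) codom_f => /(_ isT).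
by rewrite (inj_eq (fr_inj hs)) (negPf ji).
Qed.

Lemma fr_expo i m : exch_exponents s i m ->
  forall j, j != i -> m j = expo es (kap i) (kap j).
Proof.
move=> hm; apply: (exch_exponents_expo fr_gamP (fr_inj hs) fr_kap12 (fr_c hs)
  fr_seed_ok (fr_cod hs) (fr_e hs) (fr_exch hs) hm) => j.
exact: fr_expo_ok.
Qed.

Lemma fr_base : sats rho base.
Proof. exact: (base_of_base0 (rho_base0 hpi) (rho_neq0 hpi (k := 13) isT)). Qed.

(** The symmetry [gam] moves the values of the generators to another solution of
    [base], and the exchange relation holds for all solutions with [x_1 != 0]. *)
Lemma fr_relation l : let f := rho \o gam in
  f (epartner (entry_at es (kap l))) *
    (f (kap l) * \prod_(k <- denom es (kap l)) f k) = ev f (T (kap l)).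
Proof.
have hk : kap l \in ids es by rewrite -(fr_cod hs) codom_f.
have [h1 h2] := entry_atP hk.
have hr : rel_ok x1_chart (relation_prel (exch_relation es (entry_at es (kap l)))).
  apply: (h1 (fun e => rel_ok x1_chart (relation_prel (exch_relation es e)))).
  by move/all_nthP: exch_relations_ok => h; apply: (h [::]); case: hs.
have [_ _ _ hb] := fr_sym hs.
have b := hb F rho fr_base.
have := chart_relation (rho := rho \o gam) _ _ hr; rewrite /sat /= ev_mon h2 !big_cons.
apply; first by move=> r hr'; apply: b; rewrite /base mem_cat hr'.
apply: (rho_neq0 hpi); exact: (symmetry_lt44 (fr_sym hs) (k := 13) isT).1.
Qed.

Lemma ecst_neq0 d : d != 0 -> ecst d != 0.
Proof. by rewrite fmorph_eq0. Qed.

Lemma fr_rho_neq0 l : rho (gam (kap l)) != 0.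
Proof.
apply: (rho_neq0 hpi); have /andP [_ h] := fr_kap_range l.
exact: (symmetry_lt44 (fr_sym hs) h).1.
Qed.

Lemma ecstV d : ecst d^-1 = (ecst d)^-1.
Proof. exact: (fmorphV (const_emb pi)). Qed.

Lemma fr_mmap i : mmap (coef_emb pi) (cluster s) (exch s i) =
  ecst (e i) * ev (rho \o gam) (T (kap i)).
Proof.
have mc d : mmap (coef_emb pi) (cluster s) (cst d) = ecst d by exact: mmapC.
rewrite (fr_exch hs) (rmorphM (mmap _ _)) /= mc; congr (_ * _).
rewrite (rmorph_ev (mmap (coef_emb pi) (cluster s))).
apply: (eq_ev (T_wf fr_seed_ok (fr_cod hs) i)) => k.
rewrite unfold_in -(fr_cod hs) => /orP [k12|/codomP [l ->]] /=.
  rewrite /frame_env k12 /frz mmapC /= coef_embX; congr (rho _).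
  by rewrite /= modn_small //; have [] := fr_gamP k12.
rewrite (env_kap _ _ (fr_inj hs) fr_kap12) (rmorphM (mmap _ _)) /= mc mmapX mmap1U.
rewrite (fr_cluster hs) ecstV mulKf //; apply: ecst_neq0; exact: (fr_c hs).
Qed.

(** Both the definition of mutation and the relation among generators express a
    product with the same [i]-th variable, which can be cancelled; comparing
    the constants gives [newc]. *)
Lemma fr_partner i m w : exch_exponents s i m ->
  cluster s i * w = exch_laurent (coef_emb pi) s i m (cluster s) ->
  w = ecst (newc kap c es e i) * rho (gam (epartner (entry_at es (kap i)))).
Proof.
move=> hm; rewrite /exch_laurent fr_mmap -(fr_relation i) /=.
rewrite (prod_denom (fr_inj hs) fr_seed_ok (fr_cod hs)).
have -> : \prod_(l < 5 | l != i) cluster s l ^- m l =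
    \prod_(l | (l != i) && expo es (kap i) (kap l))
      (ecst (c l)^-1 * (rho (gam (kap l)))^-1).
  rewrite (bigID (fun l => expo es (kap i) (kap l))) /= [X in _ * X]big1 ?mulr1.
    apply: eq_bigr => l /andP [li hl]; rewrite (fr_expo hm li) hl expr1.
    by rewrite (fr_cluster hs) invfM ecstV.
  by move=> l /andP [li /negPf hl]; rewrite (fr_expo hm li) hl expr0 invr1.
rewrite big_split prodfV /= (fr_cluster hs) => h.
apply: (mulfI (x := ecst (c i) * rho (gam (kap i)))).
  by rewrite mulf_neq0 ?fr_rho_neq0 ?ecst_neq0 ?(fr_c hs).
rewrite {}h /newc (rmorphM (const_emb pi)) (rmorphM (const_emb pi) (e i)).
rewrite (rmorph_prod (const_emb pi)) (fmorphV (const_emb pi) (c i)).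
apply: partner_scaling; first by rewrite ecst_neq0 ?(fr_c hs).
by apply/prodf_neq0 => l _; exact: fr_rho_neq0.
Qed.

End Framed.

End Invariant.

(** * Mutation preserves the invariant *)

Section MutationStep.
Local Open Scope ring_scope.
Variables (R : realType) (A6 : idomainType).
Variable pi : {rmorphism ambient R -> A6}.
Hypothesis hpi : coordinate_ring pi.
Local Notation C := (complex R).
Local Notation A := (coef_ring R).
Local Notation P := {mpoly A[5]}.
Local Notation F := {fraction A6}.
Local Notation rho := (gen_val pi).
Local Notation ecst := (const_emb pi).

Variables (s s' : cayley_seed R A6) (n : nat) (gam del : nat -> nat).
Variables (kap : 'I_5 -> nat) (c e : 'I_5 -> C).
Hypothesis hs : framed pi s n gam del kap c e.
Variable i : 'I_5.
Hypothesis hmut : mutation (coef_emb pi) s i s'.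
Local Notation es := (seedn n).
Local Notation T v := (epoly (entry_at es v)).
Local Notation ent := (entry_at es (kap i)).
Local Notation w := (epartner ent).
Local Notation es' := (seedn (etarget ent)).
Local Notation g := (eact ent).
Local Notation km := (kmid kap i w).
Local Notation cm := (cmid kap c es e i).
Local Notation menv := (frame_env gam km cm).
(* the frame of [s'] with respect to the seed [es'] of the list *)
Local Notation gam' := (gam \o tact g).
Local Notation del' := (tinv g \o del).
Local Notation kap' := (tinv g \o km).
Local Notation env' := (frame_env gam' kap' cm).
Local Notation T' v := (epoly (entry_at es' v)).

Let sg := symmetry_tact g.
Let seed_okT := fr_seed_ok hs.
Let kap_inj := fr_inj hs.
Let kap12 := fr_kap12 hs.
Let hcod := fr_cod hs.

Lemma step_check : [/\ (etarget ent < size seeds)%N, w \notin ids es,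
  (12 <= w < 44)%N, forall l, kap' l \in ids es' &
  (forall v, v \in ids es' -> exists l, tact g v = km l) /\
  forall l, mut_poly_ok es (kap i) g w (denom es (kap i)) (entry_at es' (kap' l))].
Proof.
have [hm hv] := fr_entry hs i; move: hm; rewrite /mut_ok hv.
case/and5P => h1 h2 h3 _ /and3P [/allP h4 /allP h5 h6].
have midE l : km l = (fun v => if v == kap i then w else v) (kap l).
  by rewrite /kmid (inj_eq kap_inj).
have hk l : kap' l \in ids es'.
  apply: (h4 (km l)); rewrite midE; apply: map_f.
  by rewrite -hcod codom_f.
split=> //; split=> [v /h5 /mapP [u]|l].
  by rewrite -hcod => /codomP [l ->] ->; exists l; rewrite midE.
by have [h _] := entry_atP (hk l); apply: h.
Qed.

Let wids : w \notin ids es. Proof. by have [] := step_check. Qed.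
Let w44 : (12 <= w < 44)%N. Proof. by have [] := step_check. Qed.
Let w12 : (12 <= w)%N. Proof. by have /andP [] := w44. Qed.

Let km_inj : injective km.
Proof. exact: (kmid_inj kap_inj hcod wids). Qed.

Lemma km_range l : (12 <= km l < 44)%N.
Proof. by rewrite /kmid; case: ifP => _ //; exact: (fr_kap_range hs). Qed.

Lemma tact_kap' l : tact g (kap' l) = km l.
Proof.
have /andP [_ h] := km_range l; have [_ _ h3 _] := sg.
exact: (h3 _ h).2.
Qed.

Let kap'_inj : injective kap'.
Proof. by move=> l l' h; apply: km_inj; rewrite -!tact_kap' h. Qed.

Let seed_ok' : seed_ok es'.
Proof. by move/all_nthP: seeds_ok; apply; have [] := step_check. Qed.

Lemma cod_kap' : codom kap' =i ids es'.
Proof.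
have [_ _ _ hk [hv _]] := step_check.
have /and4P [_ _ /allP hr _] := seed_ok'.
move=> v; apply/codomP/idP => [[l ->]|hv']; first exact: hk.
have [l el] := hv _ hv'; exists l; rewrite /= -el; have [_ _ h3 _] := sg.
by have /andP [_ h] := hr _ hv'; rewrite (h3 _ h).1.
Qed.

Let kap'12 l : (12 <= kap' l)%N.
Proof.
have [_ _ _ hk _] := step_check; have /and4P [_ _ /allP hr _] := seed_ok'.
by have /andP [] := hr _ (hk l).
Qed.

Let cm0 l : cm l != 0.
Proof. by apply: cmid_neq0; [exact: (fr_c hs)|exact: (fr_e hs)]. Qed.

Let sg' : symmetry gam' del'.
Proof. exact: (symmetry_comp (fr_sym hs) sg). Qed.

Let gamP' k : (k < 12)%N ->
  [/\ (gam' k < 12)%N, (del' k < 12)%N, del' (gam' k) = k & gam' (del' k) = k].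
Proof.
move=> hk; have [h1 _ h3 _] := sg'; have [a b] := h1 _ hk.
have k44 : (k < 44)%N by exact: ltn_trans hk _.
by have [d f] := h3 k k44; split.
Qed.

Lemma env'_menv l :
  ev env' (T' (kap' l)) = ev menv (prename (tact g) (T' (kap' l))).
Proof.
rewrite [RHS]ev_prename; apply: (eq_ev (T_wf seed_ok' cod_kap' l)) => k.
rewrite unfold_in -cod_kap' => /orP [k12|/codomP [l' ->]] /=.
  rewrite /frame_env k12; have [h1 _ _ _] := sg.
  by rewrite (h1 _ k12).1.
have -> : tinv g (km l') = kap' l' by [].
rewrite (env_kap _ _ kap'_inj kap'12) tact_kap' (env_kap _ _ km_inj) //.
by move=> l2; have /andP [] := km_range l2.
Qed.

(** There are three cases: the exchange polynomial of the mutated variable and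
    those that do not depend on it are unchanged, and the others are determined
    by [mutated_exch_unique]. *)
Lemma step_exch l : exists2 a : C, a != 0 & exch s' l = cst a * ev env' (T' (kap' l)).
Proof.
have [sok [m [hm hcl _ hii hj]]] := hmut.
have [_ _ _ hk [_ hpol]] := step_check.
have hexp := fr_expo hs hm.
have [hev hv'] := entry_atP (hk l).
have := hpol l; rewrite /mut_poly_ok hv' tact_kap' env'_menv.
set T2 := prename _ _.
case: (eqVneq l i) => [->|li].
  rewrite /kmid eqxx eqxx => hq; exists (e i); first exact: (fr_e hs).
  rewrite hii (fr_exch hs); apply: (congr1 ( *%R (cst (e i)))).
  apply: (etrans _ (peq_ev menv hq)); apply: esym.
  exact: (ev_menv _ _ kap_inj kap12 hcod _ w12 wids (T_wf seed_okT hcod i) (T_free seed_okT hcod i)).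
have kml : km l = kap l by rewrite /kmid (negPf li).
rewrite kml eq_sym (negPf (w_kap hcod wids l)).
have hjl := hj l li.
case: ifP => hfree.
  have hfm : mfree i (exch s l).
    apply: mfree_mderiv; rewrite (fr_exch hs) mderivM.
    rewrite (mderiv_ev _ _ kap12 kap_inj hfree); last first.
      by have := T_wf seed_okT hcod l; apply: sub_all => d; apply: sub_all => k;
         rewrite hcod.
    by rewrite mulr0 addr0 /cst mderivC mul0r.
  move: hjl; rewrite hfm => -[a ua ->] hq; have [d d0 ed] := unit_cst ua.
  exists (d * e l); first by rewrite mulf_neq0 // (fr_e hs).
  rewrite -mul_mpolyC ed (fr_exch hs) (rmorphM (@cst R)) mulrA.
  apply: (congr1 ( *%R (cst d * cst (e l)))).
  apply: (etrans _ (peq_ev menv hq)); apply: esym.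
  exact: (ev_menv _ _ kap_inj kap12 hcod _ w12 wids (T_wf seed_okT hcod l) hfree).
move=> /and4P [hx /negP hneq hdv hz].
(* the tabulated polynomial depends on [kap i], hence [exch s l] on ['X_i] *)
have hn : mfree i (exch s l) = false.
  apply/negP => hf; apply: hneq.
  have := mfree_spec (val := iotaC R (two_at (kap i))) (val' := iotaC R (fun=> 1)) c idfun
    hf _ kap_inj (del := del) _.
  rewrite (fr_exch hs) !rmorphM /= !spec_cst.
  rewrite !(spec_int (fr_gamP hs) kap_inj kap12 (fr_c hs) _ (ids_codom hcod) (T_wf seed_okT hcod l)).
  move=> h; apply/eqP/(@intr_inj C)/(mulfI (fr_e hs l))/h => [k|k].
    by rewrite /iotaC /two_at => /negPf ->.
  have [_ hd _ _] := fr_gamP hs (ltn_ord k).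
  by apply: contraTneq hd => ->; rewrite -leqNgt kap12.
rewrite hn in hjl.
have eok := entry_okP seed_ok' cod_kap' l.
have /and5P [wfT _ _ z12 /andP [zT pT]] := eok.1.
have [_ h2 h3 _] := sg.
pose vs' := [seq tact g v | v <- ids es'].
have hvs' : {subset vs' <= codom km}.
  move=> v /mapP [u]; rewrite -cod_kap' => /codomP [l' ->] ->.
  by rewrite tact_kap' codom_f.
have eok' := eok.1.
apply: (mutated_exch_unique (fr_gamP hs) kap_inj kap12 (fr_c hs) seed_okT hcod (fr_e hs)
  (fr_exch hs) w12 wids hexp hx hvs' _ _ _ _ _ _ hz hdv _ hjl).
- apply/allP => d /mapP [d' hd' ->]; apply/allP => k /mapP [k' hk' ->].
  have /orP[k12|kids] := allP (allP wfT _ hd') _ hk'.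
    by have [h1 _ _ _] := sg; rewrite (h1 _ k12).1.
  by rewrite /vs' map_f ?orbT.
- rewrite -env'_menv.
  exact: (primeb_laurent_prime gamP' kap'_inj kap'12 cm0 (ids_codom cod_kap') wfT pT).
- rewrite -env'_menv; exact: (entry_nonunit gamP' kap'_inj kap'12 cm0 (ids_codom cod_kap') eok').
- move=> l' q; rewrite -env'_menv.
  by apply: (entry_X_free gamP' kap'_inj kap'12 cm0 _ eok') => v; rewrite cod_kap'.
- by move=> l'; apply: (pt12 z12); exact: kap'12.
- rewrite evalzE [LHS]ev_prename -[RHS](eqP zT) evalzE.
  have /and4P [_ _ /allP hr _] := seed_ok'.
  apply: (eq_ev wfT) => k hk0; congr (pt _ _); apply: (h3 _ _).1.
  have := hk0; rewrite unfold_in => /orP[k12|/hr /andP[]//].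
  exact: ltn_trans k12 _.
- by have [_ _ /(_ l) []] := sok.
Qed.

Lemma framed_mutation : exists e',
  framed pi s' (etarget ent) gam' del' kap' cm e'.
Proof.
have [e' e'0 he'] := fin_all_exists2 step_exch.
have [_ [m [hm hcl hj _ _]]] := hmut.
exists e'; split=> //; first by have [] := step_check.
- exact: cod_kap'.
- move=> l; have -> : gam' (kap' l) = gam (km l) by rewrite -(tact_kap' l).
  case: (eqVneq l i) => [->|li].
    by rewrite (fr_partner hpi hs hm hcl) /cmid /kmid eqxx.
  by rewrite (hj l li) (fr_cluster hs) /cmid /kmid (negPf li).
Qed.

End MutationStep.

(** * Seeds of the structure *)

Lemma ev_initial (S : comNzRingType) (f : nat -> S) :
  let F v := ev f (epoly (entry_at (seedn 0) v)) in
  ([/\ F 13 = f 30 + f 0 * f 1,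
    F 14 = f 2 * f 13 * (f 30 + f 10 * f 16) + f 9 * f 15 * (f 30 + f 1 * f 0)
      + f 13 * f 15 * (f 7 * f 16 + f 4 * f 0),
    F 15 = f 30 + f 3 * f 14 + f 10 * f 16,
    F 16 = f 11 * (f 30 + f 3 * f 14)
      + f 15 * (f 4 * f 13 + f 6 * f 14 + f 1 * f 9) &
    F 30 = f 13 * f 16 * (f 5 * f 14 + f 7 * f 15 + f 2 * f 10)
      + f 0 * f 15 * (f 4 * f 13 + f 1 * f 9)
      + f 0 * f 14 * (f 6 * f 15 + f 8 * f 16 + f 3 * f 11)])%R.
Proof.
move=> F; rewrite {}/F; split;
  match goal with |- ev f ?p = _ =>
    let q := eval vm_compute in p in change p with q end;
  rewrite /ev !big_cons !big_nil; ring.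
Qed.

Section Main.
Local Open Scope ring_scope.
Variables (R : realType) (A6 : idomainType).
Variable pi : {rmorphism ambient R -> A6}.
Hypothesis hpi : coordinate_ring pi.
Local Notation C := (complex R).
Local Notation A := (coef_ring R).
Local Notation P := {mpoly A[5]}.
Local Notation F := {fraction A6}.
Local Notation rho := (gen_val pi).
Local Notation ecst := (const_emb pi).

Definition kap_init (l : 'I_5) : nat := nth 0%N (ids (seedn 0)) l.

Lemma framed_initial : framed pi (initial_seed pi) 0 id id kap_init (fun=> 1) (fun=> 1).
Proof.
have inj : injective kap_init.
  have u : uniq (ids (seedn 0)) by vm_compute.
  have sz (l : 'I_5) : (l < size (ids (seedn 0)))%N by exact: ltn_ord.
  by move=> l l' /eqP; rewrite /kap_init (nth_uniq _ (sz l) (sz l') u) => /eqP/val_inj.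
have k12 l : (12 <= kap_init l)%N by case: l => [[|[|[|[|[|]]]]] ?].
split=> //.
- move=> v; apply/codomP/idP => [[l ->]|hv]; first exact: mem_nth.
  have hi : (index v (ids (seedn 0)) < 5)%N by rewrite -[5%N]/(size (ids (seedn 0))) index_mem.
  by exists (Ordinal hi); rewrite /kap_init nth_index.
- by move=> _; exact: oner_neq0.
- by move=> _; exact: oner_neq0.
- move=> l; rewrite (rmorph1 (const_emb pi)) mul1r.
  by case: l => [[|[|[|[|[|]]]]] ?]; rewrite /initial_seed /= ?(tnth_nth 0).
move=> l; rewrite (rmorph1 (@cst R)) mul1r; apply: esym.
set f := frame_env _ _ _.
have fX k (hk : (k < 5)%N) : f (kap_init (Ordinal hk)) = 'X_(@inZp 4 k).
  rewrite /f (env_kap _ _ inj k12) invr1 (rmorph1 (@cst R)) mul1r.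
  congr 'X_(_); apply: val_inj; exact: (esym (modn_small hk)).
have h1 : f 13 = 'X_(@inZp 4 0) := fX 0%N isT.
have h2 : f 14 = 'X_(@inZp 4 1) := fX 1%N isT.
have h3 : f 15 = 'X_(@inZp 4 2) := fX 2%N isT.
have h4 : f 16 = 'X_(@inZp 4 3) := fX 3%N isT.
have h5 : f 30 = 'X_(@inZp 4 4) := fX 4%N isT.
have fz : f 0%N = frz R 12 by rewrite /f /frame_env /frz; congr ('X_(_))%:MP; exact: val_inj.
have fa k : (k < 12)%N -> f k = frz R k by move=> hk; rewrite /f /frame_env hk.
have [e1 e2 e3 e4 e5] := ev_initial f.
rewrite h1 h2 h3 h4 h5 fz ?(fa _ isT) in e1 e2 e3 e4 e5.
by case: l => [[|[|[|[|[|]]]]] ?]; [exact: e1|exact: e2|exact: e3|exact: e4|exact: e5|].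
Qed.

Lemma lpa_framed s : cayley_lpa_seed pi s -> exists n gam del kap c e,
  framed pi s n gam del kap c e.
Proof.
elim=> [|s' t i _ [n [gam [del [kap [c [e h]]]]]] hm].
  by exists 0%N, id, id, kap_init, (fun=> 1), (fun=> 1); exact: framed_initial.
have [e' h'] := framed_mutation hpi h hm.
by do 6!eexists; exact: h'.
Qed.

Section Normalised.
Variables (s : cayley_seed R A6) (n : nat) (gam del : nat -> nat).
Variables (kap : 'I_5 -> nat) (c e : 'I_5 -> C).
Hypothesis hs : framed pi s n gam del kap c e.
Hypothesis hnorm : normalised pi s.

Lemma fr_lt44 v : (v < 44)%N -> (gam v < 44)%N.
Proof. by move=> hv; exact: (symmetry_lt44 (fr_sym hs) hv).1. Qed.

(** The [l]-th variable is a generator, and is also [c l] times a generator. *)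
Lemma normalised_c_gt0 l : 0 < c l.
Proof.
have [/(_ l) /(representative_rho) [k /andP [_ hk] ek] _] := hnorm.
apply: (proportional_gt0 hpi hk (fr_lt44 _)); last by rewrite -ek (fr_cluster hs).
by have /andP [] := fr_kap_range hs l.
Qed.

(** The constant [newc] of the variable obtained by mutation is positive for the
    same reason, and it is [e l] up to factors that are already known to be
    positive. *)
Lemma normalised_e_gt0 l : 0 < e l.
Proof.
have [_ /(_ l) [m [w [hm hw hcl]]]] := hnorm.
have [k /andP [_ hk] ek] := representative_rho hw.
have ew := fr_partner hpi hs hm hcl.
have /andP [_ w44] := fr_partner_range hs l.
have : 0 < newc kap c (seedn n) e l.
  by apply: (proportional_gt0 hpi hk (fr_lt44 w44)); rewrite -ek ew.
rewrite /newc pmulr_lgt0; first by rewrite pmulr_lgt0 // invr_gt0 normalised_c_gt0.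
by apply: prodr_gt0 => j _; rewrite invr_gt0 normalised_c_gt0.
Qed.

Lemma normalised_exch_positive i : positive_coefs (exch s i).
Proof.
rewrite (fr_exch hs); apply: positive_coefsM.
  by apply: positive_coefs_cst; rewrite ltW ?normalised_e_gt0.
apply: (positive_coefs_ev (T_wf (fr_seed_ok hs) (fr_cod hs) i)) => k.
move=> /orP [k12|]; last rewrite -(fr_cod hs) => /codomP [l ->].
  by rewrite /frame_env k12; exact: positive_coefs_frozen.
rewrite (env_kap _ _ (fr_inj hs) (fr_kap12 hs)).
apply: positive_coefsM; last exact: positive_coefsX.
by apply: positive_coefs_cst; rewrite invr_ge0 ltW ?normalised_c_gt0.
Qed.

Lemma normalised_expansion w : is_representative pi w ->
  laurent_positive pi (cluster s) w.
Proof.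
move=> /representative_rho [k hk ->].
have [_ h2 h3 _] := fr_sym hs.
have /andP [_ k44] := hk; have [_ ek] := h3 k k44; have [_ hdk] := h2 k hk.
rewrite -ek.
have hch : chain_ok relations (ids (seedn n)) (ids (seedn n)) (nth [::] expansion_chains n).
  by apply: (allP chains_ok); rewrite mem_iota; case: hs.
apply: (chain_expansions hpi _ (fr_sym hs) (fr_cod hs) normalised_c_gt0
  (fr_cluster hs) hch hdk) => l.
rewrite (fr_cluster hs) mulf_neq0 ?(fr_rho_neq0 hpi hs) //.
by apply: ecst_neq0; exact: (fr_c hs).
Qed.

End Normalised.
End Main.

Theorem corollary5p5 (R : realType) (A6 : idomainType)
    (pi : {rmorphism ambient R -> A6}) (hpi : coordinate_ring pi) :
  (forall s : cayley_seed R A6, cayley_lpa_seed pi s -> normalised pi s ->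
     forall i : 'I_5, positive_coefs (exch s i)) /\
  (forall s t : cayley_seed R A6,
     cayley_lpa_seed pi s -> normalised pi s ->
     cayley_lpa_seed pi t -> normalised pi t ->
     forall j : 'I_5, laurent_positive pi (cluster s) (cluster t j)).
Proof.
split=> [s hs ns i|s t hs ns ht nt j].
  have [n [gam [del [kap [c [e h]]]]]] := lpa_framed hpi hs.
  exact: (normalised_exch_positive hpi h ns).
have [n [gam [del [kap [c [e h]]]]]] := lpa_framed hpi hs.
by apply: (normalised_expansion hpi h ns); have [] := nt.
Qed.
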